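(* Let $X$ be the $\psi$-super-Brownian motion described in the context, with $\psi'(0^+)\in(-\infty,0)$ and $\psi(\infty)=\infty$. Let $\lambda^*>0$ be the largest root of $\psi$, $\underline\lambda=\sqrt{-2\psi'(0^+)}$, and $c_\lambda=-\psi'(0^+)/\lambda+\lambda/2$ for $\lambda>0$ (so $c_{\underline\lambda}=\underline\lambda$, and $c_\lambda$ ranges over $[\underline\lambda,\infty)$ for $\lambda\in(0,\underline\lambda]$). (i) If $\int^\infty\left(\int_{\lambda^*}^\xi\psi(u)\,du\right)^{-1/2}d\xi<\infty$, then no travelling waves with wave speed $c$ exist for $c\in[0,c_{\underline\lambda})$. (ii) A travelling wave with wave speed $c$ exists if $c\ge c_{\underline\lambda}$. In particular, for each $\lambda\in(0,\underline\lambda]$ there exists a travelling wave with wave speed $c_\lambda$ which may be written in the form $$\Phi_{c_\lambda}(x)=-\log\mathbb E\left[e^{-e^{-\lambda x}\Delta(\lambda)}\right],\qquad x\in\mathbb R,$$ where $\Delta(\lambda)$ is a non-negative random variable such that the event $\{\Delta(\lambda)=0\}$ agrees with $\mathcal E$, $\mathbb P$-almost surely. (iii) For $\lambda\in(0,\underline\lambda]$ there is, up to an additive shift in its argument, a unique travelling wave with wave speed $c_\lambda$. (iv) For $\lambda\in(0,\underline\lambda]$ and $\Phi_{c_\lambda}$ the travelling wave with wave speed $c_\lambda$, there exist a constant $k_\lambda\in(0,\infty)$ and a function $L_\lambda:(0,\infty)\to(0,\infty)$, slowly varying at $0$, such that $$\lim_{x\to\infty}\frac{\Phi_{c_\lambda}(x)}{e^{-\lambda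 x}L_\lambda(e^{-\lambda x})}=k_\lambda .$$
   Context: Branching mechanism: $\psi(\lambda)=-\alpha\lambda+\beta\lambda^2+\int_{(0,\infty)}(e^{-\lambda x}-1+\lambda x)\,\nu(dx)$, $\lambda\ge0$, where $\alpha=-\psi'(0^+)\in(0,\infty)$, $\beta\ge0$, $\nu$ is a measure on $(0,\infty)$ with $\int_{(0,\infty)}(x\wedge x^2)\,\nu(dx)<\infty$, and $\psi(\infty)=\infty$. Then $\psi$ is strictly convex with exactly two roots in $[0,\infty)$, namely $0$ and $\lambda^*>0$. $\psi$-super-Brownian motion: the Markov process $X=\{X_t:t\ge0\}$ with values in the finite measures $\mathcal M_F(\mathbb R)$ on $\mathbb R$, with law $\mathbb P_\mu$ when $X_0=\mu$, such that for bounded continuous $f\ge0$, $-\log\mathbb E_\mu(e^{-\langle f,X_t\rangle})=\int_{\mathbb R}u_f(x,t)\,\mu(dx)$, where $\langle f,\mu\rangle=\int f\,d\mu$ and $u_f$ is the unique positive solution of $\partial_tu_f=\frac12\partial_x^2u_f-\psi(u_f)$ with $u_f(x,0)=f(x)$. Write $\mathbb P=\mathbb P_{\delta_0}$, $\mathbb E$ for its expectation, $\|\mu\|=\langle1,\mu\rangle$, and $\mathcal E=\{\lim_{t\to\infty}\|X_t\|=0\}$. Travelling wave with wave speed $c\ge0$: a non-negative, non-increasing solution $\Phi_c:\mathbb R\to[0,\infty)$ of $\frac12\Phi_c''+c\Phi_c'-\psi(\Phi_c)=0$ on $\mathbb R$ with $\Phi_c(-\infty)=\lambda^*$ and $\Phi_c(+\infty)=0$.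 A function $L:(0,\infty)\to(0,\infty)$ is slowly varying at $0$ if $L(az)/L(z)\to1$ as $z\downarrow0$ for every $a>0$. *)

(* Defs.v *)
From HB Require Import structures.
From mathcomp Require Import all_boot all_order all_algebra.
From mathcomp Require Import all_classical all_reals all_analysis.
From mathcomp Require Import measurable_realfun.

Set Implicit Arguments.
Unset Strict Implicit.
Unset Printing Implicit Defensive.

Import Order.TTheory GRing.Theory Num.Theory.
Import numFieldNormedType.Exports.

Local Open Scope classical_set_scope.
Local Open Scope ring_scope.

(* [psi] is only constrained on [0, +oo[, and [nu] only enters through its
   restriction to ]0, +oo[.  The parameter [alpha] is - psi'(0+), so [0 < alpha]
   says that psi'(0+) is negative (and finite). *)
Definition branching_mechanism (R : realType) (psi : R -> R) : Prop :=
  exists (alpha beta : R) (nu : {measure set (measurableTypeR R) -> \bar R}),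
    [/\ 0 < alpha,
        0 <= beta,
        (\int[nu]_(x in `]0%R, +oo[) (Num.min x (x ^+ 2))%:E < +oo)%E,
        (forall l : R, 0 <= l ->
           psi l = - alpha * l + beta * l ^+ 2
             + \int[nu]_(x in `]0%R, +oo[) (expR (- (l * x)) - 1 + l * x))
      & psi x @[x --> +oo] --> +oo].

(* psi'(0+), as a one-sided derivative at 0. *)
Definition right_derive0 (R : realType) (psi : R -> R) : R :=
  lim (h^-1 * (psi h - psi 0) @[h --> 0^'+]).

Definition largest_root (R : realType) (psi : R -> R) (ls : R) : Prop :=
  [/\ 0 < ls, psi ls = 0 & forall x : R, 0 <= x -> psi x = 0 -> x <= ls].

Definition lambda_min (R : realType) (psi : R -> R) : R :=
  Num.sqrt (- 2 * right_derive0 psi).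

Definition wave_speed (R : realType) (psi : R -> R) (l : R) : R :=
  - right_derive0 psi / l + l / 2.

Definition travelling_wave (R : realType) (psi : R -> R) (ls c : R)
    (Phi : R -> R) : Prop :=
  [/\ (forall x, 0 <= Phi x) /\ (forall x y : R, x <= y -> Phi y <= Phi x),
      (forall x : R, derivable Phi x 1 /\ derivable (derive1 Phi) x 1),
      (forall x, 2^-1 * derive1 (derive1 Phi) x + c * derive1 Phi x - psi (Phi x) = 0),
      Phi x @[x --> -oo] --> ls
    & Phi x @[x --> +oo] --> (0 : R)].

Definition bounded_continuous (R : realType) (f : R -> R) : Prop :=
  continuous f /\ exists M : R, forall x, `|f x| <= M.

(* [u x t] is a classical non-negative solution for [t > 0], jointly continuous
   up to [t = 0].  Boundedness on finite time intervals is the class in which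
   uniqueness holds: when the Keller-Osserman integral of [psi] diverges there
   can be further, spatially unbounded, non-negative solutions. *)
Definition evolution_solution (R : realType) (psi f : R -> R)
    (u : R -> R -> R) : Prop :=
  [/\ (forall x t : R, 0 <= t -> 0 <= u x t),
      (forall T : R, exists M : R, forall x t : R, 0 <= t <= T -> u x t <= M),
      {within [set p : R * R | 0 <= p.2], continuous (fun p => u p.1 p.2)},
      (forall x t : R, 0 < t ->
         [/\ derivable (u x) t 1,
             derivable (u ^~ t) x 1,
             derivable (derive1 (u ^~ t)) x 1
           & derive1 (u x) t = 2^-1 * derive1 (derive1 (u ^~ t)) x - psi (u x t)])
    & (forall x, u x 0 = f x)].

Definition unique_evolution_solution (R : realType) (psi f : R -> R)
    (u : R -> R -> R) : Prop :=
  evolution_solution psi f u /\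
  forall v, evolution_solution psi f v ->
    forall x t : R, 0 <= t -> v x t = u x t.

Definition finite_measures (R : realType) : Type :=
  {finite_measure set (measurableTypeR R) -> \bar R}.

HB.instance Definition _ (R : realType) := gen_eqMixin (finite_measures R).
HB.instance Definition _ (R : realType) := gen_choiceMixin (finite_measures R).

Definition dirac_zero (R : realType) : finite_measures R :=
  dirac (0%R : measurableTypeR R).

HB.instance Definition _ (R : realType) :=
  isPointed.Build (finite_measures R) (@dirac_zero R).

Definition evaluation_sets (R : realType) : set (set (finite_measures R)) :=
  [set G | exists (B : set (measurableTypeR R)) (Y : set (\bar R)),
     [/\ measurable B, measurable Y & G = [set m : finite_measures R | Y (m B)]]].

(* The space M_F(R), with the sigma-algebra generated by the evaluations
   [m |-> m B] (the Borel sigma-algebra of the weak topology). *)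
Definition MF (R : realType) : measurableType (@evaluation_sets R).-sigma :=
  g_sigma_algebraType (@evaluation_sets R).

Definition to_finite_measure (R : realType) (m : MF R) :
  {finite_measure set (measurableTypeR R) -> \bar R} := m.

Definition pairing (R : realType) (f : R -> R) (m : MF R) : R :=
  \int[to_finite_measure m]_(x in setT) f x.

Definition natural_filtration (R : realType) (d : measure_display)
    (W : measurableType d)
    (X : R -> W -> MF R) (s : R) : set (set W) :=
  <<s [set A | exists (r : R) (G : set (MF R)),
         [/\ 0 <= r <= s, measurable G & A = X r @^-1` G]] >>.

(* [X t] is the position at time [t >= 0] (negative times are irrelevant) and
   [P mu] is the law started from [mu].  Two measures may differ as Rocq objects
   off the measurable sets, hence the form of [sbm_start]. *)
Record super_brownian_motion (R : realType) (psi : R -> R)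
    (d : measure_display) (W : measurableType d) (X : R -> W -> MF R)
    (P : MF R -> probability W R) : Prop := {
  sbm_measurable : forall t : R, 0 <= t -> measurable_fun setT (X t);
  sbm_start : forall mu, \forall w \ae P mu,
    forall B : set (measurableTypeR R), measurable B ->
      to_finite_measure (X 0 w) B = to_finite_measure mu B;
  sbm_right_continuous : forall w (f : R -> R) (t : R),
    bounded_continuous f -> 0 <= t ->
    pairing f (X s w) @[s --> t^'+] --> pairing f (X t w);
  sbm_kernel : forall (t : R) (G : set (MF R)), 0 <= t -> measurable G ->
    measurable_fun setT (fun mu => P mu (X t @^-1` G));
  sbm_markov : forall mu (s t : R) (A : set W) (G : set (MF R)),
    0 <= s -> 0 <= t -> natural_filtration X s A -> measurable G ->
    (P mu (A `&` X (s + t)%R @^-1` G)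
       = \int[P mu]_(w in A) P (X s w) (X t @^-1` G))%E;
  sbm_laplace : forall f : R -> R,
    bounded_continuous f -> (forall x, 0 <= f x) ->
    exists2 u : R -> R -> R, unique_evolution_solution psi f u &
      forall mu (t : R), 0 <= t ->
        - ln (fine 'E_(P mu) [ fun w => expR (- pairing f (X t w)) ])
          = pairing (u ^~ t) mu
}.

Definition extinguishing (R : realType) (W : Type) (X : R -> W -> MF R) :
    set W :=
  [set w | pairing (cst 1) (X t w) @[t --> +oo] --> (0 : R)].

(* Finiteness of the integral "at infinity": the lower limit is any K > ls
   (at ls itself the integrand has a non-integrable singularity). *)
Definition integral_condition (R : realType) (psi : R -> R) (ls : R) : Prop :=
  exists2 K : R, ls < K &
    (\int[@lebesgue_measure R]_(xi in `[K, +oo[)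
       ((Num.sqrt (\int[@lebesgue_measure R]_(u in `[ls, xi]) psi u)%R)^-1)%:E
     < +oo)%E.

Definition slowly_varying0 (R : realType) (L : R -> R) : Prop :=
  (forall z : R, 0 < z -> 0 < L z) /\
  forall a : R, 0 < a -> L (a * z) / L z @[z --> 0^'+] --> (1 : R).

(* Main.v *)
(* Along a wave, [w = - Phi' / Phi] solves the Riccati equation
   [w' = w^2 - 2 c w - 2 psi(Phi) / Phi], where [- psi(Phi) / Phi <= alpha] tends
   to [alpha] at [+oo].  If [c^2 < 2 alpha] then [w] blows up, so that there is
   no wave; if [c = alpha / l + l / 2] with [l <= c] then [w <= l] and [w] tends
   to [l], which gives the slow variation of [e^(l x) Phi x].  Existence and
   uniqueness come from the phase plane, where the squared slope, as a function
   of the height, solves a first order equation.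

   Since [Phi(x - c t)] solves the evolution equation, [exp(- <Phi(. + c n), X_n>)]
   is a bounded martingale with mean [exp(- Phi 0)]; let [exp(- Delta)] be its
   limit.  As [Phi(z + x) / Phi z] tends to [e^(- l x)] when [z] tends to [+oo],
   shifting [Phi] by [x] multiplies [Delta] by [e^(- l x)], provided that the mass
   of [X_n] to the left of [- c n + A] is negligible; this follows from an explicit
   supersolution of the linearised equation which decays in the frame moving at
   the minimal speed.  Finally [exp(- lambda^* |X_t|)] is a martingale whose second
   moment converges to its first one, so that its limit is the indicator function
   of extinction, and both [{Delta = 0}] and extinction have probability
   [exp(- lambda^* )]. *)
Require Import Defs.
From HB Require Import structures.
From mathcomp Require Import all_boot all_order all_algebra.
From mathcomp Require Import all_classical all_reals all_analysis.
From mathcomp Require Import measurable_realfun giry ring lra.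

Set Implicit Arguments.
Unset Strict Implicit.
Unset Printing Implicit Defensive.

Import Order.TTheory GRing.Theory Num.Theory.
Import numFieldNormedType.Exports.

Local Open Scope classical_set_scope.
Local Open Scope ring_scope.

(** * Calculus on the line *)

(** [Delta] is extracted from a wave that is already there, not the other way round: waves are built
    by ODE arguments alone, and then any wave of speed [c] yields a random variable. In this way the
    critical rate [sqrt(2 al)] needs no separate treatment. The price is one estimate at that rate:
    in the frame moving at the minimal speed a pure exponential solves the linearised equation
    without decaying, so it cannot show that the mass far to the left disappears. A correction
    gaining a factor of order [T^(-1/5)] does. Two probabilistic points are kept elementary. The
    wave martingale is only needed along a subsequence, because its limit is identified through
    Laplace transforms; orthogonality of increments is enough for that. Extinction is a statement in
    continuous time, reached from a discrete martingale inequality on refining dyadic grids together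
    with right continuity. Finally [extinguishing X] is not known to be measurable; it is caught
    between a measurable subset and the event [Delta = 0], which have the same probability. *)

Section calculus.
Context {R : realType}.
Implicit Types (f g D dD df : R -> R) (a b c x y : R).

Lemma is_derive1_continuous f x l : is_derive x 1 f l -> {for x, continuous f}.
Proof. by move=> h; apply/differentiable_continuous/derivable1_diffP; case: h. Qed.

Lemma is_derive_shift f x a l :
  is_derive (x + a) 1 f l -> is_derive x 1 (fun z => f (z + a)) l.
Proof.
move=> h; have -> : (fun z => f (z + a)) = f \o (fun z : R => z + a) by [].
have hg : is_derive x 1 (fun z : R => z + a) 1.
  by apply: is_derive_eq; rewrite addr0.
by have := @is_derive1_comp R f (fun z => z + a) x _ _ h hg; rewrite mulr1.
Qed.

Lemma derive_le0_le f df a b : a <= b ->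
  (forall x, a < x < b -> is_derive x 1 f (df x)) ->
  (forall x, a < x < b -> df x <= 0) ->
  (forall x, a <= x <= b -> {for x, continuous f}) -> f b <= f a.
Proof.
rewrite le_eqVlt => /predU1P[<-//|ab] fd fle fc.
have fcw : {within `[a, b], continuous f}.
  by apply: continuous_in_subspaceT => x; rewrite inE /= in_itv /=; exact: fc.
have fd' x : x \in `]a, b[ -> is_derive x 1 f (df x) by rewrite in_itv; exact: fd.
have [x] := MVT ab fd' fcw.
rewrite in_itv /= => xab e; rewrite -subr_le0 e.
by rewrite mulr_le0_ge0 ?fle// subr_ge0 ltW.
Qed.

Lemma derive_ge0_le f df a b : a <= b ->
  (forall x, a < x < b -> is_derive x 1 f (df x)) ->
  (forall x, a < x < b -> 0 <= df x) ->
  (forall x, a <= x <= b -> {for x, continuous f}) -> f a <= f b.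
Proof.
move=> ab fd fge fc; rewrite -lerN2.
apply: (@derive_le0_le (- f) (fun x => - df x) a b ab) => [x h|x h|x h].
- by apply: is_deriveN; apply: fd.
- by rewrite oppr_le0; apply: fge.
- by apply: continuousN; apply: fc.
Qed.

(** After the last point of [[a, b]] where [D <= 0], [D] is positive, hence nonincreasing, and
    cannot have left zero. The differential inequality is thus only needed where the comparison
    fails, which is how all the first order comparisons below are obtained. *)
Lemma barrier D dD a b : a <= b ->
  (forall x, a <= x <= b -> {for x, continuous D}) ->
  (forall x, a < x < b -> 0 < D x -> is_derive x 1 D (dD x)) ->
  (forall x, a < x < b -> 0 < D x -> dD x <= 0) ->
  D a <= 0 -> D b <= 0.
Proof.
move=> ab Dc Dd Dle Da; rewrite leNgt; apply/negP => Db.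
pose S := [set x | a <= x <= b /\ D x <= 0].
have Sa : S a by split; rewrite ?lexx.
have hS : has_sup S by split; [exists a|exists b => x [/andP[]]].
set s := sup S.
have as_ : a <= s by apply: ub_le_sup => //; case: hS.
have sb : s <= b by apply: ge_sup; [exists a|move=> x [/andP[]]].
have Ds : D s <= 0.
  rewrite leNgt; apply/negP => Ds.
  have /nbhs_ballP[e /= e0 he] : \forall x \near s, 0 < D x.
    by apply: (cvgr_gt (D s) (Dc s _)); rewrite // as_.
  have [x Sx xs] := @sup_adherent R S e e0 hS.
  have xs' : x <= s by apply: ub_le_sup => //; case: hS.
  have : 0 < D x.
    apply: he; rewrite /ball /= ger0_norm ?subr_ge0//.
    by rewrite ltrBlDr -ltrBlDl.
  by case: Sx => _; rewrite leNgt => /negP.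
have pos x : s < x < b -> 0 < D x.
  move=> /andP[sx xb]; rewrite ltNge; apply/negP => Dx.
  have : x <= s by apply: ub_le_sup; [case: hS|split=> //; rewrite (ltW xb) (le_trans as_ (ltW sx))].
  by rewrite leNgt sx.
have in_ x : s < x < b -> a < x < b.
  by move=> /andP[sx xb]; rewrite xb (le_lt_trans as_ sx).
have : D b <= D s.
  apply: (@derive_le0_le D dD) => // x h.
  - by apply: Dd; [exact: in_|exact: pos].
  - by apply: Dle; [exact: in_|exact: pos].
  - by move: h => /andP[sx xb]; apply: Dc; rewrite xb (le_trans as_).
by move=> h; have := lt_le_trans Db (le_trans h Ds); rewrite ltxx.
Qed.

Lemma is_derive_expRM (k x : R) :
  is_derive x 1 (fun y : R => expR (k * y)) (k * expR (k * x)).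
Proof.
have hg : is_derive x 1 (fun y : R => k * y) k.
  by apply: is_derive_eq; rewrite /GRing.scale /= !(mulr1, mul1r, mulr0, addr0).
have := @is_derive1_comp R expR (fun y => k * y) x _ _ (is_derive_expR _) hg.
by rewrite mulrC.
Qed.

Lemma is_derive_expR_comp f x l :
  is_derive x 1 f l -> is_derive x 1 (fun y => expR (f y)) (l * expR (f x)).
Proof.
by move=> h; rewrite mulrC; exact: (is_derive1_comp (is_derive_expR (f x)) h).
Qed.

(** The weight [e^(C x)] makes [g] nondecreasing and [e^(- C x)] makes it nonincreasing, so the zero
    at [x0] spreads to the left and to the right. *)
Lemma gronwall0 g dg (C x0 : R) :
  (forall x, is_derive x 1 g (dg x)) -> (forall x, 0 <= g x) ->
  (forall x, `|dg x| <= C * g x) -> g x0 = 0 -> forall x, g x = 0.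
Proof.
move=> gd g0 gC gx0 x.
pose G k y : R := g y * expR (k * y).
have Gd k y : is_derive y 1 (G k) ((dg y + k * g y) * expR (k * y)).
  have h1 := is_derive_expRM k y.
  have h2 := gd y.
  by apply: is_derive_eq; rewrite /GRing.scale /=; ring.
have Gc k y : {for y, continuous (G k)} by apply: is_derive1_continuous (Gd k y).
have e0 k : 0 < expR (k * x) by apply: expR_gt0.
have Gle k : G k x <= 0 -> g x = 0.
  by rewrite /G pmulr_lle0// => h; apply/eqP; rewrite eq_le h g0.
have Gx0 k : G k x0 = 0 by rewrite /G gx0 mul0r.
have [xx0|/ltW xx0] := leP x x0.
  apply: (Gle C); rewrite -(Gx0 C); apply: derive_ge0_le => // y _.
  by rewrite mulr_ge0 ?expR_ge0// -lerBlDr sub0r; have := gC y; rewrite ler_norml => /andP[].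
apply: (Gle (- C)); rewrite -(Gx0 (- C)); apply: derive_le0_le => // y _.
rewrite mulr_le0_ge0 ?expR_ge0// mulNr subr_le0.
by have := gC y; rewrite ler_norml => /andP[].
Qed.

End calculus.

(** * Branching mechanisms *)

(** This is all that is retained of the integral form of [psi]: convexity, the slope at the origin
    and the two roots. Convexity supplies every bound used later, including local Lipschitz
    continuity. *)
Record mechanism (R : realType) (psi : R -> R) (al ls : R) : Prop := Mechanism {
  mech_al : 0 < al;
  mech_ls : 0 < ls;
  mech_convex : forall x y t, 0 <= x -> 0 <= y -> 0 <= t <= 1 ->
    psi (t * x + (1 - t) * y) <= t * psi x + (1 - t) * psi y;
  mech_slope : psi h / h @[h --> 0^'+] --> - al;
  mech_psi0 : psi 0 = 0;
  mech_psils : psi ls = 0 }.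

Section mechanism.
Context {R : realType} {psi : R -> R} {al ls : R}.
Hypothesis M : mechanism psi al ls.
Implicit Types x y u v m : R.

Let al0 := mech_al M.
Let ls0 := mech_ls M.

Lemma mech_slope_mono x y : 0 < x <= y -> psi x / x <= psi y / y.
Proof.
move=> /andP[x0 xy]; have y0 := lt_le_trans x0 xy.
have t01 : 0 <= x / y <= 1.
  by rewrite divr_ge0 ?(ltW x0) ?(ltW y0)//= ler_pdivrMr// mul1r.
have := mech_convex M (ltW y0) (lexx 0) t01.
rewrite mulr0 addr0 (mech_psi0 M) mulr0 addr0 divfK ?gt_eqF// => h.
by rewrite ler_pdivrMr// (le_trans h)// mulrC mulrAC mulrA.
Qed.

(** The slopes of the chords from the origin decrease to [- al] at 0. This bound by the tangent is
    what compares the nonlinear equations with their linearisation at 0. *)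
Lemma mech_ge u : 0 <= u -> - al * u <= psi u.
Proof.
rewrite le_eqVlt => /predU1P[<-|u0]; first by rewrite mulr0 (mech_psi0 M).
rewrite -ler_pdivlMr//.
apply: (cvgr_to_le (mech_slope M)); near=> h.
apply: mech_slope_mono; apply/andP; split; near: h; first exact: nbhs_right_gt.
exact: nbhs_right_le.
Unshelve. all: by end_near. Qed.

Lemma mech_near_lt0 : exists2 d : R, 0 < d < ls & psi d < 0.
Proof.
have h1 : \forall h \near 0^'+, psi h / h < 0.
  by apply: (cvgr_lt (- al) (mech_slope M)); rewrite oppr_lt0.
near (0:R)^'+ => d.
have d0 : 0 < d by near: d; exact: nbhs_right_gt.
have pd : psi d / d < 0 by near: d.
exists d; last by move: pd; rewrite pmulr_llt0 ?invr_gt0.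
by rewrite d0; near: d; exact: nbhs_right_lt.
Unshelve. all: by end_near. Qed.

(** The slope at 0 gives one negative value, at [d]; monotonicity of the chords from the origin
    spreads it to the left of [d], convexity against the root [ls] to the right. *)
Lemma mech_lt0 u : 0 < u < ls -> psi u < 0.
Proof.
move=> /andP[u0 uls]; have [d /andP[d0 dls] pd] := mech_near_lt0.
have [ud|du] := leP u d.
  have := @mech_slope_mono u d; rewrite u0 ud => /(_ isT) h.
  have : psi u / u < 0 by apply: le_lt_trans h _; rewrite pmulr_llt0 ?invr_gt0.
  by rewrite pmulr_llt0 ?invr_gt0.
have dl : 0 < ls - d by rewrite subr_gt0.
pose t := (ls - u) / (ls - d).
have t0 : 0 < t by rewrite divr_gt0// subr_gt0.
have t1 : t <= 1 by rewrite ler_pdivrMr// mul1r lerB// ltW.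
have t01 : 0 <= t <= 1 by rewrite (ltW t0).
have := mech_convex M (ltW d0) (ltW ls0) t01.
rewrite (mech_psils M) mulr0 addr0.
have -> : t * d + (1 - t) * ls = u.
  by rewrite /t; field; rewrite gt_eqF.
by move=> h; apply: le_lt_trans h _; rewrite pmulr_rlt0.
Qed.

Lemma mech_le0 u : 0 <= u <= ls -> psi u <= 0.
Proof.
move=> /andP[]; rewrite le_eqVlt => /predU1P[<-|u0]; rewrite ?(mech_psi0 M)//.
rewrite le_eqVlt => /predU1P[->|ul]; rewrite ?(mech_psils M)//.
by rewrite ltW// mech_lt0// u0.
Qed.

Lemma mech_gt0 u : ls < u -> 0 < psi u.
Proof.
move=> lsu; have [d /andP[d0 dls] pd] := mech_near_lt0.
have du : 0 < u - d by rewrite subr_gt0 (lt_trans dls).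
pose t := (u - ls) / (u - d).
have t0 : 0 < t by rewrite divr_gt0// subr_gt0.
have t1 : t < 1 by rewrite ltr_pdivrMr// mul1r ltrD2l ltrN2.
have t01 : 0 <= t <= 1 by rewrite (ltW t0) ltW.
have := mech_convex M (ltW d0) (ltW (lt_trans ls0 lsu)) t01.
have -> : t * d + (1 - t) * u = ls.
  by rewrite /t; field; rewrite gt_eqF.
rewrite (mech_psils M) => h.
have : 0 < (1 - t) * psi u.
  rewrite -[ltLHS](subrr (t * psi d)) ltrBlDl (lt_le_trans _ h)//.
  by rewrite pmulr_rlt0.
by rewrite pmulr_rgt0// subr_gt0.
Qed.

Lemma mech_ndecr x y : ls <= x -> x <= y -> psi x <= psi y.
Proof.
move=> lx xy; have x0 := lt_le_trans ls0 lx; have y0 := lt_le_trans x0 xy.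
have py : 0 <= psi y.
  have := le_trans lx xy; rewrite le_eqVlt => /predU1P[<-|/mech_gt0/ltW//].
  by rewrite (mech_psils M).
have := @mech_slope_mono x y; rewrite x0 xy => /(_ isT).
rewrite ler_pdivrMr// => h; apply: le_trans h _.
by rewrite mulrAC ler_pdivrMr// ler_wpM2l.
Qed.

(** By convexity the slopes on [[0, m]] lie between [- al] and the slope of a chord ending at
    [m + 1]. Such a chord has length at least 1, so its slope is bounded by the increment of [psi]
    along it, and hence by [K]. *)
Lemma mech_lipschitz m : 0 <= m -> exists2 K : R, 0 < K &
  forall x y, 0 <= x <= m -> 0 <= y <= m -> `|psi x - psi y| <= K * `|x - y|.
Proof.
move=> m0; pose K := `|psi (m + 1)| + al * m + al; exists K.
  by rewrite ltr_wpDl// addr_ge0// mulr_ge0// ltW.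
suff H x y : 0 <= x -> x < y -> y <= m -> `|psi x - psi y| <= K * `|x - y|.
  move=> x y /andP[x0 xm] /andP[y0 ym].
  have [xy|yx|->] := ltgtP x y; first exact: H.
    by rewrite distrC (distrC x); exact: H.
  by rewrite !subrr !normr0 mulr0.
move=> x0 xy ym; rewrite distrC (distrC x).
have yx : 0 < y - x by rewrite subr_gt0.
have y0 := le_lt_trans x0 xy.
rewrite (gtr0_norm yx) ler_norml; apply/andP; split.
  have h1 : psi x <= x / y * psi y.
    have t01 : 0 <= x / y <= 1.
      by rewrite divr_ge0 ?(ltW y0)//= ler_pdivrMr// mul1r ltW.
    have := mech_convex M (ltW y0) (lexx 0) t01.
    by rewrite mulr0 addr0 (mech_psi0 M) mulr0 addr0 divfK ?gt_eqF.
  have h2 : - al * (y - x) <= psi y - psi x.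
    have : - al * (y - x) <= psi y / y * (y - x).
      by rewrite ler_pM2r// ler_pdivlMr// mech_ge// ltW.
    move/le_trans; apply; rewrite mulrBr divfK ?gt_eqF// lerB// (le_trans h1)//.
    by rewrite le_eqVlt; apply/orP; left; apply/eqP; ring.
  apply: le_trans h2; rewrite -mulNr ler_pM2r// lerN2 /K lerDr addr_ge0//.
  by rewrite mulr_ge0// ltW.
have xm := lt_le_trans xy ym.
have d1 : 1 <= m + 1 - x by rewrite lerBrDl lerD2r ltW.
have d0 : 0 < m + 1 - x by apply: lt_le_trans d1.
pose t := (m + 1 - y) / (m + 1 - x).
have t01 : 0 <= t <= 1.
  rewrite divr_ge0 ?ler_pdivrMr ?mul1r ?(ltW d0)//=.
    by rewrite lerD2l lerN2 ltW.
  by rewrite subr_ge0 (le_trans ym)// lerDl.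
have := mech_convex M x0 (addr_ge0 m0 ler01) t01.
have -> : t * x + (1 - t) * (m + 1) = y by rewrite /t; field; rewrite gt_eqF.
have e : 1 - t = (y - x) / (m + 1 - x) by rewrite /t; field; rewrite gt_eqF.
move=> h; have h' : psi y - psi x <= (1 - t) * (psi (m + 1) - psi x) by lra.
apply: le_trans h' _; rewrite e mulrAC ler_pdivrMr// mulrC.
have h3 : psi (m + 1) - psi x <= K.
  rewrite /K -addrA lerD ?ler_norm//.
  have := mech_ge x0; have : al * x <= al * m by rewrite ler_pM2l// ltW.
  by have := al0; lra.
have K0 : 0 <= K by rewrite addr_ge0 ?addr_ge0// ?mulr_ge0// ltW.
apply: (@le_trans _ _ (K * (y - x))); first by rewrite ler_pM2r.
by rewrite ler_peMr// mulr_ge0// ltW.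
Qed.

Lemma mech_comp_continuous (f : R -> R) : continuous f ->
  (forall x, 0 <= f x) -> continuous (psi \o f).
Proof.
move=> fc f0 x; have m0 : 0 <= f x + 1 by rewrite addr_ge0.
have [K K0 hK] := mech_lipschitz m0.
apply/cvgrPdist_le => e e0.
have h1 : \forall y \near x, `|f x - f y| <= e / K.
  by move/cvgrPdist_le: (fc x); apply; rewrite divr_gt0.
have h2 : \forall y \near x, f y <= f x + 1.
  by apply: (cvgr_le (f x) (fc x)); rewrite ltrDl.
near=> y; apply: (@le_trans _ _ (K * `|f x - f y|)).
  apply: hK; first by rewrite f0/= lerDl.
  by rewrite f0/=; near: y.
by rewrite mulrC -ler_pdivlMr//; near: y.
Unshelve. all: by end_near. Qed.

End mechanism.

(** * From the integral form of the branching mechanism to convexity and slope *)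

Section branching_mechanism.
Context {R : realType}.
Implicit Types (x y l u : R).

Local Notation cexp l x := (expR (- (l * x)) - 1 + l * x).

Lemma cexp_ge0 l x : 0 <= cexp l x.
Proof. by have := expR_ge1Dx (- (l * x)); lra. Qed.

(** The two bounds match the two sides of [min x (x^2)]. The quadratic one comes from
    [e^(- y) <= 1 / (1 + y)] and [(1 - y + y^2) (1 + y) = 1 + y^3]. *)
Lemma cexp_le l x : 0 <= l -> 0 < x ->
  cexp l x <= l * x /\ cexp l x <= (l * x) ^+ 2.
Proof.
move=> l0 x0; have y0 : 0 <= l * x by rewrite mulr_ge0// ltW.
set y := l * x in y0 *.
have e1 : expR (- y) <= 1 by rewrite -expR0 ler_expR oppr_le0.
split; first lra.
have e2 : expR (- y) <= (1 + y)^-1.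
  by rewrite expRN lef_pV2 ?posrE ?expR_gt0 ?expR_ge1Dx// ltr_pwDl.
have e3 : (1 + y)^-1 <= 1 - y + y ^+ 2.
  rewrite -[leLHS]mul1r ler_pdivrMr ?ltr_pwDl//.
  have -> : (1 - y + y ^+ 2) * (1 + y) = 1 + y ^+ 3 by ring.
  by rewrite lerDl exprn_ge0.
lra.
Qed.

Lemma convex_expR_real x y t : 0 <= t <= 1 ->
  expR (t * x + (1 - t) * y) <= t * expR x + (1 - t) * expR y.
Proof.
move=> /andP[t0 t1]; set z := t * x + _.
have h w : expR z * (1 + (w - z)) <= expR w.
  have -> : expR w = expR z * expR (w - z) by rewrite -expRD addrC subrK.
  by rewrite ler_pM2l ?expR_gt0// expR_ge1Dx.
have h1 : t * (expR z * (1 + (x - z))) <= t * expR x by rewrite ler_wpM2l.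
have h2 : (1 - t) * (expR z * (1 + (y - z))) <= (1 - t) * expR y.
  by rewrite ler_wpM2l ?subr_ge0.
have e : expR z = t * (expR z * (1 + (x - z))) + (1 - t) * (expR z * (1 + (y - z))).
  by rewrite /z; ring.
by rewrite e lerD.
Qed.

Context (nu : {measure set (measurableTypeR R) -> \bar R}).
Let D : set (measurableTypeR R) := `]0%R, +oo[%classic.
Hypothesis nufin : (\int[nu]_(x in D) (Num.min x (x ^+ 2))%:E < +oo)%E.

Let mD : measurable D. Proof. exact: measurable_itv. Qed.

Let continuous_mfun (f : R -> R) : continuous f ->
  measurable_fun D (EFin \o (f : measurableTypeR R -> R)).
Proof.
move=> fc; apply/measurable_EFinP; apply: (@measurable_funS _ _ _ _ setT) => //.
exact: continuous_measurable_fun.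
Qed.

Let gpos x : D x -> 0 <= Num.min x (x ^+ 2).
Proof.
by rewrite /D /= in_itv /= andbT => x0; rewrite le_min (ltW x0) exprn_ge0// ltW.
Qed.

Let mcexp l : measurable_fun D (EFin \o (fun x : measurableTypeR R => cexp l x)).
Proof.
apply: continuous_mfun => x.
apply: cvgD; last by apply: cvgM; [exact: cvg_cst|exact: cvg_id].
apply: cvgB; last exact: cvg_cst.
apply: continuous_comp; last exact: continuous_expR.
by apply: cvgN; apply: cvgM; [exact: cvg_cst|exact: cvg_id].
Qed.

Let ming_integrable : nu.-integrable D (EFin \o (fun x => Num.min x (x ^+ 2))).
Proof.
apply/integrableP; split.
  apply: continuous_mfun => x; apply: (@continuous_min _ _ id (fun y => y ^+ 2)); first exact: cvg_id.
  exact: exprn_continuous.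
rewrite [ltLHS](_ : _ = \int[nu]_(x in D) (Num.min x (x ^+ 2))%:E)%E//.
by apply: eq_integral => x; rewrite inE => Dx /=; rewrite ger0_norm// gpos.
Qed.

Let cexp_le_min l x : 0 <= l -> D x ->
  cexp l x <= (l + l ^+ 2) * Num.min x (x ^+ 2).
Proof.
move=> l0; rewrite /D /= in_itv /= andbT => x0.
have [h1 h2] := cexp_le l0 x0.
have [xx|xx] := leP x (x ^+ 2).
  by rewrite (le_trans h1)// ler_wpM2r ?(ltW x0)// lerDl exprn_ge0.
by rewrite (le_trans h2)// exprMn ler_wpM2r ?exprn_ge0 ?(ltW x0)// lerDr.
Qed.

Let cexp_integrable l : 0 <= l ->
  nu.-integrable D (EFin \o (fun x => cexp l x)).
Proof.
move=> l0; apply: (@le_integrable _ _ _ _ _ mD _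
  (fun x => (l + l ^+ 2)%:E * (Num.min x (x ^+ 2))%:E)%E) => //.
- move=> x Dx /=; rewrite lee_fin !ger0_norm ?cexp_ge0 ?cexp_le_min//.
  by rewrite mulr_ge0 ?gpos// addr_ge0// exprn_ge0.
- exact: integrableZl.
Qed.

Let cint l := \int[nu]_(x in D) cexp l x.

Let cint_convex l u t : 0 <= l -> 0 <= u -> 0 <= t <= 1 ->
  cint (t * l + (1 - t) * u) <= t * cint l + (1 - t) * cint u.
Proof.
move=> l0 u0 t01; have /andP[t0 t1] := t01.
have t1' : 0 <= 1 - t by rewrite subr_ge0.
have il := cexp_integrable l0; have iu := cexp_integrable u0.
rewrite /cint -!RintegralZl// -RintegralD//; last 2 first.
- exact: (@integrableZl _ _ _ _ _ mD t _ il).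
- exact: (@integrableZl _ _ _ _ _ mD (1 - t) _ iu).
apply: le_Rintegral => //.
- by apply: cexp_integrable; rewrite addr_ge0// mulr_ge0.
- apply: (@integrableD _ _ _ _ _ mD (fun x => (t * cexp l x)%:E)
    (fun x => ((1 - t) * cexp u x)%:E)).
    exact: (@integrableZl _ _ _ _ _ mD t _ il).
  exact: (@integrableZl _ _ _ _ _ mD (1 - t) _ iu).
move=> x Dx.
have := convex_expR_real (- (l * x)) (- (u * x)) t01.
have -> : t * - (l * x) + (1 - t) * - (u * x) = - ((t * l + (1 - t) * u) * x) by ring.
by move=> h; lra.
Qed.

(** Dominated convergence: divided by [l], the integrand is at most [l x^2], which tends to 0, and
    for [l <= C] it stays below [(1 + C) min x (x^2)], integrable by hypothesis. *)
Let cint_slope : cint h / h @[h --> 0^'+] --> (0:R).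
Proof.
apply/cvg_at_rightP => u [u0 ucvg].
have [C [C0 uC]] : exists C : R, 0 <= C /\ forall n, u n <= C.
  have [C [_ hC]] := cvg_seq_bounded (cvgP _ ucvg).
  exists (`|C| + 1); split; first by rewrite addr_ge0.
  move=> n; apply: le_trans (ler_norm _) _; apply: hC => //.
  by rewrite (le_lt_trans (ler_norm _))// ltrDl.
have un0 n : u n != 0 by rewrite gt_eqF.
pose g (n : nat) (x : R) := (cexp (u n) x / u n)%:E.
have gi n : nu.-integrable D (g n).
  apply: (eq_integrable mD _ _ _ (@integrableZr _ _ _ _ _ mD (u n)^-1 _ (cexp_integrable (ltW (u0 n))))).
  by move=> x _ /=; rewrite /g EFinM.
have -> : (fun n => cint (u n) / u n) = (fun n => fine (\int[nu]_(x in D) g n x))%E.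
  apply/funext => n; rewrite /cint mulrC -RintegralZl//; last exact: cexp_integrable (ltW (u0 n)).
  by rewrite /Rintegral; congr fine; apply: eq_integral => x _; rewrite /g mulrC.
suff h : (\int[nu]_(x in D) g n x)%E @[n --> \oo] --> (\int[nu]_(x in D) cst 0%E x)%E.
  by apply: (@fine_cvg _ _ _ _ _ 0); move: h; rewrite integral0.
apply: (@dominated_cvg _ _ _ nu D mD g _ (fun x => (1 + C)%:E * (Num.min x (x ^+ 2))%:E)%E).
- by move=> n; apply: measurable_int (gi n).
- move=> x; rewrite /D /= in_itv /= andbT => x0.
  apply: cvg_EFin; first by near=> n.
  apply: (@squeeze_cvgr _ _ _ _ (cst 0) (fun n => u n * x ^+ 2)).
  + near=> n; rewrite /= divr_ge0 ?cexp_ge0 ?(ltW (u0 n))//=.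
    rewrite ler_pdivrMr// (le_trans (cexp_le (ltW (u0 n)) x0).2)//.
    by rewrite exprMn [u n ^+ 2]expr2 mulrAC.
  + exact: cvg_cst.
  + by rewrite -[0](mul0r (x ^+ 2)); apply: cvgMr_tmp.
- by [].
- exact: integrableZl.
- move=> n x Dx; rewrite /g -EFinM lee_fin ger0_norm ?divr_ge0 ?cexp_ge0 ?(ltW (u0 n))//.
  rewrite ler_pdivrMr// (le_trans (cexp_le_min (ltW (u0 n)) Dx))//.
  rewrite [leRHS]mulrAC ler_wpM2r ?gpos//.
  have := uC n; have := u0 n; nra.
Unshelve. all: by end_near. Qed.

Lemma branching_mechanism_convex (psi : R -> R) (al be ls : R) :
  0 < al -> 0 <= be ->
  (forall l, 0 <= l -> psi l = - al * l + be * l ^+ 2 + cint l) ->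
  0 < ls -> psi ls = 0 -> mechanism psi al ls.
Proof.
move=> al0 be0 hpsi ls0 psils; split => //.
- move=> x y t x0 y0 t01; have /andP[t0 t1] := t01.
  rewrite !hpsi//; last by rewrite addr_ge0// mulr_ge0// subr_ge0.
  have := cint_convex x0 y0 t01.
  have : be * (t * x + (1 - t) * y) ^+ 2 <= be * (t * x ^+ 2 + (1 - t) * y ^+ 2).
    rewrite ler_wpM2l// -subr_ge0.
    have -> : t * x ^+ 2 + (1 - t) * y ^+ 2 - (t * x + (1 - t) * y) ^+ 2 =
      t * (1 - t) * (x - y) ^+ 2 by ring.
    by rewrite mulr_ge0 ?sqr_ge0// mulr_ge0// subr_ge0.
  lra.
- have -> : - al = - al + be * 0 + 0 by ring.
  apply: (@cvg_trans _ ((- al + be * h + cint h / h) @[h --> 0^'+])).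
    apply: near_eq_cvg; near=> h.
    have h0 : 0 < h by near: h; exact: nbhs_right_gt.
    by rewrite hpsi ?(ltW h0)//; field; rewrite gt_eqF.
  apply: cvgD; last exact: cint_slope.
  apply: cvgD; first exact: cvg_cst.
  apply: cvg_at_right_filter; apply: cvgM; [exact: cvg_cst|exact: cvg_id].
- rewrite hpsi// mulr0 expr0n mulr0 !add0r /cint.
  rewrite /Rintegral integral0_eq// => x _.
  by rewrite mul0r oppr0 expR0 subrr addr0.
Unshelve. all: by end_near. Qed.

End branching_mechanism.

Lemma branching_mechanismW (R : realType) (psi : R -> R) (ls : R) :
  branching_mechanism psi -> largest_root psi ls ->
  exists2 al, mechanism psi al ls & right_derive0 psi = - al.
Proof.
move=> [al [be [nu [al0 be0 nufin hpsi _]]]] [ls0 psils _].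
have M := branching_mechanism_convex nufin al0 be0 hpsi ls0 psils.
exists al => //; rewrite /right_derive0; apply/cvg_lim => //.
have := mech_slope M; rewrite (mech_psi0 M).
by under eq_fun do rewrite mulrC -{1}[psi _]subr0.
Qed.

Section limits_at_infinity.
Context {R : realType}.
Implicit Types (f : R -> R) (l e : R).

Lemma cvgy_dist f l e : f x @[x --> +oo] --> l -> 0 < e ->
  exists X, forall x, X <= x -> `|f x - l| < e.
Proof.
move=> fl e0; have [M [_ hM]] := (cvgrPdist_lt _ _).1 fl e e0.
by exists (M + 1) => x Mx; rewrite distrC; apply: hM; rewrite (lt_le_trans _ Mx)// ltrDl.
Qed.

Lemma cvgNy_dist f l e : f x @[x --> -oo] --> l -> 0 < e ->
  exists X, forall x, x <= X -> `|f x - l| < e.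
Proof.
move=> fl e0; have [M [_ hM]] := (cvgrPdist_lt _ _).1 fl e e0.
exists (M - 1) => x Mx; rewrite distrC; apply: hM; rewrite (le_lt_trans Mx)// ltrBlDr ltrDl.
exact: ltr01.
Qed.

End limits_at_infinity.

(** * Travelling waves *)

Section travelling_wave.
Context {R : realType} {psi : R -> R} {al ls : R}.
Hypothesis M : mechanism psi al ls.
Let al0 := mech_al M.
Let ls0 := mech_ls M.
Context {c : R} {Phi : R -> R}.
Hypothesis W : travelling_wave psi ls c Phi.
Implicit Types x y z : R.

Let Phi0 x : 0 <= Phi x. Proof. by case: W => -[]. Qed.

Lemma wave_nincr x y : x <= y -> Phi y <= Phi x.
Proof. by case: W => -[_ h] _ _ _ _; exact: h. Qed.

Lemma wave_is_derive x : is_derive x 1 Phi (derive1 Phi x).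
Proof. by case: W => _ /(_ x)[h _] _ _ _; rewrite derive1E; exact: derivableP. Qed.

Lemma wave_is_derive2 x : is_derive x 1 (derive1 Phi) (2 * psi (Phi x) - 2 * c * derive1 Phi x).
Proof.
case: W => _ /(_ x)[_ h] /(_ x) eqn _ _.
have -> : 2 * psi (Phi x) - 2 * c * derive1 Phi x = 'D_1 (derive1 Phi) x.
  by move: eqn; rewrite -derive1E; lra.
exact: derivableP.
Qed.

Lemma wave_continuous : continuous Phi.
Proof. by move=> x; exact: is_derive1_continuous (wave_is_derive x). Qed.

Lemma wave_cvgNy : Phi x @[x --> -oo] --> ls. Proof. by case: W. Qed.

Lemma wave_cvgy : Phi x @[x --> +oo] --> (0 : R). Proof. by case: W. Qed.

Lemma wave_le_ls x : Phi x <= ls.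
Proof.
apply: (cvgr_to_ge wave_cvgNy); near=> y; apply: wave_nincr; near: y.
exact: nbhs_ninfty_le (num_real _).
Unshelve. all: by end_near. Qed.

Lemma wave_derive_le0 x : derive1 Phi x <= 0.
Proof.
have := wave_is_derive x => -[h1 <-].
have := h1 => /cvg_ex[l hl]; rewrite /derive (cvg_lim _ hl)//.
have hl' : h^-1 *: (Phi (h *: 1 + x) - Phi x) @[h --> 0^'+] --> l.
  exact: cvg_dnbhs_at_right hl.
apply: (cvgr_to_le hl'); near=> h.
have h0 : 0 < h by near: h; exact: nbhs_right_gt.
rewrite /GRing.scale /= pmulr_rle0 ?invr_gt0// subr_le0; apply: wave_nincr.
by rewrite lerDr mulr1 ltW.
Unshelve. all: by end_near. Qed.

Let psi_diff b : b = 0 \/ b = ls ->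
  exists2 K : R, 0 < K & forall x, `|psi (Phi x)| <= K * `|Phi x - b|.
Proof.
move=> hb; have [K K0 hK] := mech_lipschitz M (ltW ls0); exists K => // y.
have pb : psi b = 0 by case: hb => ->; rewrite ?(mech_psi0 M) ?(mech_psils M).
have := hK (Phi y) b; rewrite pb subr0; apply; first by rewrite Phi0 wave_le_ls.
by case: hb => ->; rewrite ?lexx ltW.
Qed.

(** Uniqueness for the wave equation at an equilibrium: [psi (Phi)] is at most of the order of
    [Phi - b], so [E] satisfies a Gronwall inequality in both directions. *)
Let stationary_cst b x0 : b = 0 \/ b = ls -> Phi x0 = b -> derive1 Phi x0 = 0 ->
  forall x, Phi x = b.
Proof.
move=> hb e1 e2 x.
have [K K0 hK] := psi_diff hb.
pose E z := (Phi z - b) ^+ 2 + derive1 Phi z ^+ 2.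
have dE z : is_derive z 1 E (2 * (Phi z - b) * derive1 Phi z +
    2 * derive1 Phi z * (2 * psi (Phi z) - 2 * c * derive1 Phi z)).
  have h1 := wave_is_derive z; have h2 := wave_is_derive2 z.
  by apply: is_derive_eq; rewrite /GRing.scale /=; ring.
have : E x = 0.
  apply: (gronwall0 (C := 1 + 2 * K + 4 * `|c|) (x0 := x0) dE) => [z|z|].
  - by rewrite addr_ge0 ?sqr_ge0.
  - rewrite /E; set A := Phi z - b; set B := derive1 Phi z; set p := psi _.
    have hp : `|p| <= K * `|A| by exact: hK.
    have hAB : 2 * (`|A| * `|B|) <= A ^+ 2 + B ^+ 2.
      rewrite -(real_normK (num_real A)) -(real_normK (num_real B)).
      have := sqr_ge0 (`|A| - `|B|); lra.
    have t1 : `|2 * A * B| <= A ^+ 2 + B ^+ 2.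
      by rewrite !normrM ger0_norm// -mulrA.
    have t2 : `|4 * B * p| <= 2 * K * (A ^+ 2 + B ^+ 2).
      rewrite !normrM (ger0_norm (ler0n _ 4)).
      apply: (@le_trans _ _ (4 * `|B| * (K * `|A|))).
        by rewrite ler_wpM2l// mulr_ge0.
      have : K * (2 * (`|A| * `|B|)) <= K * (A ^+ 2 + B ^+ 2) by rewrite ler_pM2l.
      lra.
    have t3 : `|4 * c * B ^+ 2| <= 4 * `|c| * (A ^+ 2 + B ^+ 2).
      rewrite normrM (ger0_norm (sqr_ge0 B)) normrM (ger0_norm (ler0n _ 4)).
      by rewrite ler_wpM2l ?lerDr ?sqr_ge0// mulr_ge0.
    have -> : 2 * A * B + 2 * B * (2 * p - 2 * c * B) =
       2 * A * B + 4 * B * p - 4 * c * B ^+ 2 by ring.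
    apply: (le_trans (ler_normB _ _)).
    apply: (@le_trans _ _ (`|2 * A * B| + `|4 * B * p| + `|4 * c * B ^+ 2|)).
      by rewrite lerD2r ler_normD.
    lra.
  - by rewrite /E e1 e2 subrr expr0n addr0.
move/eqP; rewrite paddr_eq0 ?sqr_ge0// sqrf_eq0 => /andP[/eqP/subr0_eq].
by [].
Qed.

Let not_cst b : (b = 0 \/ b = ls) -> ~ forall x, Phi x = b.
Proof.
move=> hb h; have hc : Phi = cst b by apply/funext.
have e1 : b = ls.
  apply: (cvg_unique _ _ wave_cvgNy) => //; rewrite hc; exact: cvg_cst.
have e2 : b = 0.
  apply: (cvg_unique _ _ wave_cvgy) => //; rewrite hc; exact: cvg_cst.
by move: ls0; rewrite -e1 e2 ltxx.
Qed.

Let dPhi x := @ex_derive _ _ _ _ _ _ _ (wave_is_derive x).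

Let in_oo x : x \in `]x - 1, x + 1[.
Proof. by rewrite in_itv /= ltrBlDr !ltrDl ltr01. Qed.

(** Touching an equilibrium from one side forces a zero slope, so the wave would be constant,
    against its two distinct limits. *)
Lemma wave_gt0 x : 0 < Phi x.
Proof.
rewrite lt_neqAle Phi0 andbT eq_sym; apply/eqP => e.
have d0 : is_derive x 1 Phi 0.
  apply: (@derive1_at_min _ Phi (x - 1) (x + 1)) => //.
    by lra.
  by move=> t _; rewrite e.
apply: (@not_cst 0); first by left.
apply: (@stationary_cst 0 x) => //; first by left.
by rewrite derive1E; exact: derive_val.
Qed.

Lemma wave_lt_ls x : Phi x < ls.
Proof.
rewrite lt_neqAle wave_le_ls andbT; apply/eqP => e.
have d0 : is_derive x 1 Phi 0.
  apply: (@derive1_at_max _ Phi (x - 1) (x + 1)) => //.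
    by lra.
  by move=> t _; rewrite e wave_le_ls.
apply: (@not_cst ls); first by right.
apply: (@stationary_cst ls x) => //; first by right.
by rewrite derive1E; exact: derive_val.
Qed.

(** A zero of the slope would be a maximum of the slope, so the second derivative would vanish as
    well and the equation would give [psi (Phi x) = 0] strictly between the roots. *)
Lemma wave_derive_lt0 x : derive1 Phi x < 0.
Proof.
rewrite lt_neqAle wave_derive_le0 andbT; apply/eqP => e.
have d0 : is_derive x 1 (derive1 Phi) 0.
  apply: (@derive1_at_max _ (derive1 Phi) (x - 1) (x + 1)) => //.
  - by lra.
  - by move=> t _; have [] := wave_is_derive2 t.
  - by move=> t _; rewrite e wave_derive_le0.
have := wave_is_derive2 x => -[_]; rewrite derive_val e mulr0 subr0 => h.
have := mech_lt0 M; move=> /(_ (Phi x)); rewrite wave_gt0 wave_lt_ls => /(_ isT).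
lra.
Qed.

(** The slope equals the increment over [[x, x + 1]] at some point [z], and [Phi' + 2 c Phi] is
    nonincreasing because its derivative is [2 psi (Phi) <= 0]; this carries the bound from [z] back
    to [x]. The increment vanishes at [-oo], and so does the slope. *)
Lemma wave_derive_ge x : - (1 + 2 * `|c|) * (Phi x - Phi (x + 1)) <= derive1 Phi x.
Proof.
have xx1 : x < x + 1 by rewrite ltrDl.
have [|z] := MVT xx1 (fun y _ => wave_is_derive y).
  apply: continuous_subspaceT; exact: wave_continuous.
rewrite in_itv /= => /andP[xz zx1] e.
have hS : derive1 Phi z + 2 * c * Phi z <= derive1 Phi x + 2 * c * Phi x.
  apply: (@derive_le0_le _ (fun y => derive1 Phi y + 2 * c * Phi y)
    (fun y => 2 * psi (Phi y)) _ _ (ltW xz)) => y.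
  - move=> _; have h1 := wave_is_derive y; have h2 := wave_is_derive2 y.
    by apply: is_derive_eq; rewrite /GRing.scale /=; ring.
  - by move=> _; rewrite pmulr_rle0// (mech_le0 M)// Phi0 wave_le_ls.
  - move=> _; apply: cvgD; first exact: is_derive1_continuous (wave_is_derive2 y).
    by apply: cvgM; [exact: cvg_cst|exact: wave_continuous].
have h1 := wave_nincr (ltW xz); have h2 := wave_nincr (ltW zx1).
have h3 : `|c * (Phi x - Phi z)| <= `|c| * (Phi x - Phi (x + 1)).
  by rewrite normrM ler_wpM2l// ger0_norm; lra.
have e' : Phi (x + 1) - Phi x = derive1 Phi z by rewrite e; ring.
have := ler_norm (c * (Phi x - Phi z)); lra.
Qed.

Lemma wave_derive_cvgNy : derive1 Phi x @[x --> -oo] --> (0 : R).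
Proof.
apply: (@squeeze_cvgr _ _ _ _ (fun x => - (1 + 2 * `|c|) * (Phi x - Phi (x + 1))) (cst 0)).
- by near=> x; rewrite wave_derive_ge wave_derive_le0.
- rewrite -(mulr0 (- (1 + 2 * `|c|))) -(subrr ls); apply: cvgM; first exact: cvg_cst.
  apply: cvgB; first exact: wave_cvgNy.
  exact: cvg_comp (cvg_addrr_Ny 1) wave_cvgNy.
- exact: cvg_cst.
Unshelve. all: by end_near. Qed.

Lemma wave_onto v : 0 < v < ls -> exists x, Phi x = v.
Proof.
move=> /andP[v0 vls].
have vls' : 0 < ls - v by rewrite subr_gt0.
have [a ha] := cvgNy_dist wave_cvgNy vls'.
have [b hb] := cvgy_dist wave_cvgy v0.
have fa : v <= Phi a.
  by have := ha _ (lexx a); rewrite ltr_norml => /andP[h _]; lra.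
have fb : Phi b <= v.
  by have := hb _ (lexx b); rewrite ltr_norml => /andP[_ h]; lra.
have ab : a <= b.
  rewrite leNgt; apply/negP => /ltW/wave_nincr h.
  have fav : Phi a = v by apply/eqP; rewrite eq_le fa andbT (le_trans h).
  by have := ha _ (lexx a); rewrite fav distrC gtr0_norm ?subr_gt0// ltxx.
have [||z _ hz] := @IVT R Phi a b v ab; last by exists z.
  apply: continuous_subspaceT; exact: wave_continuous.
by rewrite ge_min fb orbT/= le_max fa.
Qed.

Lemma wave_decr x y : x < y -> Phi y < Phi x.
Proof.
move=> xy; have [|z _ e] := MVT xy (fun y _ => wave_is_derive y).
  apply: continuous_subspaceT; exact: wave_continuous.
by rewrite -subr_lt0 e nmulr_rlt0 ?wave_derive_lt0// subr_gt0.
Qed.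

Lemma wave_inj x y : Phi x = Phi y -> x = y.
Proof. by move=> e; have [/wave_decr|/wave_decr|//] := ltgtP x y; rewrite e ltxx. Qed.

End travelling_wave.

Lemma mech_slope_le (R : realType) (psi : R -> R) (al ls e : R) :
  mechanism psi al ls -> 0 < e ->
  exists2 d : R, 0 < d & forall u, 0 < u <= d -> psi u <= (- al + e) * u.
Proof.
move=> M e0.
have h1 : \forall h \near 0^'+, psi h / h < - al + e.
  by apply: (cvgr_lt (- al) (mech_slope M)); rewrite ltrDl.
near (0:R)^'+ => d.
have d0 : 0 < d by near: d; exact: nbhs_right_gt.
have pd : psi d / d < - al + e by near: d.
exists d => // u ud; have := mech_slope_mono M ud; move: ud => /andP[u0 _].
by rewrite ler_pdivrMr// => /le_trans; apply; rewrite ler_pM2r// ltW.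
Unshelve. all: by end_near. Qed.

(** * Minimal speed and exponential decay rate of a wave *)

Section wave_speed.
Context {R : realType} {psi : R -> R} {al ls : R}.
Hypothesis M : mechanism psi al ls.
Let al0 := mech_al M.
Let ls0 := mech_ls M.
Context {c : R} {Phi : R -> R}.
Hypothesis W : travelling_wave psi ls c Phi.
Implicit Types x y z e a b : R.

Let Phi0 x : 0 < Phi x. Proof. exact: (wave_gt0 M W). Qed.

Let w x : R := - (derive1 Phi x) / Phi x.

Let w_derive x : is_derive x 1 w (w x ^+ 2 - 2 * c * w x - 2 * (psi (Phi x) / Phi x)).
Proof.
have h1 := wave_is_derive W x; have h2 := wave_is_derive2 W x.
have Pn0 : Phi x != 0 by rewrite gt_eqF.
have h3 := is_deriveV Pn0 h1.
by apply: is_derive_eq; rewrite /GRing.scale /= /w; field.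
Qed.

Let w_continuous : continuous w.
Proof. by move=> x; exact: is_derive1_continuous (w_derive x). Qed.

Let w0 x : 0 <= w x.
Proof. by rewrite divr_ge0 ?(ltW (Phi0 _))// oppr_ge0 (wave_derive_le0 W). Qed.

Let slope_le e : 0 < e -> exists X, forall x, X <= x ->
  psi (Phi x) / Phi x <= - al + e.
Proof.
move=> e0; have [d d0 hd] := mech_slope_le M e0.
have [X hX] := cvgy_dist (wave_cvgy W) d0; exists X => x Xx.
rewrite ler_pdivrMr// hd// Phi0/=.
by have := hX _ Xx; rewrite subr0 gtr0_norm// => /ltW.
Qed.

(* The Riccati equation [w' = w^2 - 2 c w + 2 al - o(1)] solved by the
   logarithmic derivative [w] has a right-hand side bounded below by
   [(w - c)^2 + d], so that [w] would blow up in finite time. *)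
Lemma wave_speed_ge : 0 <= c -> 2 * al <= c ^+ 2.
Proof.
move=> c0; rewrite leNgt; apply/negP => ca.
pose d := (2 * al - c ^+ 2) / 2.
have d0 : 0 < d by rewrite divr_gt0// subr_gt0.
have [X hX] := slope_le (divr_gt0 d0 (ltr0Sn _ 1)).
have dw x : X <= x ->
    (w x - c) ^+ 2 + d <= w x ^+ 2 - 2 * c * w x - 2 * (psi (Phi x) / Phi x).
  by move=> Xx; have := hX _ Xx; rewrite /d; lra.
(* From [X] on, [w] is nonnegative and grows at rate at least [d], so it has passed [c + 1] at
   [Y]. *)
pose Y := X + (c + 1) / d.
have XY : X <= Y by rewrite lerDl divr_ge0 ?addr_ge0// ltW.
have wY x : Y <= x -> c + 1 <= w x.
  move=> Yx; have Xx := le_trans XY Yx.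
  have : w X - d * X <= w x - d * x.
    apply: (@derive_ge0_le _ (fun y => w y - d * y) (fun y => w y ^+ 2 -
       2 * c * w y - 2 * (psi (Phi y) / Phi y) - d) _ _ Xx) => y.
    - move=> _; have h := w_derive y.
      by apply: is_derive_eq; rewrite /GRing.scale /=; ring.
    - move=> /andP[/ltW Xy _]; have := dw _ Xy; have := sqr_ge0 (w y - c); lra.
    - move=> _; apply: cvgB; first exact: w_continuous.
      by apply: cvgM; [exact: cvg_cst|exact: cvg_id].
  have : d * (Y - X) <= d * (x - X) by rewrite ler_pM2l// lerD2r.
  have -> : d * (Y - X) = c + 1 by rewrite /Y addrC addKr mulrC divfK// gt_eqF.
  by have := w0 X; lra.
(* The reciprocal decreases at rate at least 1, is at most 1 at [Y] and must stay positive: a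
   stretch of length 2 is contradictory. *)
pose v x : R := (w x - c)^-1.
have wc x : Y <= x -> 1 <= w x - c by move=> /wY; lra.
have wc0 x : Y <= x -> 0 < w x - c by move=> /wc; exact: lt_le_trans.
have dv x : Y <= x -> is_derive x 1 v (- (w x - c) ^- 2 *
     (w x ^+ 2 - 2 * c * w x - 2 * (psi (Phi x) / Phi x))).
  move=> Yx; have wn0 : w x - c != 0 by rewrite gt_eqF// wc0.
  have h : is_derive x 1 (fun y => w y - c)
     (w x ^+ 2 - 2 * c * w x - 2 * (psi (Phi x) / Phi x)).
    by have h := w_derive x; apply: is_derive_eq; rewrite subr0.
  exact: (is_deriveV (f := fun y => w y - c) wn0 h).
have Y2 : Y <= Y + 2 by rewrite lerDl.
have : v (Y + 2) + (Y + 2) <= v Y + Y.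
  apply: (@derive_le0_le _ (fun x => v x + x) (fun x => - (w x - c) ^- 2 *
     (w x ^+ 2 - 2 * c * w x - 2 * (psi (Phi x) / Phi x)) + 1) _ _ Y2) => x.
  - by move=> /andP[/ltW Yx _]; have h := dv _ Yx; apply: is_derive_eq.
  - move=> /andP[/ltW Yx _]; have := dw _ (le_trans XY Yx).
    set r := _ - 2 * (_ / _) => hr.
    rewrite mulNr addrC subr_le0 -[leLHS](mulVf (_ : (w x - c) ^+ 2 != 0)).
      by rewrite ler_pM2l ?invr_gt0 ?exprn_gt0 ?wc0//; lra.
    by rewrite expf_neq0// gt_eqF// wc0.
  - move=> /andP[Yx _]; apply: cvgD; last exact: cvg_id.
    exact: is_derive1_continuous (dv _ Yx).
have : v Y <= 1 by rewrite invf_le1 ?wc ?wc0.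
have : 0 < v (Y + 2) by rewrite invr_gt0 wc0.
lra.
Qed.

Context {lam : R}.
Hypotheses (lam0 : 0 < lam) (lamc : lam <= c) (clam : c = al / lam + lam / 2).

Let lam2 : lam * (2 * c - lam) = 2 * al.
Proof. by rewrite clam; field; rewrite gt_eqF. Qed.

Let c2lam : lam <= 2 * c - lam.
Proof.
by rewrite lerBrDr mulr_natl mulr2n lerD.
Qed.

(** The numbers [lam] and [2 c - lam] are the roots of [r^2 - 2 c r + 2 al]. With
    [psi (Phi) >= - al Phi] this gives [G' <= - (2 c - lam) G], so [G], which has the negative limit
    [- lam ls] at [-oo], never becomes positive. *)
Lemma wave_derive_gelam x : - lam * Phi x <= derive1 Phi x.
Proof.
pose G y : R := - (derive1 Phi y + lam * Phi y).
have GNy : G y @[y --> -oo] --> - (0 + lam * ls).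
  apply: cvgN; apply: cvgD; first exact: (wave_derive_cvgNy M W).
  by apply: cvgM; [exact: cvg_cst|exact: wave_cvgNy W].
have lls : 0 < lam * ls by rewrite mulr_gt0.
have [b hb] := cvgNy_dist GNy lls.
pose a := Num.min b x.
have Ga : G a <= 0.
  have := hb a; rewrite ge_min lexx => /(_ isT); rewrite ltr_norml => /andP[_].
  by rewrite add0r opprK -ltrBrDr subrr => /ltW.
have ax : a <= x by rewrite ge_min lexx orbT.
suff : G x <= 0 by rewrite /G oppr_le0; lra.
apply: (@barrier _ G (fun y => - (2 * psi (Phi y) - 2 * c * derive1 Phi y
    + lam * derive1 Phi y)) _ _ ax) => // [y _|y _ _|y _ Gy].
- have h1 := wave_is_derive W y; have h2 := wave_is_derive2 W y.
  apply: cvgN; apply: cvgD; first exact: is_derive1_continuous h2.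
  apply: cvgM; first exact: cvg_cst.
  exact: is_derive1_continuous h1.
- have h1 := wave_is_derive W y; have h2 := wave_is_derive2 W y.
  by apply: is_derive_eq; rewrite /GRing.scale /=; ring.
- have := mech_ge M (ltW (Phi0 y)).
  have h : 0 <= (2 * c - lam) * G y.
    by rewrite mulr_ge0 ?(ltW Gy)// (le_trans (ltW lam0)).
  have : lam * (2 * c - lam) * Phi y = 2 * al * Phi y by rewrite lam2.
  by rewrite /G in h; lra.
Qed.

Lemma wave_expR_mono x y : x <= y ->
  expR (lam * x) * Phi x <= expR (lam * y) * Phi y.
Proof.
move=> xy; have hd z := is_derive_expRM lam z.
apply: (@derive_ge0_le _ (fun z => expR (lam * z) * Phi z)
  (fun z => expR (lam * z) * (derive1 Phi z + lam * Phi z)) _ _ xy) => z.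
- move=> _; have h1 := wave_is_derive W z; have h2 := hd z.
  by apply: is_derive_eq; rewrite /GRing.scale /=; ring.
- by move=> _; rewrite mulr_ge0 ?expR_ge0//; have := wave_derive_gelam z; lra.
- move=> _; apply: cvgM; first exact: is_derive1_continuous (hd z).
  exact: is_derive1_continuous (wave_is_derive W z).
Qed.

Lemma wave_shift_ge x b : 0 <= b -> expR (- (lam * b)) * Phi x <= Phi (x + b).
Proof.
move=> b0; have /wave_expR_mono : x <= x + b by rewrite lerDl.
rewrite mulrDr expRD -mulrA ler_pM2l ?expR_gt0// => h.
by rewrite expRN -ler_pdivlMl ?invr_gt0 ?expR_gt0// invrK.
Qed.

(** While [w <= lam - e], the product [(lam - w) (2 c - lam - w)] is at least [e^2], as [lam] is the
    smaller root; the case of a double root is included. Hence [w' >= e^2 / 2] far to the right, [w]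
    must reach [lam - e], and the same inequality forbids falling back. *)
Lemma wave_derive_lelam e : 0 < e < lam ->
  exists X, forall x, X <= x -> derive1 Phi x <= - (lam - e) * Phi x.
Proof.
move=> /andP[e0 elam].
suff [X hX] : exists X, forall x, X <= x -> lam - e <= w x.
  by exists X => x /hX; rewrite ler_pdivlMr//; lra.
have e20 : 0 < e ^+ 2 / 4 by rewrite divr_gt0// exprn_gt0.
have [X hX] := slope_le e20.
pose dw x : R := w x ^+ 2 - 2 * c * w x - 2 * (psi (Phi x) / Phi x).
have hdw x : X <= x -> w x <= lam - e -> e ^+ 2 / 2 <= dw x.
  move=> /hX h hw; rewrite /dw.
  have : e ^+ 2 <= (lam - w x) * (2 * c - lam - w x).
    rewrite expr2; apply: ler_pM; rewrite ?(ltW e0)//; first lra.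
    by apply: (@le_trans _ _ (lam - w x)); [lra|rewrite lerD2r].
  have := lam2; nra.
have [Y XY hY] : exists2 Y, X <= Y & lam - e <= w Y.
  have [//|noY] := pselect (exists2 Y, X <= Y & lam - e <= w Y).
  exfalso.
  have hw x : X <= x -> w x < lam - e.
    by move=> Xx; rewrite ltNge; apply/negP => h; apply: noY; exists x.
  pose Y := X + lam / (e ^+ 2 / 2).
  have e21 : 0 < e ^+ 2 / 2 by rewrite divr_gt0// exprn_gt0.
  have XY : X <= Y by rewrite lerDl divr_ge0 ?ltW.
  have : w X - e ^+ 2 / 2 * X <= w Y - e ^+ 2 / 2 * Y.
    apply: (@derive_ge0_le _ (fun y => w y - e ^+ 2 / 2 * y)
       (fun y => dw y - e ^+ 2 / 2) _ _ XY) => y.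
    - move=> _; have h := w_derive y.
      by apply: is_derive_eq; rewrite /GRing.scale /= /dw; ring.
    - move=> /andP[/ltW Xy _]; have := hdw _ Xy; have := hw _ Xy; lra.
    - move=> _; apply: cvgB; first exact: w_continuous.
      by apply: cvgM; [exact: cvg_cst|exact: cvg_id].
  have -> : e ^+ 2 / 2 * Y = e ^+ 2 / 2 * X + lam.
    by rewrite /Y; field; rewrite gt_eqF.
  by have := hw _ XY; have := w0 X; lra.
exists Y => x Yx; rewrite -subr_le0.
pose D y : R := lam - e - w y; rewrite -/(D x).
have Dc y : Y <= y <= x -> {for y, continuous D}.
  by move=> _; apply: cvgB; [exact: cvg_cst|exact: w_continuous].
have Dd y : Y < y < x -> 0 < D y -> is_derive y 1 D (- dw y).
  by move=> _ _; have h := w_derive y; apply: is_derive_eq; rewrite /dw; ring.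
have Dle y : Y < y < x -> 0 < D y -> - dw y <= 0.
  move=> /andP[/ltW Yy _] /ltW; rewrite subr_ge0 oppr_le0 => h.
  by have := hdw _ (le_trans XY Yy) h; apply: le_trans; rewrite divr_ge0// sqr_ge0.
by apply: (barrier Yx Dc Dd Dle); rewrite subr_le0.
Qed.

(** [e^(lam x) Phi x] is nondecreasing, and [e^((lam - e) x) Phi x] is eventually nonincreasing for
    every small [e]; the ratio is squeezed between the two rates. *)
Lemma wave_ratio_cvg_ge0 a : 0 <= a ->
  Phi (x + a) / Phi x @[x --> +oo] --> expR (- (lam * a)).
Proof.
move=> a0; apply/cvgrPdist_le => n n0.
have : expR (e * a - lam * a) @[e --> (0:R)] --> expR (0 * a - lam * a).
  apply: continuous_comp; last exact: continuous_expR.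
  apply: cvgB; last exact: cvg_cst.
  by apply: cvgM; [exact: cvg_id|exact: cvg_cst].
rewrite mul0r sub0r => /cvg_at_right_filter/cvgrPdist_le/(_ n n0) he.
near (0:R)^'+ => e.
have e0 : 0 < e by near: e; exact: nbhs_right_gt.
have elam : e < lam by near: e; exact: nbhs_right_lt.
have en : `|expR (- (lam * a)) - expR (e * a - lam * a)| <= n by near: e.
have [X hX] : exists X, forall x, X <= x -> derive1 Phi x <= - (lam - e) * Phi x.
  by apply: wave_derive_lelam; rewrite e0.
near=> x; have Xx : X <= x by near: x; exact: nbhs_pinfty_ge (num_real _).
have r1 : expR (- (lam * a)) <= Phi (x + a) / Phi x.
  by rewrite ler_pdivlMr// wave_shift_ge.
have r2 : Phi (x + a) / Phi x <= expR (e * a - lam * a).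
  rewrite ler_pdivrMr//.
  have xa : x <= x + a by rewrite lerDl.
  have hd z := is_derive_expRM (lam - e) z.
  have : expR ((lam - e) * (x + a)) * Phi (x + a) <= expR ((lam - e) * x) * Phi x.
    apply: (@derive_le0_le _ (fun z => expR ((lam - e) * z) * Phi z)
      (fun z => expR ((lam - e) * z) * (derive1 Phi z + (lam - e) * Phi z)) _ _ xa) => z.
    - move=> _; have h1 := wave_is_derive W z; have h2 := hd z.
      by apply: is_derive_eq; rewrite /GRing.scale /=; ring.
    - move=> /andP[/ltW xz _]; rewrite mulr_ge0_le0 ?expR_ge0//.
      by have := hX _ (le_trans Xx xz); lra.
    - move=> _; apply: cvgM; first exact: is_derive1_continuous (hd z).
      exact: is_derive1_continuous (wave_is_derive W z).
  rewrite mulrDr expRD -mulrA ler_pM2l ?expR_gt0// => h.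
  have -> : e * a - lam * a = - ((lam - e) * a) by ring.
  by rewrite expRN ler_pdivlMl ?expR_gt0.
rewrite distrC ger0_norm ?subr_ge0//; apply: le_trans en.
by rewrite distrC ger0_norm ?subr_ge0 ?lerD2r// (le_trans r1).
Unshelve. all: by end_near. Qed.

Lemma wave_ratio_cvg a :
  Phi (x + a) / Phi x @[x --> +oo] --> expR (- (lam * a)).
Proof.
have [|/ltW a0] := leP 0 a; first exact: wave_ratio_cvg_ge0.
have na0 : 0 <= - a by rewrite oppr_ge0.
have h := wave_ratio_cvg_ge0 na0.
have -> : expR (- (lam * a)) = (expR (- (lam * - a)))^-1.
  by rewrite -expRN mulrN opprK.
have := @cvg_comp _ _ _ (fun x => x + a) (fun x => Phi (x - a) / Phi x) _ _ _
  (@cvg_addrr _ a) h.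
move=> /(cvgV (lt0r_neq0 (expR_gt0 _))).
apply: cvg_trans; apply: near_eq_cvg; near=> x.
by rewrite /= addrK invf_div.
Unshelve. all: by end_near. Qed.

End wave_speed.

(** * Uniqueness of the wave up to a shift *)

Section uniqueness.
Context {R : realType} {psi : R -> R} {al ls c : R}.
Hypothesis M : mechanism psi al ls.
Context {Phi1 Phi2 : R -> R}.
Hypothesis W1 : travelling_wave psi ls c Phi1.
Hypothesis W2 : travelling_wave psi ls c Phi2.
Implicit Types x y z : R.

Lemma wave_inverse_derive (g : R -> R) x : (forall y, g (Phi2 y) = y) ->
  is_derive (Phi2 x) 1 g (derive1 Phi2 x)^-1.
Proof.
move=> gK; apply: is_derive_inverse; last 2 first.
- exact: (wave_is_derive W2).
- by rewrite lt_eqF// (wave_derive_lt0 M W2).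
- by near=> y; exact: gK.
- by near=> y; exact: (wave_continuous W2).
Unshelve. all: by end_near. Qed.

(* Both waves are compared at equal height: with [Phi2 (h x) = Phi1 x], the
   difference [D] of the squared slopes satisfies [D D' <= 0], because the terms
   in [psi] cancel, and it vanishes at [-oo]. *)
Lemma wave_unique : 0 <= c -> exists a, forall x, Phi1 x = Phi2 (x + a).
Proof.
move=> c0.
have [h hE] : exists h : R -> R, forall x, Phi2 (h x) = Phi1 x.
  suff /choice[h hE] : forall x, exists y, Phi2 y = Phi1 x by exists h.
  by move=> x; apply: (wave_onto W2); rewrite (wave_gt0 M W1) (wave_lt_ls M W1).
(* A global left inverse of [Phi2], with the junk value 0 off its range. Writing [h] as [g \o Phi1]
   gives access to the derivative of an inverse function. *)
have [g gK] : exists g : R -> R, forall y, g (Phi2 y) = y.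
  have : forall v, exists y, forall z, Phi2 z = v -> y = z.
    move=> v; have [[y yv]|nv] := pselect (exists y, Phi2 y = v).
      by exists y => z zv; apply: (wave_inj M W2); rewrite yv zv.
    by exists 0 => z zv; exfalso; apply: nv; exists z.
  by move=> /choice[g hg]; exists g => y; exact: hg.
have hg : h = g \o Phi1 by apply/funext => x; rewrite /= -hE gK.
pose a x : R := derive1 Phi1 x; pose b x : R := derive1 Phi2 (h x).
have a_lt0 x : a x < 0 := wave_derive_lt0 M W1 x.
have b_lt0 x : b x < 0 := wave_derive_lt0 M W2 (h x).
have dh x : is_derive x 1 h (a x / b x).
  rewrite hg mulrC; apply: is_derive1_comp; last exact: (wave_is_derive W1).
  by rewrite -hE; exact: wave_inverse_derive.
have da x := wave_is_derive2 W1 x.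
have db x : is_derive x 1 b ((2 * psi (Phi1 x) - 2 * c * b x) * (a x / b x)).
  have d2 := wave_is_derive2 W2 (h x); rewrite hE in d2.
  exact: (is_derive1_comp (f := derive1 Phi2) d2 (dh x)).
pose D x : R := (a x ^+ 2 - b x ^+ 2) ^+ 2.
have dD x : is_derive x 1 D
    (- 8 * c * ((a x - b x) ^+ 2 * (a x * (a x + b x)))).
  have h1 := da x; have h2 := db x; have b0 : b x != 0 by rewrite lt_eqF.
  by apply: is_derive_eq; rewrite /GRing.scale /= -/(a x); field.
have h_cvgNy : h x @[x --> -oo] --> -oo.
  apply/cvgrNyPle => B.
  have : 0 < ls - Phi2 B by rewrite subr_gt0 (wave_lt_ls M W2).
  move=> /(cvgNy_dist (wave_cvgNy W1))[X hX]; near=> x.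
  have xX : x <= X by near: x; exact: nbhs_ninfty_le (num_real _).
  rewrite leNgt; apply/negP => /ltW/(wave_nincr W2); rewrite hE.
  by have := hX _ xX; rewrite ltr_norml => /andP[]; lra.
have D_cvgNy : D x @[x --> -oo] --> (0 : R).
  have a0 : a x @[x --> -oo] --> (0 : R) := wave_derive_cvgNy M W1.
  have b0 : b x @[x --> -oo] --> (0 : R).
    exact: cvg_comp h_cvgNy (wave_derive_cvgNy M W2).
  have -> : (0 : R) = (0 * 0 - 0 * 0) * (0 * 0 - 0 * 0) by ring.
  by apply: cvgM; apply: cvgB; apply: cvgM.
have D0 x : D x = 0.
  apply/eqP; rewrite eq_le sqr_ge0 andbT.
  apply: (cvgr_to_ge D_cvgNy); near=> y.
  have yx : y <= x by near: y; exact: nbhs_ninfty_le (num_real _).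
  apply: (derive_le0_le yx (fun z _ => dD z)) => z _.
    rewrite mulr_le0_ge0//; first by rewrite mulNr oppr_le0 mulr_ge0.
    rewrite mulr_ge0 ?sqr_ge0// mulr_le0// ltW//.
    by rewrite -[ltRHS]addr0 ltrD.
  exact: is_derive1_continuous (dD z).
have ab x : a x = b x.
  have /eqP := D0 x; rewrite sqrf_eq0 subr_eq0 eqf_sqr => /orP[/eqP//|/eqP e].
  by have := a_lt0 x; have := b_lt0 x; rewrite e; lra.
have hx x : h x - x = h 0 - 0.
  apply: (@is_derive_0_is_cst _ (fun y => h y - y)) => y; have := dh y.
  rewrite ab divff ?lt_eqF// => hy.
  by apply: is_derive_eq; rewrite subrr.
exists (h 0) => x; rewrite -hE; congr Phi2.
by have := hx x; rewrite subr0 => <-; rewrite addrC subrK.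
Unshelve. all: by end_near. Qed.

End uniqueness.

(** * Existence of travelling waves *)

Section primitive.
Context {R : realType}.
Local Notation mu := (@lebesgue_measure R).
Implicit Types (f g : R -> R) (s t : R).

(** For integrands that vanish on the negative half-line. The base point is strictly negative so
    that 0 is interior to the domain of integration and the function is differentiable there too. *)
Let cumul f s : R := \int[mu]_(x in `[-1, s]) f x.

Let continuous_itv_integrable f s t : continuous f ->
  mu.-integrable `[s, t] (EFin \o f).
Proof.
move=> fc; apply: continuous_compact_integrable; first exact: segment_compact.
exact: continuous_subspaceT.
Qed.

Let cumul0 f s : (forall x, x <= 0 -> f x = 0) -> s <= 0 -> cumul f s = 0.
Proof.
move=> f0 s0; rewrite /cumul /Rintegral integral0_eq// => x /=.
by rewrite in_itv /= => /andP[_ xs]; rewrite f0// (le_trans xs).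
Qed.

Let cumul_derive f s : continuous f -> (forall x, x <= 0 -> f x = 0) ->
  is_derive s 1 (cumul f) (f s).
Proof.
move=> fc f0; have [s1|s1] := ltP (-1) s.
  have ss : s < s + 1 by rewrite ltrDl.
  have [h1 h2] := continuous_FTC1_closed ss (@continuous_itv_integrable f (-1) (s + 1) fc) s1 (fc s).
  by rewrite -h2 derive1E; exact: derivableP.
have s0 : s < 0 by rewrite (le_lt_trans s1)// ltrN10.
rewrite f0 ?(ltW s0)//.
have : is_derive s 1 (cst 0 : R -> R) 0 by exact: is_derive_cst.
apply: near_eq_is_derive.
by near=> x; rewrite /= cumul0//; apply: ltW; near: x; exact: lt_nbhsl.
Unshelve. all: by end_near. Qed.

Lemma exists_primitive0 f : continuous f -> (forall x, x <= 0 -> f x = 0) ->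
  exists F : R -> R, (forall s, is_derive s 1 F (f s)) /\ forall s, s <= 0 -> F s = 0.
Proof.
move=> fc f0; exists (cumul f); split=> s; first exact: cumul_derive.
exact: cumul0.
Qed.

Lemma derive_eq_cst f g (df : R -> R) t :
  (forall s, is_derive s 1 f (df s)) -> (forall s, is_derive s 1 g (df s)) ->
  f t = g t -> forall s, f s = g s.
Proof.
move=> fd gd ft s; apply/eqP; rewrite -subr_eq0; apply/eqP.
have d (x : R) : is_derive x 1 (fun x => f x - g x) 0.
  by have h1 := fd x; have h2 := gd x; apply: is_derive_eq; rewrite subrr.
by rewrite (is_derive_0_is_cst s t d) ft subrr.
Qed.

(** Each half of [f - f 0], extended by 0, has a primitive that vanishes on the other half-line; the
    left half is reflected, and [f 0 * x] restores the constant. *)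
Lemma exists_primitive f : continuous f ->
  exists F : R -> R, forall s, is_derive s 1 F (f s).
Proof.
move=> fc.
have half (g : R -> R) : continuous g ->
    continuous (fun x : R => g (Num.max x 0) - g 0).
  move=> gc x; apply: cvgB; last exact: cvg_cst.
  apply: continuous_comp; last exact: gc.
  by apply: (@continuous_max _ _ id (cst 0)); [exact: cvg_id|exact: cvg_cst].
have half0 (g : R -> R) (x : R) : x <= 0 -> g (Num.max x 0) - g 0 = 0.
  by move=> x0; rewrite max_r// subrr.
have fNc : continuous (fun x : R => f (- x)).
  by move=> x; apply: continuous_comp; [apply: cvgN; exact: cvg_id|exact: fc].
have [F1 [F1d _]] := exists_primitive0 (half f fc) (half0 f).
have [F2 [F2d _]] := exists_primitive0 (half _ fNc) (half0 (fun x : R => f (- x))).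
exists (fun x => F1 x - F2 (- x) + f 0 * x) => s.
have h1 := F1d s.
have h2 : is_derive s 1 (fun x => F2 (- x)) (- (f (- Num.max (- s) 0) - f (- 0))).
  have hN : is_derive s 1 (-%R : R -> R) (- 1).
    have h := @is_derive_id _ _ s (1 : R); exact: (is_deriveN h).
  by rewrite -mulrN1; exact: (is_derive1_comp (F2d (- s)) hN).
apply: is_derive_eq; rewrite /GRing.scale /=.
have [s0|/ltW s0] := leP 0 s.
  by rewrite max_r ?oppr_le0// !oppr0; ring.
by rewrite max_l ?oppr_ge0// (opprK s) !oppr0; ring.
Qed.

(** The bound on the derivatives is a Lipschitz constant common to all [n], inherited by the
    pointwise limit. This provides the continuity of the limiting right-hand side that [derive_lim]
    asks for. *)
Lemma derive_lim_continuous (y_ f_ : nat -> R -> R) (y : R -> R) :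
  (forall n s, is_derive s 1 (y_ n) (f_ n s)) ->
  (forall T, exists C : R, forall n s, s <= T -> `|f_ n s| <= C) ->
  (forall s, y_ n s @[n --> \oo] --> y s) -> continuous y.
Proof.
move=> yd fb yl s; have [C hC] := fb (s + 1).
have lip n u v : u <= v -> v <= s + 1 -> `|y_ n v - y_ n u| <= C * (v - u).
  move=> uv vs; have fle x : u < x < v -> `|f_ n x| <= C.
    by move=> /andP[_ xv]; apply: hC; rewrite (le_trans (ltW xv)).
  have cont x : {for x, continuous (y_ n)} by exact: is_derive1_continuous (yd n x).
  rewrite ler_norml; apply/andP; split.
    have : y_ n u + C * u <= y_ n v + C * v.
      apply: (@derive_ge0_le _ (fun x => y_ n x + C * x) (fun x => f_ n x + C) _ _ uv).
      - by move=> x _; have h := yd n x; apply: is_derive_eq; rewrite /GRing.scale /=; ring.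
      - by move=> x /fle; rewrite ler_norml => /andP[h _]; lra.
      - by move=> x _; apply: cvgD; [exact: cont|apply: cvgM; [exact: cvg_cst|exact: cvg_id]].
    lra.
  have : y_ n v - C * v <= y_ n u - C * u.
    apply: (@derive_le0_le _ (fun x => y_ n x - C * x) (fun x => f_ n x - C) _ _ uv).
    - by move=> x _; have h := yd n x; apply: is_derive_eq; rewrite /GRing.scale /=; ring.
    - by move=> x /fle; rewrite ler_norml => /andP[_ h]; lra.
    - by move=> x _; apply: cvgB; [exact: cont|apply: cvgM; [exact: cvg_cst|exact: cvg_id]].
  lra.
have C0 : 0 <= C by apply: le_trans (hC 0%N (s + 1) (lexx _)).
have lipy t : t <= s + 1 -> `|y s - y t| <= C * `|s - t|.
  move=> ts; apply: (cvgr_to_le (cvg_norm (cvgB (yl s) (yl t)))).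
  near=> n; have [st|/ltW st] := leP t s.
    by rewrite (ger0_norm (_ : 0 <= s - t)) ?subr_ge0// lip// lerDl.
  by rewrite distrC (distrC s) (ger0_norm (_ : 0 <= t - s)) ?subr_ge0// lip.
have hs1 : s < s + 1 by rewrite ltrDl.
apply/cvgrPdist_le => e e0; near=> t.
have ts : t <= s + 1 by apply: ltW; near: t; exact: lt_nbhsl.
apply: le_trans (lipy t ts) _.
apply: (@le_trans _ _ ((C + 1) * `|s - t|)); first by rewrite ler_wpM2r// lerDl.
rewrite mulrC -ler_pdivlMr ?ltr_wpDl//; near: t.
have := @cvg_id _ (nbhs s); move=> /cvgrPdist_le; apply.
by rewrite divr_gt0// ltr_wpDl.
Unshelve. all: by end_near. Qed.

(** In integral form, starting from 0 on the left, the equation passes to the limit by dominated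
    convergence. *)
Lemma derive_lim (y_ f_ : nat -> R -> R) (y f : R -> R) :
  (forall n s, is_derive s 1 (y_ n) (f_ n s)) ->
  (forall n, continuous (f_ n)) ->
  (forall n s, s <= 0 -> y_ n s = 0) ->
  (forall n s, s <= 0 -> f_ n s = 0) ->
  (forall T, exists C : R, forall n s, s <= T -> `|f_ n s| <= C) ->
  (forall s, y_ n s @[n --> \oo] --> y s) ->
  (forall s, f_ n s @[n --> \oo] --> f s) -> continuous f ->
  forall s, is_derive s 1 y (f s).
Proof.
move=> yd fnc yn0 fn0 fb yl fl fc.
have f0 s : s <= 0 -> f s = 0.
  move=> s0; apply: (cvg_unique _ (fl s)) => //.
  have -> : f_^~ s = cst 0 by apply/funext => n; exact: fn0.
  exact: cvg_cst.
have yE n s : y_ n s = cumul (f_ n) s.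
  apply: (derive_eq_cst (t := 0) (yd n)); last by rewrite yn0// cumul0//; exact: fn0.
  by move=> t; apply: cumul_derive => //; exact: fn0.
suff -> : y = cumul f by move=> s; exact: cumul_derive.
apply/funext => s; apply: (cvg_unique _ (yl s)) => //.
have -> : y_^~ s = (fun n => cumul (f_ n) s) by apply/funext => n; exact: yE.
have [C hC] := fb s.
have fi := continuous_itv_integrable (-1) s fc.
apply: fine_cvg; rewrite fineK; last exact: integrable_fin_num.
apply: (@dominated_cvg _ _ _ mu _ (measurable_itv _) (fun n x => (f_ n x)%:E) _ (cst C%:E)).
- by move=> n; apply: measurable_int (continuous_itv_integrable (-1) s (fnc n)).
- by move=> x _; apply: cvg_EFin; [near=> n|exact: fl].
- by [].
- by apply: continuous_itv_integrable => x; exact: cvg_cst.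
- by move=> n x; rewrite /= in_itv /= => /andP[_ xs]; rewrite lee_fin hC.
Unshelve. all: by end_near. Qed.

End primitive.

(** * Solvability of [y' = h - c sqrt(y)] from the value 0 *)

Section dissipative_equation.
Context {R : realType}.
Implicit Types (h rho y z : R -> R) (s t u v : R).

Section lipschitz.
Variables (h rho : R -> R) (K H : R).
Hypotheses (K0 : 0 <= K) (hc : continuous h) (h0 : forall s, s <= 0 -> h s = 0)
  (hH : forall s, 0 <= h s <= H).
Hypotheses (rhoc : continuous rho) (rho0 : rho 0 = 0)
  (rhoK : forall u v, u <= v -> 0 <= rho v - rho u <= K * (v - u)).

(* In terms of [z = e^(K s) y] the equation reads [z' = G(s, z)] with [G]
   nondecreasing in [z], so that the Picard iterates are monotone. *)
Let G s u : R := expR (K * s) * (h s - rho (expR (- K * s) * u)) + K * u.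

Let eeN s : expR (K * s) * expR (- K * s) = 1.
Proof. by rewrite -expRD mulNr subrr expR0. Qed.

Let G_mono s u v : u <= v -> G s u <= G s v.
Proof.
move=> uv; have e0 : 0 < expR (- K * s) by exact: expR_gt0.
have /rhoK/andP[_ hr] : expR (- K * s) * u <= expR (- K * s) * v by rewrite ler_pM2l.
have : expR (K * s) * (rho (expR (- K * s) * v) - rho (expR (- K * s) * u)) <=
    expR (K * s) * (K * (expR (- K * s) * v - expR (- K * s) * u)).
  by rewrite ler_pM2l ?expR_gt0.
have -> : expR (K * s) * (K * (expR (- K * s) * v - expR (- K * s) * u)) =
  (expR (K * s) * expR (- K * s)) * (K * (v - u)) by ring.
by rewrite eeN /G; lra.
Qed.

Let G_ge0 s v : 0 <= v -> 0 <= G s v.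
Proof.
move=> v0; apply: le_trans (G_mono s v0).
by rewrite /G !mulr0 rho0 subr0 addr0 mulr_ge0 ?expR_ge0//; case/andP: (hH s).
Qed.

Let G_le s v : 0 <= v -> G s v <= expR (K * s) * H + K * v.
Proof.
move=> v0; rewrite lerD2r ler_pM2l ?expR_gt0//.
have /rhoK/andP[+ _] : 0 <= expR (- K * s) * v by rewrite mulr_ge0// expR_ge0.
by rewrite rho0; case/andP: (hH s) => _; lra.
Qed.

Let G_0 s z : s <= 0 -> z s = 0 -> G s (z s) = 0.
Proof. by move=> /h0 hs zs; rewrite /G hs zs !mulr0 rho0 subrr mulr0 addr0. Qed.

Let G_continuous z : continuous z -> continuous (fun s => G s (z s)).
Proof.
have expc k : continuous (fun s => expR (k * s)).
  by move=> s; exact: is_derive1_continuous (is_derive_expRM k s).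
move=> zc s; apply: cvgD; last by apply: cvgM; [exact: cvg_cst|exact: zc].
apply: cvgM; first exact: expc.
apply: cvgB; first exact: hc.
apply: (@continuous_comp _ _ _ (fun s => expR (- K * s) * z s) rho); last exact: rhoc.
by apply: cvgM; [exact: expc|exact: zc].
Qed.

Let step z : continuous z -> (forall s, s <= 0 -> z s = 0) ->
  exists z', (forall s, is_derive s 1 z' (G s (z s))) /\ forall s, s <= 0 -> z' s = 0.
Proof.
move=> zc z0; apply: exists_primitive0; first exact: G_continuous.
by move=> s s0; rewrite G_0// z0.
Qed.

Let iterates : exists z_ : nat -> R -> R,
  [/\ z_ 0%N = cst 0, forall n s, s <= 0 -> z_ n s = 0 &
      forall n s, is_derive s 1 (z_ n.+1) (G s (z_ n s))].
Proof.
pose S := {z : R -> R | continuous z /\ forall s, s <= 0 -> z s = 0}.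
have next (z : S) : exists z' : S, forall s, is_derive s 1 (sval z') (G s (sval z s)).
  case: z => z [zc z0]; have [z' [dz' z'0]] := step zc z0.
  have z'c : continuous z' by move=> s; exact: is_derive1_continuous (dz' s).
  by exists (exist _ z' (conj z'c z'0)).
have [nx hnx] := choice next.
have S0 : continuous (cst 0 : R -> R) /\ forall s, s <= 0 -> (cst 0 : R -> R) s = 0.
  by split=> // s; exact: cvg_cst.
exists (fun n => sval (iter n nx (exist _ (cst 0) S0))); split=> //.
- by move=> n s s0; case: (iter n nx _) => z [_ z0] /=; exact: z0.
- by move=> n s /=; exact: hnx.
Qed.

(** The Picard iterates started at 0 increase, and remain below [H s e^(K s)], whose derivative is
    the upper bound of [G] along it. Their limit solves the equation for [z], and the factor
    [e^(- K s)] leads back to [y]. *)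
Lemma lipschitz_equation : exists y, (forall s, is_derive s 1 y (h s - rho (y s))) /\
  [/\ forall s, s <= 0 -> y s = 0, forall s, 0 <= y s & forall s, 0 <= s -> y s <= H * s].
Proof.
have [z_ [z_0 zneg dz]] := iterates.
have zc n : continuous (z_ n).
  case: n => [|n] s; first by rewrite z_0; exact: cvg_cst.
  exact: is_derive1_continuous (dz n s).
have H0 : 0 <= H by have /andP[/le_trans] := hH 0; apply.
have z0 n s : 0 <= z_ n s.
  elim: n s => [|n IH] s; first by rewrite z_0.
  have [s0|/ltW s0] := leP s 0; first by rewrite zneg.
  rewrite -(zneg n.+1 0 (lexx 0)); apply: (derive_ge0_le s0 (fun t _ => dz n t)).
    by move=> t _; exact: G_ge0.
  by move=> t _; exact: zc.
have zmono n s : z_ n s <= z_ n.+1 s.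
  elim: n s => [|n IH] s; first by rewrite [in leLHS]z_0.
  have [s0|/ltW s0] := leP s 0; first by rewrite !zneg.
  have : z_ n.+2 0 - z_ n.+1 0 <= z_ n.+2 s - z_ n.+1 s.
    apply: (@derive_ge0_le _ (fun t => z_ n.+2 t - z_ n.+1 t)
      (fun t => G t (z_ n.+1 t) - G t (z_ n t)) _ _ s0) => t _.
    - by rewrite subr_ge0 G_mono.
    - by apply: cvgB; exact: zc.
  by rewrite !(zneg _ 0 (lexx 0)) subrr subr_ge0.
have zle n s : 0 <= s -> z_ n s <= H * s * expR (K * s).
  elim: n s => [|n IH] s s0; first by rewrite z_0/= !mulr_ge0 ?expR_ge0.
  have dB t : is_derive t 1 (fun t => H * t * expR (K * t))
      (expR (K * t) * H + K * (H * t * expR (K * t))).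
    by have h2 := is_derive_expRM K t; apply: is_derive_eq; rewrite /GRing.scale /=; ring.
  have : z_ n.+1 s - H * s * expR (K * s) <= z_ n.+1 0 - H * 0 * expR (K * 0).
    apply: (@derive_le0_le _ (fun t => z_ n.+1 t - H * t * expR (K * t))
      (fun t => G t (z_ n t) - (expR (K * t) * H + K * (H * t * expR (K * t)))) _ _ s0) => t.
    - move=> /andP[/ltW t0 _]; rewrite subr_le0 (le_trans (G_le _ (z0 n t)))//.
      by rewrite lerD2l ler_wpM2l// IH.
    - move=> _; apply: cvgB; first exact: zc.
      exact: is_derive1_continuous (dB t).
  by rewrite (zneg _ 0 (lexx 0)) mulr0 mul0r subrr subr_le0.
have zcv s : cvgn (fun n => z_ n s).
  apply: (@nondecreasing_is_cvgn _ (fun n => z_ n s)).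
    by apply/nondecreasing_seqP => n; exact: zmono.
  exists (H * Num.max s 0 * expR (K * Num.max s 0)) => _ [n _ <-].
  have [s0|/ltW s0] := leP 0 s; first by rewrite zle.
  by rewrite zneg// mulr0 mul0r.
pose z s := limn (fun n => z_ n s).
have zl s : z_ n s @[n --> \oo] --> z s by exact: zcv.
have zl1 s : z_ n.+1 s @[n --> \oo] --> z s by rewrite (cvg_shiftS (z_^~ s)).
have Gb T : exists C : R, forall n s, s <= T -> `|G s (z_ n s)| <= C.
  exists (expR (K * `|T|) * H + K * (H * `|T| * expR (K * `|T|))) => n s sT.
  have [s0|/ltW s0] := leP s 0.
    by rewrite G_0 ?normr0 ?zneg// addr_ge0 ?mulr_ge0 ?expR_ge0.
  have sT' : s <= `|T| := le_trans sT (ler_norm _).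
  rewrite ger0_norm ?G_ge0// (le_trans (G_le _ (z0 _ _)))//.
  have ee : expR (K * s) <= expR (K * `|T|) by rewrite ler_expR ler_wpM2l.
  rewrite lerD ?ler_wpM2r//= ler_wpM2l// (le_trans (zle _ _ s0))//.
  by rewrite ler_pM ?mulr_ge0 ?expR_ge0// ler_wpM2l.
have zcont : continuous z.
  exact: (@derive_lim_continuous _ (fun n => z_ n.+1) (fun n s => G s (z_ n s)) z dz Gb zl1).
have zneg' s : s <= 0 -> z s = 0.
  move=> s0; apply/cvg_lim => //; have -> : z_^~ s = cst 0.
    by apply/funext => n; exact: zneg.
  exact: cvg_cst.
have dzl s : is_derive s 1 z (G s (z s)).
  apply: (@derive_lim _ (fun n => z_ n.+1) (fun n s => G s (z_ n s)) z (fun s => G s (z s))) => //.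
  - by move=> n; exact: G_continuous.
  - by move=> n t t0; exact: zneg.
  - by move=> n t t0; rewrite G_0// zneg.
  - move=> t; apply: cvgD; last by apply: cvgM; [exact: cvg_cst|exact: zl].
    apply: cvgM; first exact: cvg_cst.
    apply: cvgB; first exact: cvg_cst.
    apply: (@cvg_comp _ _ _ (fun n => expR (- K * t) * z_ n t) rho _ (nbhs (expR (- K * t) * z t))).
      by apply: cvgM; [exact: cvg_cst|exact: zl].
    exact: rhoc.
  - exact: G_continuous.
exists (fun s => expR (- K * s) * z s); split; last split.
- move=> s; have h1 := is_derive_expRM (- K) s; have h2 := dzl s.
  apply: is_derive_eq; rewrite /GRing.scale /= /G.
  transitivity ((expR (K * s) * expR (- K * s)) * (h s - rho (expR (- K * s) * z s))); first by ring.
  by rewrite eeN mul1r.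
- by move=> s s0; rewrite zneg'// mulr0.
- move=> s; rewrite mulr_ge0 ?expR_ge0//.
  by apply: (cvgr_to_ge (zl s)); near=> n; exact: z0.
- move=> s s0; rewrite mulNr expRN ler_pdivrMl ?expR_gt0// mulrC.
  by apply: (cvgr_to_le (zl s)); near=> n; exact: zle.
Unshelve. all: by end_near. Qed.

End lipschitz.

(** The square root fails to be Lipschitz exactly where the solution starts. The functions [r n] are
    Lipschitz with constant [1 / (2 d n)] and increase with [n] on [u >= 0]; a larger damping gives
    a smaller solution, so the solutions decrease with [n] and converge. *)
Lemma sqrt_equation h (c H : R) : 0 <= c -> continuous h ->
  (forall s, s <= 0 -> h s = 0) -> (forall s, 0 <= h s <= H) ->
  exists y, (forall s, is_derive s 1 y (h s - c * Num.sqrt (y s))) /\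
    ((forall s, s <= 0 -> y s = 0) /\ forall s, 0 <= y s).
Proof.
move=> c0 hc h0 hH.
have H0 : 0 <= H by have /andP[/le_trans] := hH 0; apply.
pose d (n : nat) : R := n.+1%:R^-1.
have d0 n : 0 < d n by rewrite invr_gt0.
(* a Lipschitz approximation of the square root *)
pose r n u := Num.sqrt (Num.max u 0 + d n ^+ 2) - d n.
have r0 n : r n 0 = 0.
  by rewrite /r max_l// add0r sqrtr_sqr ger0_norm ?subrr// ltW.
have rc n : continuous (r n).
  move=> u; apply: cvgB; last exact: cvg_cst.
  apply: continuous_comp; last exact: sqrt_continuous.
  apply: cvgD; last exact: cvg_cst.
  by apply: (@continuous_max _ _ id (cst 0)); [exact: cvg_id|exact: cvg_cst].
have sq_ge n u : d n <= Num.sqrt (Num.max u 0 + d n ^+ 2).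
  rewrite -[leLHS](ger0_norm (ltW (d0 n))) -sqrtr_sqr ler_wsqrtr// lerDr.
  by rewrite le_max lexx orbT.
have rK n u v : u <= v -> 0 <= r n v - r n u <= (2 * d n)^-1 * (v - u).
  move=> uv; rewrite /r opprB addrA subrK.
  set a := Num.max u 0; set b := Num.max v 0.
  have ab : a <= b by rewrite /a /b ge_max !le_max uv lexx orbT.
  have bau : b - a <= v - u.
    rewrite /a /b; case: (leP u 0) => u0; case: (leP v 0) => v0; lra.
  have a0 : 0 <= a by rewrite le_max lexx orbT.
  set A := Num.sqrt _; set B := Num.sqrt _.
  have dA : d n <= A := sq_ge n v; have dB : d n <= B := sq_ge n u.
  have A2 : A ^+ 2 = b + d n ^+ 2 by rewrite sqr_sqrtr// addr_ge0 ?sqr_ge0// (le_trans a0).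
  have B2 : B ^+ 2 = a + d n ^+ 2 by rewrite sqr_sqrtr// addr_ge0 ?sqr_ge0.
  have BA : B <= A by rewrite ler_wsqrtr// lerD2r.
  rewrite subr_ge0 BA/= mulrC ler_pdivlMr ?mulr_gt0//.
  apply: le_trans bau; have -> : b - a = (A - B) * (A + B).
    by rewrite -subr_sqr A2 B2; ring.
  by rewrite ler_wpM2l ?subr_ge0//; have := d0 n; lra.
have r_le n u : 0 <= u -> Num.sqrt u - d n <= r n u <= Num.sqrt u.
  move=> u0; rewrite /r max_l// lerD2r lerBlDr; apply/andP; split.
    by rewrite ler_wsqrtr// lerDl sqr_ge0.
  rewrite -[leRHS]ger0_norm ?addr_ge0 ?sqrtr_ge0 ?(ltW (d0 n))//.
  rewrite -sqrtr_sqr ler_wsqrtr// sqrrD sqr_sqrtr// lerD2r lerDl.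
  by rewrite mulrn_wge0// mulr_ge0 ?sqrtr_ge0// ltW.
have dmono n : d n.+1 <= d n by rewrite lef_pV2 ?posrE// ler_nat.
have r_mono n u : 0 <= u -> r n u <= r n.+1 u.
  move=> u0; rewrite /r max_l//.
  set A := Num.sqrt _; set B := Num.sqrt _.
  have A2 : A ^+ 2 = u + d n ^+ 2 by rewrite sqr_sqrtr// addr_ge0 ?sqr_ge0.
  have B2 : B ^+ 2 = u + d n.+1 ^+ 2 by rewrite sqr_sqrtr// addr_ge0 ?sqr_ge0.
  have dA : d n <= A by have := sq_ge n u; rewrite max_l.
  have dB : d n.+1 <= B by have := sq_ge n.+1 u; rewrite max_l.
  have := d0 n; have := d0 n.+1; have := dmono n.
  have e : (A - B) * (A + B) = (d n - d n.+1) * (d n + d n.+1).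
    by rewrite -!subr_sqr A2 B2; ring.
  move=> h1 h2 h3; have h4 : 0 < A + B by lra.
  have : (A - B) * (A + B) <= (d n - d n.+1) * (A + B).
    by rewrite e ler_wpM2l; lra.
  by rewrite ler_pM2r//; lra.
have sol n : exists y, (forall s, is_derive s 1 y (h s - c * r n (y s))) /\
  [/\ forall s, s <= 0 -> y s = 0, forall s, 0 <= y s & forall s, 0 <= s -> y s <= H * s].
  apply: (@lipschitz_equation h (fun u => c * r n u) (c * (2 * d n)^-1) H) => //.
  - by rewrite mulr_ge0// invr_ge0 mulr_ge0// ltW.
  - by move=> u; apply: cvgM; [exact: cvg_cst|exact: rc].
  - by rewrite r0 mulr0.
  - move=> u v /(rK n)/andP[h1 h2]; rewrite -mulrBr mulr_ge0//= -mulrA.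
    by rewrite ler_wpM2l.
have [y_ hy] := choice sol.
have yd n s : is_derive s 1 (y_ n) (h s - c * r n (y_ n s)) := (hy n).1 s.
have yneg n s : s <= 0 -> y_ n s = 0 by case: (hy n) => _ [+ _ _]; exact.
have y0 n s : 0 <= y_ n s by case: (hy n) => _ [_ + _]; exact.
have yle n s : 0 <= s -> y_ n s <= H * s by case: (hy n) => _ [_ _]; exact.
have yc n : continuous (y_ n) by move=> s; exact: is_derive1_continuous (yd n s).
have ymono n s : y_ n.+1 s <= y_ n s.
  have [s0|/ltW s0] := leP s 0; first by rewrite !yneg.
  pose D t := y_ n.+1 t - y_ n t.
  pose dD t := (h t - c * r n.+1 (y_ n.+1 t)) - (h t - c * r n (y_ n t)).
  suff : D s <= 0 by rewrite subr_le0.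
  have Dd t : is_derive t 1 D (dD t) by exact: is_deriveB.
  have Dle t : 0 < t < s -> 0 < D t -> dD t <= 0.
    move=> _ Dt; have h1 := r_mono n _ (y0 n.+1 t).
    have /(rK n)/andP[h2 _] : y_ n t <= y_ n.+1 t by rewrite -subr_ge0 ltW.
    have : c * (r n (y_ n t)) <= c * (r n.+1 (y_ n.+1 t)).
      by rewrite ler_wpM2l// (le_trans _ h1)// -subr_ge0.
    by rewrite /dD; lra.
  apply: (barrier s0 _ (fun t _ _ => Dd t) Dle); last by rewrite /D !yneg// subrr.
  by move=> t _; exact: is_derive1_continuous (Dd t).
have ycv s : cvgn (fun n => y_ n s).
  apply: (@nonincreasing_is_cvgn _ (fun n => y_ n s)).
    by apply/nonincreasing_seqP => n; exact: ymono.
  by exists 0 => _ [n _ <-].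
pose y s := limn (fun n => y_ n s).
have yl s : y_ n s @[n --> \oo] --> y s by exact: ycv.
have fb T : exists C : R, forall n s, s <= T -> `|h s - c * r n (y_ n s)| <= C.
  exists (H + c * Num.sqrt (H * `|T|)) => n s sT.
  apply: le_trans (ler_normB _ _) _; apply: lerD.
    by case/andP: (hH s) => ? ?; rewrite ger0_norm.
  have /andP[h1 h2] := r_le n _ (y0 n s).
  have /(rK n)/andP[+ _] := y0 n s; rewrite r0 subr0 => h3.
  rewrite ger0_norm ?mulr_ge0// ler_wpM2l// (le_trans h2)// ler_wsqrtr//.
  have [s0|/ltW s0] := leP s 0; first by rewrite yneg// mulr_ge0.
  by rewrite (le_trans (yle _ _ s0))// ler_wpM2l// (le_trans sT)// ler_norm.
have ycont : continuous y := derive_lim_continuous yd fb yl.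
have ylim0 s : 0 <= y s by apply: (cvgr_to_ge (yl s)); near=> n; exact: y0.
have ylneg s : s <= 0 -> y s = 0.
  move=> s0; apply/cvg_lim => //; have -> : y_^~ s = cst 0.
    by apply/funext => n; exact: yneg.
  exact: cvg_cst.
have dcvg : d n @[n --> \oo] --> (0 : R) by exact: cvg_harmonic.
exists y; split=> // s.
apply: (@derive_lim _ y_ (fun n s => h s - c * r n (y_ n s)) y
  (fun s => h s - c * Num.sqrt (y s)) yd) => //.
- move=> n t; apply: cvgB; first exact: hc.
  apply: cvgM; first exact: cvg_cst.
  by apply: (@continuous_comp _ _ _ (y_ n) (r n)); [exact: yc|exact: rc].
- by move=> n t t0; rewrite h0// yneg// r0 mulr0 subr0.
- move=> t; apply: cvgB; first exact: cvg_cst.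
  apply: cvgM; first exact: cvg_cst.
  have sl : Num.sqrt (y_ n t) @[n --> \oo] --> Num.sqrt (y t).
    apply: (@cvg_comp _ _ _ (y_^~ t) Num.sqrt _ (nbhs (y t))); first exact: yl.
    exact: sqrt_continuous.
  apply: (@squeeze_cvgr _ _ _ _ (fun n => Num.sqrt (y_ n t) - d n) (fun n => Num.sqrt (y_ n t))) => //.
    by near=> n; exact: r_le.
  by rewrite -[X in _ --> X]subr0; exact: cvgB.
- move=> t; apply: cvgB; first exact: hc.
  apply: cvgM; first exact: cvg_cst.
  by apply: (@continuous_comp _ _ _ y Num.sqrt); [exact: ycont|exact: sqrt_continuous].
Unshelve. all: by end_near. Qed.

End dissipative_equation.

(** * Global solutions of a scalar autonomous equation *)

Section flow.
Context {R : realType}.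
Implicit Types (v tau : R -> R) (x y z : R).

Lemma is_derive_incr_ex (f df : R -> R) x y : x < y ->
  (forall z, is_derive z 1 f (df z)) -> exists2 z, x < z < y & f y - f x = df z * (y - x).
Proof.
move=> xy fd; have [|z] := MVT xy (fun z _ => fd z).
  by apply: continuous_subspaceT => z; exact: is_derive1_continuous (fd z).
by rewrite in_itv /= => hz e; exists z.
Qed.

(** Separation of variables: the solution is the inverse of a primitive [G] of [1 / v], and
    [1 / v >= 1 / C] makes [G] onto. *)
Lemma autonomous_flow v (C : R) : continuous v -> (forall x, 0 < v x <= C) ->
  exists tau, [/\ forall x, is_derive x 1 tau (v (tau x)),
    tau x @[x --> +oo] --> +oo & tau x @[x --> -oo] --> -oo].
Proof.
move=> vc hv.
have v0 x : 0 < v x by case/andP: (hv x).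
have vn0 x : v x != 0 by rewrite gt_eqF.
have C0 : 0 < C by have /andP[/lt_le_trans] := hv 0; apply.
have [G dG] : exists G : R -> R, forall x, is_derive x 1 G (v x)^-1.
  by apply: exists_primitive => x; apply: cvgV; [exact: vn0|exact: vc].
have Gc : continuous G by move=> x; exact: is_derive1_continuous (dG x).
have Gmono x y : x < y -> C^-1 * (y - x) <= G y - G x.
  move=> xy; have [z _ ->] := is_derive_incr_ex xy dG.
  by rewrite ler_pM2r ?subr_gt0// lef_pV2 ?posrE//; case/andP: (hv z).
have Gincr x y : x < y -> G x < G y.
  move=> xy; rewrite -subr_gt0; apply: lt_le_trans (Gmono _ _ xy).
  by rewrite mulr_gt0 ?invr_gt0// subr_gt0.
have Ginj x y : G x = G y -> x = y.
  by move=> e; have [/Gincr|/Gincr|//] := ltgtP x y; rewrite e ltxx.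
have Gonto x : exists y, G y = x.
  pose b := C * (`|x| + `|G 0| + 1).
  have b0 : 0 < b by rewrite mulr_gt0// ltr_wpDl// addr_ge0.
  have h1 : `|x| + `|G 0| + 1 <= G b - G 0.
    by have := Gmono _ _ b0; rewrite subr0 /b mulrA mulVf ?mul1r// gt_eqF.
  have nb0 : - b < 0 by rewrite oppr_lt0.
  have h2 : `|x| + `|G 0| + 1 <= G 0 - G (- b).
    by have := Gmono _ _ nb0; rewrite sub0r opprK /b mulrA mulVf ?mul1r// gt_eqF.
  have bb : - b <= b by rewrite (le_trans (ltW nb0)) ?ltW.
  have [||y _ hy] := @IVT R G (- b) b x bb; last by exists y.
    exact: continuous_subspaceT.
  have := ler_norm x; have := ler_norm (- x); have := ler_norm (G 0).
  have := ler_norm (- G 0); rewrite !normrN ge_min le_max => *.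
  by apply/andP; split; apply/orP; [left|right]; lra.
have [tau hG] := choice Gonto.
have GK y : tau (G y) = y by apply: Ginj; rewrite hG.
exists tau; split.
- move=> x; rewrite -[v _]invrK -{1}(hG x).
  apply: is_derive_inverse; last by rewrite invr_eq0.
    by near=> y; exact: GK.
  by near=> y; exact: Gc.
- apply/cvgryPge => B; near=> x.
  have xB : G B <= x by near: x; exact: nbhs_pinfty_ge (num_real _).
  by rewrite leNgt; apply/negP => /Gincr; rewrite hG ltNge xB.
- apply/cvgrNyPle => B; near=> x.
  have xB : x <= G B by near: x; exact: nbhs_ninfty_le (num_real _).
  by rewrite leNgt; apply/negP => /Gincr; rewrite hG ltNge xB.
Unshelve. all: by end_near. Qed.

End flow.

(** * Construction of a wave from its squared slope *)

Section existence.
Context {R : realType} {psi : R -> R} {al ls : R}.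
Hypothesis M : mechanism psi al ls.
Let al0 := mech_al M.
Let ls0 := mech_ls M.
Context {c lam : R}.
Hypotheses (lam0 : 0 < lam) (clam : c = al / lam + lam / 2).
Implicit Types s t x y z u : R.

Let c0 : 0 < c.
Proof. by rewrite clam addr_gt0// divr_gt0. Qed.

Let lam2 : 2 * c * lam = 2 * al + lam ^+ 2.
Proof. by rewrite clam; field; rewrite gt_eqF. Qed.

(** The height [ls - s] clipped to [[0, ls]], so that the source term [h] is continuous and bounded
    on the whole line and vanishes for [s <= 0], as [sqrt_equation] requires. *)
Let clamp s := Num.max 0 (Num.min (ls - s) ls).

(** With [s = ls - Phi] and [q = Phi'^2], the wave equation becomes
    [dq/ds = - 4 psi (ls - s) - 4 c sqrt(q)]. *)
Let h s := - (4 * psi (clamp s)).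

Let clamp_itv s : 0 <= clamp s <= ls.
Proof. by rewrite /clamp le_max lexx/= ge_max (ltW ls0) ge_min lexx orbT. Qed.

Let clampE s : 0 <= s <= ls -> clamp s = ls - s.
Proof.
move=> /andP[s0 sl]; rewrite /clamp min_l; last by rewrite lerBlDr lerDl.
by rewrite max_r// subr_ge0.
Qed.

Let hE s : 0 <= s <= ls -> h s = - (4 * psi (ls - s)).
Proof. by move=> /clampE; rewrite /h => ->. Qed.

Let h_continuous : continuous h.
Proof.
move=> s; apply: cvgN; apply: cvgM; first exact: cvg_cst.
apply: (@mech_comp_continuous _ _ _ _ M clamp) => [t|t]; last by case/andP: (clamp_itv t).
apply: (@continuous_max _ _ (cst 0) (fun t => Num.min (ls - t) ls)).
  exact: cvg_cst.
apply: (@continuous_min _ _ (fun t => ls - t) (cst ls)); last exact: cvg_cst.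
by apply: cvgB; [exact: cvg_cst|exact: cvg_id].
Qed.

Let h0 s : s <= 0 -> h s = 0.
Proof.
move=> s0; rewrite /h /clamp min_r ?max_r ?(mech_psils M) ?mulr0 ?oppr0 ?(ltW ls0)//.
by rewrite lerDl oppr_ge0.
Qed.

Let h_bounded : exists H, forall s, 0 <= h s <= H.
Proof.
have [K K0 hK] := mech_lipschitz M (ltW ls0).
exists (4 * (K * ls)) => s; rewrite /h oppr_ge0 pmulr_rle0// (mech_le0 M)//=.
have := hK (clamp s) 0 (clamp_itv s); rewrite lexx (ltW ls0) (mech_psi0 M) !subr0 => /(_ isT).
have /andP[k0 kl] := clamp_itv s.
rewrite (ger0_norm k0) => hp; rewrite -mulrN ler_pM2l//.
rewrite (le_trans (ler_norm _))// normrN (le_trans hp)//.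
by rewrite ler_pM2l.
Qed.

Let h_le : exists2 K : R, 0 < K & forall s, 0 <= s <= ls -> h s <= 4 * K * s.
Proof.
have [K K0 hK] := mech_lipschitz M (ltW ls0); exists K => // s sls.
have /andP[s0 sl] := sls.
rewrite hE// -mulrN -mulrA ler_pM2l// (le_trans (ler_norm _))// normrN.
have := hK (ls - s) ls; rewrite subr_ge0 sl lexx (ltW ls0) lerBlDr lerDl s0.
move=> /(_ isT isT); rewrite (mech_psils M) subr0.
have -> : ls - s - ls = - s by ring.
by rewrite normrN (ger0_norm s0).
Qed.

(** [q] is the squared slope of the wave at depth [s] below [ls]. The barrier [(lam (ls - s))^2]
    works because [2 c lam = 2 al + lam^2]. Together with the bound [C s] it makes [sqrt(q)] vanish
    at least linearly at both ends, so that the wave neither leaves [ls] nor reaches 0 in finite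
    time. *)
Let profile : exists q : R -> R, [/\ continuous q,
  forall s, is_derive s 1 q (h s - 4 * c * Num.sqrt (q s)),
  forall s, 0 < s < ls -> 0 < q s,
  forall s, 0 <= s <= ls -> Num.sqrt (q s) <= lam * (ls - s) &
  exists C, forall s, 0 <= s <= ls -> Num.sqrt (q s) <= C * s].
Proof.
have [H hH] := h_bounded.
have c4 : 0 <= 4 * c by rewrite mulr_ge0// ltW.
have [q [dq [qneg q0]]] := sqrt_equation c4 h_continuous h0 hH.
have qc : continuous q by move=> s; exact: is_derive1_continuous (dq s).
exists q; split=> //.
- move=> s /andP[s0 sl]; rewrite lt_neqAle q0 andbT eq_sym; apply/eqP => e.
  have d0 : is_derive s 1 q 0.
    apply: (@derive1_at_min _ q (s - 1) (s + 1)) => //.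
    + by lra.
    + by rewrite in_itv /=; apply/andP; split; lra.
    + by move=> t _; rewrite e.
  have := dq s => -[_]; rewrite derive_val e sqrtr0 mulr0 subr0 hE; last first.
    by rewrite (ltW s0) ltW.
  by have := mech_lt0 M (_ : 0 < ls - s < ls); rewrite subr_gt0 sl ltrBlDr ltrDl s0 => /(_ isT); lra.
- move=> s /andP[s0 sl].
  pose E t := q t - (lam * (ls - t)) ^+ 2.
  pose dE t := h t - 4 * c * Num.sqrt (q t) + 2 * lam ^+ 2 * (ls - t).
  have dEd t : is_derive t 1 E (dE t).
    by have h1 := dq t; apply: is_derive_eq; rewrite /GRing.scale /= /dE; ring.
  suff : E s <= 0.
    rewrite subr_le0 => hq; rewrite -[leRHS]ger0_norm; last first.
      by rewrite mulr_ge0 ?subr_ge0// ltW.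
    by rewrite -sqrtr_sqr ler_wsqrtr.
  apply: (barrier s0 _ (fun t _ _ => dEd t)).
  + by move=> t _; exact: is_derive1_continuous (dEd t).
  + move=> t /andP[t0 ts] Et; have tl := lt_le_trans ts sl.
    have hl : 0 <= ls - t by rewrite subr_ge0 ltW.
    have hs : lam * (ls - t) <= Num.sqrt (q t).
      rewrite -[leLHS]ger0_norm ?mulr_ge0// ?(ltW lam0)// -sqrtr_sqr ler_wsqrtr//.
      by rewrite -subr_ge0 ltW.
    have h1 : h t <= 4 * al * (ls - t).
      by rewrite hE ?(ltW t0) ?(ltW tl)//; have := mech_ge M hl; lra.
    have h2 : c * (lam * (ls - t)) <= c * Num.sqrt (q t) by rewrite ler_pM2l.
    have h3 : 2 * c * lam * (ls - t) = (2 * al + lam ^+ 2) * (ls - t) by rewrite lam2.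
    by rewrite /dE; lra.
  + by rewrite /E qneg// sub0r oppr_le0 sqr_ge0.
- have [K K0 hK] := h_le.
  exists (Num.sqrt (2 * K)) => s /andP[s0 sl].
  rewrite -[X in _ * X](ger0_norm s0) -sqrtr_sqr -sqrtrM ?mulr_ge0 ?(ltW K0)//.
  apply: ler_wsqrtr.
  have : q s - 2 * K * s ^+ 2 <= q 0 - 2 * K * 0 ^+ 2.
    apply: (@derive_le0_le _ (fun t => q t - 2 * K * t ^+ 2)
      (fun t => h t - 4 * c * Num.sqrt (q t) - 4 * K * t) _ _ s0) => t.
    + by move=> _; have h1 := dq t; apply: is_derive_eq; rewrite /GRing.scale /=; ring.
    + move=> /andP[t0 ts]; have := hK t; rewrite (ltW t0) (ltW (lt_le_trans ts sl)) => /(_ isT).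
      have : 0 <= 4 * c * Num.sqrt (q t) by rewrite mulr_ge0 ?sqrtr_ge0.
      lra.
    + move=> _; apply: cvgB; first exact: qc.
      by apply: cvgM; [exact: cvg_cst|exact: exprn_continuous].
  by rewrite (qneg 0)// expr0n/= mulr0 subrr subr_le0.
Qed.

(** A logistic change of variable from the line to []0, ls[], which moves the degenerate ends of
    [s' = sqrt(q s)] to infinity. *)
Let S t := ls / (1 + expR (- t)).

Let eS t : 0 < 1 + expR (- t).
Proof. by rewrite ltr_pwDl ?expR_ge0. Qed.

Let S_itv t : 0 < S t < ls.
Proof.
rewrite divr_gt0//= ltr_pdivrMr// ltr_pMr// ltrDl; exact: expR_gt0.
Qed.

Let dS t : is_derive t 1 S (S t * (ls - S t) / ls).
Proof.
have he : is_derive t 1 (fun t => 1 + expR (- t)) (- expR (- t)).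
  have h1 := is_derive_expRM (- 1) t.
  have -> : (fun t => 1 + expR (- t)) = (fun t : R => 1 + expR (- 1 * t)).
    by apply/funext => u; rewrite mulN1r.
  by apply: is_derive_eq; rewrite add0r mul1r !mulN1r.
have hn : 1 + expR (- t) != 0 by rewrite gt_eqF.
have hv := is_deriveV (f := fun t => 1 + expR (- t)) hn he.
apply: is_derive_eq; rewrite /GRing.scale /= /S; field.
by rewrite hn gt_eqF.
Qed.

Let S_cvgy : S t @[t --> +oo] --> ls.
Proof.
rewrite /S -[X in _ --> X](mulr1) -[X in _ * X]invr1 -[X in X^-1](addr0 1).
apply: cvgM; first exact: cvg_cst.
apply: cvgV; first by rewrite addr0 oner_neq0.
apply: cvgD; first exact: cvg_cst.
exact: cvgr_expR.
Qed.

Let S_cvgNy : S t @[t --> -oo] --> (0 : R).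
Proof.
apply: (@squeeze_cvgr _ _ _ _ (cst 0) (fun t => ls * expR t)).
- near=> t; rewrite /= ltW/=; last by case/andP: (S_itv t).
  rewrite /S ler_pM2l// -[leRHS]invrK lef_pV2 ?posrE ?invr_gt0 ?expR_gt0//.
  by rewrite -expRN lerDr.
- exact: cvg_cst.
- rewrite -[X in _ --> X](mulr0 ls); apply: cvgM; first exact: cvg_cst.
  by apply/cvgNy_compNP; exact: cvgr_expR.
Unshelve. all: by end_near. Qed.

Lemma wave_exists : exists Phi, travelling_wave psi ls c Phi.
Proof.
have [q [qc dq q0 qlam [C qC]]] := profile.
have S0 t : 0 < S t by case/andP: (S_itv t).
have Sl t : 0 < ls - S t by rewrite subr_gt0; case/andP: (S_itv t).
have Sle t : 0 <= S t <= ls by case/andP: (S_itv t) => /ltW-> /ltW->.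
have Sc : continuous S by move=> t; exact: is_derive1_continuous (dS t).
have Sq0 t : 0 < q (S t) by exact: q0.
(* The velocity [sqrt(q) / S'] in the logistic coordinate. By partial fractions it is
   [sqrt(q) / (ls - S) + sqrt(q) / S], and the two bounds on the profile control the two terms. *)
pose v t := ls * Num.sqrt (q (S t)) / (S t * (ls - S t)).
have vc : continuous v.
  move=> t; apply: cvgM.
    apply: cvgM; first exact: cvg_cst.
    apply: (@continuous_comp _ _ _ (q \o S) Num.sqrt); last exact: sqrt_continuous.
    by apply: continuous_comp; [exact: Sc|exact: qc].
  apply: cvgV; first by rewrite mulf_neq0// gt_eqF.
  by apply: cvgM; [exact: Sc|apply: cvgB; [exact: cvg_cst|exact: Sc]].
have hv t : 0 < v t <= lam + C.
  rewrite divr_gt0 ?mulr_gt0 ?sqrtr_gt0//=.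
  have -> : v t = Num.sqrt (q (S t)) / (ls - S t) + Num.sqrt (q (S t)) / S t.
    by rewrite /v; field; rewrite !gt_eqF.
  by rewrite lerD// ler_pdivrMr// ?qlam ?qC.
have [tau [dtau tauy tauNy]] := autonomous_flow vc hv.
pose s x := S (tau x).
have ds x : is_derive x 1 s (Num.sqrt (q (s x))).
  have := is_derive1_comp (dS (tau x)) (dtau x).
  have -> // : S (tau x) * (ls - S (tau x)) / ls * v (tau x) = Num.sqrt (q (s x)).
  by rewrite /v /s; field; rewrite !gt_eqF.
pose Phi x := ls - s x.
have dPhi x : is_derive x 1 Phi (- Num.sqrt (q (s x))).
  by have := is_deriveB (is_derive_cst ls x (1 : R)) (ds x); rewrite sub0r.
have dPhiE : derive1 Phi = fun x => - Num.sqrt (q (s x)).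
  by apply/funext => x; rewrite derive1E; exact: derive_val.
have ddPhi x : is_derive x 1 (derive1 Phi) (- (h (s x) - 4 * c * Num.sqrt (q (s x))) / 2).
  rewrite dPhiE.
  have n0 : Num.sqrt (q (s x)) != 0 by rewrite gt_eqF// sqrtr_gt0; exact: Sq0.
  have h1 := is_derive1_comp (dq (s x)) (ds x).
  have h2 := is_derive1_comp (is_derive1_sqrt (Sq0 (tau x))) h1.
  have := is_deriveN h2.
  rewrite (_ : - ((2 * Num.sqrt (q (S (tau x))))^-1 * _) = - (h (s x) - 4 * c * Num.sqrt (q (s x))) / 2)//.
  by rewrite -/(s x); field.
exists Phi; split.
- split=> [x|x y xy]; first by rewrite ltW// Sl.
  apply: (derive_le0_le xy (fun z _ => dPhi z)) => z _.
    by rewrite oppr_le0 sqrtr_ge0.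
  exact: is_derive1_continuous (dPhi z).
- by move=> x; have [? _] := dPhi x; have [? _] := ddPhi x.
- move=> x; have [_] := ddPhi x; rewrite -derive1E => ->.
  rewrite dPhiE hE ?Sle// -/(Phi x); lra.
- rewrite -[X in _ --> X]subr0; apply: cvgB; first exact: cvg_cst.
  exact: cvg_comp tauNy S_cvgNy.
- rewrite -[X in _ --> X](subrr ls); apply: cvgB; first exact: cvg_cst.
  exact: cvg_comp tauy S_cvgy.
Qed.

End existence.

(** * A maximum principle *)

Section maximum_principle.
Context {R : realType}.
Implicit Types (f g : R -> R) (x y t : R).

(** One-sided because a maximum over a time interval may sit at the final time. *)
Lemma derive_ge0_left_max f x l e : 0 < e -> is_derive x 1 f l ->
  (forall y, x - e < y < x -> f y <= f x) -> 0 <= l.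
Proof.
move=> e0 -[h1 <-] hf.
have := h1 => /cvg_ex[l' hl]; rewrite /derive (cvg_lim _ hl)//.
have hl' : h^-1 *: (f (h *: 1 + x) - f x) @[h --> 0^'-] --> l'.
  exact: cvg_dnbhs_at_left hl.
apply: (cvgr_to_ge hl'); near=> h.
have h0 : h < 0 by near: h; exact: nbhs_left_lt.
have he : - e < h by near: h; apply: nbhs_left_gt; rewrite oppr_lt0.
rewrite /GRing.scale /= nmulr_rge0 ?invr_lt0// subr_le0 mulr1; apply: hf.
by apply/andP; split; lra.
Unshelve. all: by end_near. Qed.

Lemma derive2_le0_max f (f1 : R -> R) x l e : 0 < e ->
  (forall y, x - e < y < x + e -> is_derive y 1 f (f1 y)) ->
  is_derive x 1 f1 l -> (forall y, x - e < y < x + e -> f y <= f x) ->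
  f1 x = 0 /\ l <= 0.
Proof.
move=> e0 df df1 fmax.
have xe : x - e < x < x + e by rewrite ltrBlDr !ltrDl e0.
have f1x : f1 x = 0.
  have : is_derive x 1 f 0.
    apply: (@derive1_at_max _ f (x - e) (x + e)) => //.
    - by rewrite ltW// (lt_trans (andP xe).1) ?(andP xe).2.
    - by move=> t; rewrite in_itv => /df[].
  by move=> [_ <-]; have [_ <-] := df _ xe.
split=> //; rewrite leNgt; apply/negP => l0.
case: df1 => h1 hl; move: l0; rewrite -{}hl.
have := h1 => /cvg_ex[l' hl]; rewrite /derive (cvg_lim _ hl)// => l0.
have hl' : h^-1 *: (f1 (h *: 1 + x) - f1 x) @[h --> 0^'+] --> l'.
  exact: cvg_dnbhs_at_right hl.
have [d /= d0 hd] : \forall h \near 0^'+, 0 < h^-1 *: (f1 (h *: 1 + x) - f1 x).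
  exact: (cvgr_gt l' hl').
pose k := Num.min (d / 2) (e / 2).
have k0 : 0 < k by rewrite lt_min !divr_gt0.
have kd : k < d by rewrite gt_min ltr_pdivrMr// ltr_pMr// ltr1n.
have ke : k < e by rewrite gt_min orbC ltr_pdivrMr// ltr_pMr// ltr1n.
have xk : x < x + k by rewrite ltrDl.
have dk y : x < y < x + k -> is_derive y 1 f (f1 y).
  by move=> /andP[y1 y2]; apply: df; apply/andP; split; lra.
have dk' y : y \in `]x, x + k[ -> is_derive y 1 f (f1 y) by rewrite in_itv; exact: dk.
have [|z] := MVT xk dk'.
  apply: continuous_in_subspaceT => y; rewrite inE /= in_itv /= => /andP[y1 y2].
  by apply: is_derive1_continuous (df y _); apply/andP; split; lra.
rewrite in_itv /= => /andP[z1 z2] hz.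
have hz' : 0 < z - x < d by apply/andP; split; lra.
have : 0 < f1 z.
  case/andP: hz' => z3 z4.
  have := hd (z - x); rewrite /= sub0r normrN gtr0_norm// => /(_ z4 z3).
  by rewrite /GRing.scale /= mulr1 subrK f1x subr0 pmulr_rgt0 ?invr_gt0.
move=> fz; have : f (x + k) <= f x by apply: fmax; apply/andP; split; lra.
rewrite -subr_le0 hz; have -> : x + k - x = k by ring.
by rewrite leNgt mulr_gt0.
Unshelve. all: by end_near. Qed.

Context {psi : R -> R} {al ls : R}.
Hypothesis M : mechanism psi al ls.
Let al0 := mech_al M.

(** As [- psi u <= al u], the solution is a subsolution of the linear equation for which [V] is a
    supersolution. The penalty [P], unbounded in [x], confines a would-be positive maximum of
    [u - V - P] to a compact box, because [u] is bounded and [V] nonnegative; then [e] tends to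
    0. *)
Lemma evolution_le_supersolution f (u : R -> R -> R) (V Vt Vx Vxx : R -> R -> R) :
  evolution_solution psi f u ->
  {within [set p : R * R | 0 <= p.2], continuous (fun p => V p.1 p.2)} ->
  (forall x t, 0 <= t -> 0 <= V x t) ->
  (forall x t, 0 < t -> is_derive t 1 (V x) (Vt x t)) ->
  (forall x t, 0 < t -> is_derive x 1 (V ^~ t) (Vx x t)) ->
  (forall x t, 0 < t -> is_derive x 1 (Vx ^~ t) (Vxx x t)) ->
  (forall x t, 0 < t -> 2^-1 * Vxx x t + al * V x t <= Vt x t) ->
  (forall x, f x <= V x 0) ->
  forall x t, 0 <= t -> u x t <= V x t.
Proof.
move=> [u0 ub uc du uf] Vc V0 dVt dVx dVxx Vsup fV x0 t0.
rewrite le_eqVlt => /predU1P[<-|t0_gt0]; first by rewrite uf.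
(* With this rate [P] is a strict supersolution: [P_t = (al + 2) P], whereas [P_xx / 2 <= P]. *)
pose k := al + 2.
pose P e x t := e * (expR (k * t) * (1 + x ^+ 2)).
suff key e : 0 < e -> u x0 t0 <= V x0 t0 + P e x0 t0.
  apply/ler_addgt0Pr => d d0.
  pose q := expR (k * t0) * (1 + x0 ^+ 2).
  have q0 : 0 < q by rewrite mulr_gt0 ?expR_gt0// ltr_wpDr// sqr_ge0.
  have := key (d / q) (divr_gt0 d0 q0).
  by rewrite /P -/q divfK// gt_eqF.
move=> e0; rewrite leNgt; apply/negP => hlt.
have [C hC] := ub t0.
(* The box is wide enough to contain [x0] inside and for the penalty to exceed the bound [C] of [u]
   on its lateral sides. *)
pose m := `|x0| + `|C| / e + 1.
have m1 : 1 <= m by rewrite lerDr addr_ge0// divr_ge0// ltW.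
have mx0 : `|x0| < m by rewrite /m -addrA ltrDl ltr_wpDl// divr_ge0// ltW.
have Cm : C < e * (1 + m ^+ 2).
  have h1 : `|C| / e <= m by rewrite /m addrAC lerDr addr_ge0.
  have h2 : m <= m ^+ 2 by rewrite expr2 ler_peMl// (le_trans ler01).
  have : `|C| <= e * m by rewrite mulrC -ler_pdivrMr.
  have : e * m <= e * m ^+ 2 by rewrite ler_pM2l.
  by have := ler_norm C; lra.
pose K := `[- m, m] `*` `[0, t0] : set (R * R).
(* For the difference [w = u - V - P], the weight turns maximality in time into [w_t >= al w], which
   the equations contradict thanks to the strictness of [P]. *)
pose D (p : R * R) := expR (- al * p.2) * (u p.1 p.2 - (V p.1 p.2 + P e p.1 p.2)).
have KS : K `<=` [set p | 0 <= p.2] by move=> [y s] [_ /=]; rewrite in_itv /= => /andP[].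
have expc (a : R) : continuous (fun t : R => expR (a * t)).
  by move=> t; exact: is_derive1_continuous (is_derive_expRM a t).
have snd_c : continuous (fun p : R * R => p.2) by move=> p; exact: cvg_snd.
have fst_c : continuous (fun p : R * R => p.1) by move=> p; exact: cvg_fst.
have Dc : {within K, continuous D}.
  have c1 := continuous_subspaceW KS uc; have c2 := continuous_subspaceW KS Vc.
  have c3 : {within K, continuous (fun p : R * R => expR (- al * p.2))}.
    apply: continuous_subspaceT => p.
    by apply: (@continuous_comp _ _ _ snd (fun t => expR (- al * t))); [exact: snd_c|exact: expc].
  have c4 : {within K, continuous (fun p : R * R => P e p.1 p.2)}.
    apply: continuous_subspaceT => p; apply: cvgM; first exact: cvg_cst.
    apply: cvgM.
      by apply: (@continuous_comp _ _ _ snd (fun t => expR (k * t))); [exact: snd_c|exact: expc].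
    apply: cvgD; first exact: cvg_cst.
    by apply: (@continuous_comp _ _ _ fst (fun x => x ^+ 2)); [exact: fst_c|exact: exprn_continuous].
  move=> p; apply: (@cvgM _ (subspace K)); first exact: c3.
  apply: (@cvgB _ _ (subspace K)); first exact: c1.
  by apply: (@cvgD _ _ (subspace K)); [exact: c2|exact: c4].
have K0 : K (x0, t0).
  by split; rewrite /= in_itv /= ?lexx ?(ltW t0_gt0)// -ler_norml ltW.
have Kc : compact K by apply: compact_setX; exact: segment_compact.
have [|[x1 t1] /set_mem[/= x1K t1K] hmax] := compact_EVT_max _ Kc Dc.
  by exists (x0, t0).
have {}hmax y s : - m <= y <= m -> 0 <= s <= t0 -> D (y, s) <= D (x1, t1).
  by move=> hy hs; apply: hmax; apply/mem_set; split; rewrite /= in_itv.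
have D0 : 0 < D (x0, t0) by rewrite mulr_gt0 ?expR_gt0// subr_gt0.
have D1 : 0 < D (x1, t1).
  by apply: lt_le_trans D0 _; case: K0 => /= h1 h2; apply: hmax; move: h1 h2; rewrite !in_itv.
move: x1K t1K; rewrite !in_itv /= => /andP[x1l x1r] /andP[t1l t1r].
have P_ge y s : 0 <= s -> e * (1 + y ^+ 2) <= P e y s.
  move=> s0; rewrite /P ler_pM2l// ler_peMl ?addr_ge0 ?sqr_ge0//.
  by rewrite -expR0 ler_expR mulr_ge0// addr_ge0// ltW.
have u1 : V x1 t1 + P e x1 t1 < u x1 t1 by move: D1; rewrite /D /= pmulr_rgt0 ?expR_gt0// subr_gt0.
have t1_gt0 : 0 < t1.
  rewrite lt_neqAle t1l andbT; apply/eqP => t10; move: u1; rewrite -t10 uf.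
  have := fV x1; have := P_ge x1 0 (lexx 0).
  have : 0 < e * (1 + x1 ^+ 2) by rewrite mulr_gt0// ltr_wpDr// sqr_ge0.
  lra.
have x1m : x1 ^+ 2 != m ^+ 2.
  apply/eqP => h; move: u1; have := P_ge x1 t1 t1l; rewrite h.
  have := V0 x1 t1 t1l; have := hC x1 t1; rewrite t1l t1r => /(_ isT); lra.
have x1l' : - m < x1.
  by rewrite lt_neqAle x1l andbT; apply: contraNneq x1m => <-; rewrite sqrrN.
have x1r' : x1 < m by rewrite lt_neqAle x1r andbT; apply: contraNneq x1m => ->.
have [dut dux duxx upde] := du x1 t1 t1_gt0.
have hdu y : is_derive y 1 (u ^~ t1) (derive1 (u ^~ t1) y).
  by have [_ h _ _] := du y t1 t1_gt0; rewrite derive1E; exact: derivableP.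
have hduxx : is_derive x1 1 (derive1 (u ^~ t1)) (derive1 (derive1 (u ^~ t1)) x1).
  by rewrite (derive1E (derive1 (u ^~ t1)) x1); exact: derivableP.
have hdut : is_derive t1 1 (u x1) (derive1 (u x1) t1).
  by rewrite (derive1E (u x1) t1); exact: (derivableP dut).
set uxx := derive1 (derive1 (u ^~ t1)) x1 in hduxx upde.
set ut := derive1 (u x1) t1 in hdut upde.
(* at an interior maximum the space derivatives satisfy [u_xx <= W_xx] *)
have hspace : uxx - (Vxx x1 t1 + e * (expR (k * t1) * 2)) <= 0.
  pose r := Num.min (x1 + m) (m - x1).
  have r0 : 0 < r by rewrite lt_min -ltrBlDr sub0r x1l' subr_gt0.
  pose f1 y := derive1 (u ^~ t1) y - (Vx y t1 + e * (expR (k * t1) * (2 * y))).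
  apply: (@derive2_le0_max (fun y => u y t1 - (V y t1 + P e y t1)) f1 x1 _ r r0 _ _ _).2.
  - move=> y _; have h1 := hdu y; have h2 := dVx y _ t1_gt0.
    by apply: is_derive_eq; rewrite /GRing.scale /= /f1; ring.
  - have h1 := dVxx x1 _ t1_gt0.
    by apply: is_derive_eq; rewrite /GRing.scale /=; ring.
  - move=> y /andP[y1 y2]; have rl : r <= x1 + m by rewrite ge_min lexx.
    have rr : r <= m - x1 by rewrite ge_min lexx orbT.
    have := hmax y t1; rewrite /D /= ler_pM2l ?expR_gt0//; apply.
      by apply/andP; split; lra.
    by rewrite t1l.
have htime : 0 <= - al * (u x1 t1 - (V x1 t1 + P e x1 t1)) + (ut - (Vt x1 t1 + k * P e x1 t1)).
  have h1 := dVt x1 _ t1_gt0.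
  have h2 : is_derive t1 1 (P e x1) (k * P e x1 t1).
    have h := is_derive_expRM k t1.
    by apply: is_derive_eq; rewrite /GRing.scale /= /P; ring.
  have h3 := is_derive_expRM (- al) t1.
  have h4 : is_derive t1 1 (fun t => u x1 t - (V x1 t + P e x1 t)) (ut - (Vt x1 t1 + k * P e x1 t1)).
    exact: is_deriveB.
  have h5 : is_derive t1 1 (fun t => D (x1, t)) (expR (- al * t1) *
      (- al * (u x1 t1 - (V x1 t1 + P e x1 t1)) + (ut - (Vt x1 t1 + k * P e x1 t1)))).
    by apply: is_derive_eq; rewrite /GRing.scale /=; ring.
  have := derive_ge0_left_max t1_gt0 h5; rewrite pmulr_rge0 ?expR_gt0//; apply.
  move=> s /andP[s0 st]; apply: hmax; first by rewrite x1l.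
  by rewrite (le_trans (ltW st))// andbT ltW// (le_lt_trans _ s0)// subrr.
have hpsi := mech_ge M (u0 x1 t1 t1l).
have hV := Vsup x1 t1 t1_gt0.
have : e * (expR (k * t1) * 2) < 4 * P e x1 t1.
  rewrite /P; have : 0 < e * expR (k * t1) by rewrite mulr_gt0 ?expR_gt0.
  set E := e * _ => E0.
  have -> : 4 * (e * (expR (k * t1) * (1 + x1 ^+ 2))) = 4 * E * (1 + x1 ^+ 2) by rewrite /E; ring.
  rewrite mulrA -/E.
  have : 0 <= E * x1 ^+ 2 by rewrite mulr_ge0 ?sqr_ge0// ltW.
  lra.
by move: htime; rewrite upde /k; lra.
Qed.

End maximum_principle.

Section moving_frame_derivatives.
Context {R : realType}.
Variables (A l : R) (e Q z : R -> R) (x : R).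
Hypothesis Qn0 : Q x != 0.

(** [e], [Q] and [B] stand for [e^(- l z)], [T + z^2 / 5] and [T^(4/5)]. Kept abstract, they turn
    the derivatives of the supersolution into rational identities. *)
Lemma is_derive_frame1 (B : R) : is_derive x 1 e (- l * e x) ->
  is_derive x 1 Q (2 * z x / 5) ->
  is_derive x 1 (fun x => A * (e x * (B / Q x)))
    (A * (B * (e x * (- l / Q x - 2 * z x / 5 / Q x ^+ 2)))).
Proof.
move=> h1 hQ; have h2 := is_deriveV Qn0 hQ.
by apply: is_derive_eq; rewrite /GRing.scale /=; field.
Qed.

Lemma is_derive_frame2 (B : R) : is_derive x 1 e (- l * e x) ->
  is_derive x 1 Q (2 * z x / 5) -> is_derive x 1 z 1 ->
  is_derive x 1 (fun x => A * (B * (e x * (- l / Q x - 2 * z x / 5 / Q x ^+ 2))))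
    (A * (B * (e x * (l ^+ 2 / Q x + 2 * l * (2 * z x / 5) / Q x ^+ 2
      - 2 / 5 / Q x ^+ 2 + 2 * (2 * z x / 5) ^+ 2 / Q x ^+ 3)))).
Proof.
move=> h1 hQ hz; have h2 := is_deriveV Qn0 hQ.
have Q2n0 : Q x ^+ 2 != 0 by rewrite expf_neq0.
have dQ2 : is_derive x 1 (fun x => Q x ^+ 2) (2 * Q x * (2 * z x / 5)).
  by apply: is_derive_eq; rewrite /GRing.scale /=; ring.
have h3 := is_deriveV (f := fun x => Q x ^+ 2) Q2n0 dQ2.
by apply: is_derive_eq; rewrite /GRing.scale /=; field.
Qed.

Lemma is_derive_frame_time (B : R -> R) (b t : R) : t != 0 ->
  is_derive x 1 e (l ^+ 2 * e x) -> is_derive x 1 Q (1 - l * (2 * z x / 5)) ->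
  is_derive x 1 B (b * B x / t) ->
  is_derive x 1 (fun x => A * (e x * (B x / Q x)))
    (A * (B x * (e x * (l ^+ 2 / Q x + b / (t * Q x)
      - (1 - l * (2 * z x / 5)) / Q x ^+ 2)))).
Proof.
move=> tn0 h1 hQ hB; have h2 := is_deriveV Qn0 hQ.
by apply: is_derive_eq; rewrite /GRing.scale /=; field; rewrite ?Qn0 ?tn0.
Qed.

End moving_frame_derivatives.

(** Up to a constant factor, the initial value of the supersolution used below. The constant
    [1 / (2 al)] in the denominator is large enough for the profile to be nonincreasing, in spite of
    the quadratic factor. *)
Definition critical_profile (R : realType) (al z : R) : R :=
  expR (- Num.sqrt (2 * al) * z) / ((Num.sqrt (2 * al) ^+ 2)^-1 + z ^+ 2 / 5).

(** * Decay in the frame moving at the critical speed *)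

Section decay.
Context {R : realType} {psi : R -> R} {al ls : R}.
Hypothesis M : mechanism psi al ls.
Let al0 := mech_al M.
Implicit Types (x y z s t : R).

Let lam := Num.sqrt (2 * al).

Let lam0 : 0 < lam. Proof. by rewrite sqrtr_gt0 mulr_gt0. Qed.

Let lam2 : lam ^+ 2 = 2 * al. Proof. by rewrite sqr_sqrtr// mulr_ge0// ltW. Qed.

Let K := (lam ^+ 2)^-1.

Let K0 : 0 < K. Proof. by rewrite invr_gt0 exprn_gt0. Qed.

Let v0 := critical_profile al.

Let v0E : v0 = fun z => expR (- lam * z) / (K + z ^+ 2 / 5).
Proof. by []. Qed.

Let Q0 t z : 0 < t -> 0 < t + z ^+ 2 / 5.
Proof. by move=> t0; rewrite ltr_wpDr// divr_ge0// sqr_ge0. Qed.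

Lemma critical_profile_gt0 z : 0 < v0 z.
Proof. by rewrite v0E divr_gt0 ?expR_gt0// Q0. Qed.

Let dv0 z : is_derive z 1 v0 (- (expR (- lam * z) / (K + z ^+ 2 / 5) ^+ 2 *
  (lam * (K + z ^+ 2 / 5) + 2 * z / 5))).
Proof.
have h1 := is_derive_expRM (- lam) z.
have hq : is_derive z 1 (fun z => K + z ^+ 2 / 5) (2 * z / 5).
  by apply: is_derive_eq; rewrite /GRing.scale /=; ring.
have qn0 : K + z ^+ 2 / 5 != 0 by rewrite gt_eqF// Q0.
have hv := is_deriveV (f := fun z => K + z ^+ 2 / 5) qn0 hq.
rewrite v0E.
by apply: is_derive_eq; rewrite /GRing.scale /=; move: qn0; set q := K + _ => qn0; field.
Qed.

Lemma critical_profile_continuous : continuous v0.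
Proof. by move=> z; exact: is_derive1_continuous (dv0 z). Qed.

Lemma critical_profile_nincr y z : y <= z -> v0 z <= v0 y.
Proof.
move=> yz; apply: (derive_le0_le yz (fun t _ => dv0 t)) => t _.
  rewrite oppr_le0 mulr_ge0//.
    by rewrite divr_ge0 ?expR_ge0// sqr_ge0.
  have -> : lam * (K + t ^+ 2 / 5) + 2 * t / 5 =
      lam^-1 * (4 / 5 + (lam * t + 1) ^+ 2 / 5).
    by rewrite /K; field; rewrite gt_eqF.
  by rewrite mulr_ge0 ?invr_ge0 ?(ltW lam0)// addr_ge0// divr_ge0// sqr_ge0.
exact: critical_profile_continuous.
Qed.

Let th t := expR (4 / 5 * ln t).

Let dth t : 0 < t -> is_derive t 1 th (4 / 5 * th t / t).
Proof.
move=> t0.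
have h1 := is_derive1_ln t0.
have h2 : is_derive t 1 (fun t => 4 / 5 * ln t) (4 / 5 * t^-1).
  by apply: is_derive_eq; rewrite /GRing.scale /=; ring.
have := is_derive_expR_comp h2.
by have -> : 4 / 5 * t^-1 * expR (4 / 5 * ln t) = 4 / 5 * th t / t by rewrite /th; ring.
Qed.

Let th_gt0 t : 0 < th t. Proof. exact: expR_gt0. Qed.

(* In the frame moving at the critical speed [lam], the function
   [e^(- lam z) T^(4/5) / (T + z^2/5)], [T = K + t], is a supersolution of the
   linearised equation which tends to [0] as [t] tends to infinity. *)
Let evolution_critical_decay f u (C b t : R) : 0 <= C -> 0 <= t ->
  evolution_solution psi f u -> (forall y, f y <= C * v0 (y + b)) ->
  forall y, u y t <= C / th K * (expR (- lam * (y + b - lam * t)) *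
    (th (K + t) / (K + t + (y + b - lam * t) ^+ 2 / 5))).
Proof.
move=> C0 t0 evo hf y.
pose z x s := x + b - lam * s.
pose e x s := expR (- lam * z x s).
pose T s := K + s.
pose Q x s := T s + z x s ^+ 2 / 5.
pose A := C / th K.
pose V x s := A * (e x s * (th (T s) / Q x s)).
have A0 : 0 <= A by rewrite divr_ge0// ltW.
have T0 s : 0 <= s -> 0 < T s by move=> s0; rewrite ltr_wpDr.
have Qp x s : 0 <= s -> 0 < Q x s by move=> s0; exact/Q0/T0.
pose Vx x s := A * (th (T s) * (e x s * (- lam / Q x s - 2 * z x s / 5 / Q x s ^+ 2))).
pose Vxx x s := A * (th (T s) * (e x s * (lam ^+ 2 / Q x s + 2 * lam * (2 * z x s / 5) / Q x s ^+ 2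
  - 2 / 5 / Q x s ^+ 2 + 2 * (2 * z x s / 5) ^+ 2 / Q x s ^+ 3))).
pose Vt x s := A * (th (T s) * (e x s * (lam ^+ 2 / Q x s + 4 / 5 / (T s * Q x s)
  - (1 - lam * (2 * z x s / 5)) / Q x s ^+ 2))).
have dz x s : is_derive x 1 (z ^~ s) 1.
  by apply: is_derive_eq; rewrite addr0 subr0.
have dex x s : is_derive x 1 (e ^~ s) (- lam * e x s).
  apply: is_derive_expR_comp; have h := dz x s.
  by apply: is_derive_eq; rewrite /GRing.scale /=; ring.
have dQx x s : is_derive x 1 (Q ^~ s) (2 * z x s / 5).
  by have h := dz x s; apply: is_derive_eq; rewrite /GRing.scale /=; ring.
have dzs x s : is_derive s 1 (z x) (- lam).
  by apply: is_derive_eq; rewrite /GRing.scale /=; ring.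
have des x s : is_derive s 1 (e x) (lam ^+ 2 * e x s).
  apply: is_derive_expR_comp; have h := dzs x s.
  by apply: is_derive_eq; rewrite /GRing.scale /=; ring.
have dT s : is_derive s 1 T 1.
  by have := is_deriveD (is_derive_cst K s (1 : R)) (is_derive_id s (1 : R)); rewrite add0r.
have dQs x s : is_derive s 1 (Q x) (1 - lam * (2 * z x s / 5)).
  have h := dzs x s; have h' := dT s.
  by apply: is_derive_eq; rewrite /GRing.scale /=; ring.
have dthT s : 0 <= s -> is_derive s 1 (th \o T) (4 / 5 * th (T s) / T s).
  move=> s0; rewrite -[X in is_derive _ _ _ X]mulr1.
  exact: (is_derive1_comp (dth (T0 _ s0)) (dT s)).
have dVx x s : 0 < s -> is_derive x 1 (V ^~ s) (Vx x s).
  move=> s0; have qn0 : Q x s != 0 by rewrite gt_eqF// Qp// ltW.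
  exact: (@is_derive_frame1 R A lam (e ^~ s) (Q ^~ s) (z ^~ s) x qn0 (th (T s)) (dex x s) (dQx x s)).
have dVxx x s : 0 < s -> is_derive x 1 (Vx ^~ s) (Vxx x s).
  move=> s0; have qn0 : Q x s != 0 by rewrite gt_eqF// Qp// ltW.
  exact: (@is_derive_frame2 R A lam (e ^~ s) (Q ^~ s) (z ^~ s) x qn0 (th (T s))
    (dex x s) (dQx x s) (dz x s)).
have dVt x s : 0 < s -> is_derive s 1 (V x) (Vt x s).
  move=> s0; have qn0 : Q x s != 0 by rewrite gt_eqF// Qp// ltW.
  have tn0 : T s != 0 by rewrite gt_eqF// T0// ltW.
  exact: (@is_derive_frame_time R A lam (e x) (Q x) (z x) s qn0 (th \o T) (4 / 5) (T s) tn0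
    (des x s) (dQs x s) (dthT s (ltW s0))).
have := @evolution_le_supersolution _ _ _ _ M f u V Vt Vx Vxx evo.
apply => //.
- apply: continuous_in_subspaceT => -[x s] /set_mem /= s0.
  have zc : {for (x, s), continuous (fun p : R * R => z p.1 p.2)}.
    apply: cvgB; first by apply: cvgD; [exact: cvg_fst|exact: cvg_cst].
    by apply: cvgM; [exact: cvg_cst|exact: cvg_snd].
  have Tc : {for (x, s), continuous (fun p : R * R => T p.2)}.
    by apply: cvgD; [exact: cvg_cst|exact: cvg_snd].
  apply: cvgM; first exact: cvg_cst.
  apply: cvgM.
    apply: (@continuous_comp _ _ _ (fun p : R * R => - lam * z p.1 p.2) expR); last exact: continuous_expR.
    by apply: cvgM; [exact: cvg_cst|exact: zc].
  apply: cvgM.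
    apply: (@continuous_comp _ _ _ (fun p : R * R => T p.2) th); first exact: Tc.
    exact: is_derive1_continuous (dth (T0 _ s0)).
  apply: cvgV; first by rewrite gt_eqF// Qp.
  apply: cvgD; first exact: Tc.
  by apply: cvgM; [apply: cvgM; exact: zc|exact: cvg_cst].
- move=> x s s0; rewrite mulr_ge0// mulr_ge0 ?expR_ge0// divr_ge0 ?(ltW (th_gt0 _))//.
  exact/ltW/Qp.
- move=> x s s0; rewrite -subr_ge0.
  have qn0 : Q x s != 0 by rewrite gt_eqF// Qp// ltW.
  have tn0 : T s != 0 by rewrite gt_eqF// T0// ltW.
  (* Without the exponential factor this is the heat operator applied to [T^b / (T + a z^2)], namely
     [b / (T Q) - (1 - a) / Q^2 - 4 a (Q - T) / Q^3] times [T^b]. For [a = 1/5] and [b = 4/5] all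
     three coefficients equal [4/5] and a square appears; since [b < 1], the maximum [T^(b - 1)]
     still decays. *)
  have -> : Vt x s - (2^-1 * Vxx x s + al * V x s) =
      A * (th (T s) * (e x s * (4 / 5 * (Q x s - T s) ^+ 2 / (T s * Q x s ^+ 3)))).
    have -> : al = lam ^+ 2 / 2 by rewrite lam2; field.
    have ez : z x s ^+ 2 = 5 * (Q x s - T s) by rewrite /Q; field.
    rewrite /Vt /Vxx /V.
    transitivity (A * (th (T s) * (e x s * (4 / 5 / (T s * Q x s) - 1 / Q x s ^+ 2
      + 1 / 5 / Q x s ^+ 2 - 4 / 25 * z x s ^+ 2 / Q x s ^+ 3)))).
      by move: qn0 tn0; move: (Q x s) (e x s) (z x s) (th (T s)) (T s) => q E Z H S qn0 tn0;
        field; rewrite qn0.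
    rewrite ez.
    by move: qn0 tn0; move: (Q x s) (e x s) (th (T s)) (T s) => q E H S qn0 tn0; field; rewrite qn0.
  rewrite mulr_ge0// mulr_ge0 ?(ltW (th_gt0 _))// mulr_ge0 ?expR_ge0//.
  rewrite divr_ge0//; first by rewrite mulr_ge0// sqr_ge0.
  by rewrite mulr_ge0 ?exprn_ge0// ltW// ?Qp ?T0// ltW.
- move=> x; rewrite (le_trans (hf x))// le_eqVlt; apply/orP; left; apply/eqP.
  rewrite /V /A v0E /e /Q /T /z !mulr0 !subr0 !addr0.
  have kn : K + (x + b) ^+ 2 / 5 != 0 by rewrite gt_eqF// Q0.
  have hn : th K != 0 by rewrite gt_eqF.
  move: kn hn; move: (K + (x + b) ^+ 2 / 5) (expR (- lam * (x + b))) (th K) => q E H kn hn.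
  by field; rewrite ?kn ?hn.
Qed.

Let decay_cvg : (th K)^-1 * (th (K + n%:R) / (K + n%:R)) @[n --> \oo] --> (0 : R).
Proof.
rewrite -[X in _ --> X](mulr0 (th K)^-1); apply: cvgM; first exact: cvg_cst.
have hT n : 0 < K + n%:R by rewrite ltr_wpDr.
have -> : (fun n => th (K + n%:R) / (K + n%:R)) = (fun n => expR (- (5^-1 * ln (K + n%:R)))).
  apply/funext => n; rewrite -[X in _ / X]lnK ?posrE//.
  by rewrite /th -expRN -expRD; congr expR; field.
have h : 5^-1 * ln (K + n%:R) @[n --> \oo] --> +oo.
  apply/cvgryPge => B; near=> n.
  rewrite ler_pdivlMl// -ler_expR lnK ?posrE//.
  apply: (@le_trans _ _ n%:R); last by rewrite lerDr ltW.
  by near: n; exact: nbhs_infty_ger.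
exact: (@cvg_comp _ _ _ (fun n : nat => 5^-1 * ln (K + n%:R))
  (fun x : R => expR (- x)) _ _ _ h (@cvgr_expR R)).
Unshelve. all: by end_near. Qed.

(* The supersolution started from [critical_profile] shifted by [lam n] is
   observed at its centre at time [n]. *)
Lemma critical_decay : exists2 D : nat -> R, D n @[n --> \oo] --> (0 : R) &
  forall f u (C : R) n, 0 <= C -> evolution_solution psi f u ->
    (forall y, f y <= C * critical_profile al (y + lam * n%:R)) -> u 0 n%:R <= C * D n.
Proof.
exists (fun n => (th K)^-1 * (th (K + n%:R) / (K + n%:R))); first exact: decay_cvg.
move=> f u C n C0 hu hf.
have := evolution_critical_decay C0 (ler0n _ n) hu hf 0.
by rewrite add0r subrr mulr0 expR0 mul1r expr0n /= mul0r addr0 -mulrA.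
Qed.

End decay.

(** * Mixtures of measures *)

Section scaled_mixture.
Context d1 d2 (T1 : measurableType d1) (T2 : measurableType d2) (R : realType).
Local Open Scope ereal_scope.

Section scaled_kernel.
Context (D : T1 -> R) (hD : forall x, (0 <= D x <= 1)%R) (k : T1 -> giry T2 R).

Let D_ge0 x : (0 <= D x)%R. Proof. by case/andP: (hD x). Qed.

Section at_point.
Variable x : T1.

Let sc : set T2 -> \bar R := mscale (NngNum (D_ge0 x)) (k x).

HB.instance Definition _ := Measure.on sc.

Let sc_setT : sc [set: T2] <= 1.
Proof.
rewrite /sc /mscale/= -[leRHS]mule1 lee_pmul ?lee_fin//.
- by case/andP: (hD x).
- exact: sprobability_setT.
Qed.

HB.instance Definition _ := Measure_isSubProbability.Build _ _ _ sc sc_setT.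

(** Weights at most 1 keep the measure a sub-probability, so that mixtures can be formed by the bind
    of the Giry monad. *)
Definition scaled_kernel : giry T2 R := sc.

Lemma integral_scaled_kernel h : measurable_fun setT h -> (forall y, 0 <= h y) ->
  \int[scaled_kernel]_y h y = (D x)%:E * \int[k x]_y h y.
Proof. by move=> mh h0; rewrite ge0_integral_mscale. Qed.

End at_point.

Hypothesis mD : measurable_fun setT D.
Hypothesis mk : forall B, measurable B -> measurable_fun setT (fun x => k x B).

Lemma integral_scaled_mixture (mu : giry T1 R) h :
  measurable_fun setT h -> (forall y, 0 <= h y) ->
  exists2 m : giry T2 R, \int[mu]_x ((D x)%:E * \int[k x]_y h y) = \int[m]_y h y &
    forall B, measurable B -> m B = \int[mu]_x ((D x)%:E * k x B).
Proof.
move=> mh h0.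
have ms : measurable_fun setT scaled_kernel.
  apply: measurable_giry_codensity => // B mB.
  by apply: emeasurable_funM; [exact/measurable_EFinP|exact: mk].
exists (giry_bind mu ms).
  have /= := giry_int_bind mu ms mh h0; rewrite /giry_int => ->.
  by apply: eq_integral => x _; rewrite integral_scaled_kernel.
move=> B mB; rewrite /giry_bind /= [LHS]giry_int_map//; last exact: measurable_giry_ev.
Qed.

End scaled_kernel.

(** Both sides are integrals of [h] against mixed measures, and these coincide once they agree on
    measurable sets. This extends the Markov property from sets to functionals of the process. *)
Lemma eq_integral_scaled_mixture (mu : giry T1 R) (D D' : T1 -> R)
    (k k' : T1 -> giry T2 R) h :
  (forall x, (0 <= D x <= 1)%R) -> (forall x, (0 <= D' x <= 1)%R) ->
  measurable_fun setT D -> measurable_fun setT D' ->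
  (forall B, measurable B -> measurable_fun setT (fun x => k x B)) ->
  (forall B, measurable B -> measurable_fun setT (fun x => k' x B)) ->
  (forall B, measurable B ->
    \int[mu]_x ((D x)%:E * k x B) = \int[mu]_x ((D' x)%:E * k' x B)) ->
  measurable_fun setT h -> (forall y, 0 <= h y) ->
  \int[mu]_x ((D x)%:E * \int[k x]_y h y) = \int[mu]_x ((D' x)%:E * \int[k' x]_y h y).
Proof.
move=> hD hD' mD mD' mk mk' kk mh h0.
have [m -> mE] := integral_scaled_mixture hD mD mk mu mh h0.
have [m' -> mE'] := integral_scaled_mixture hD' mD' mk' mu mh h0.
apply: eq_measure_integral => B mB _.
by have := etrans (mE B mB) (etrans (kk B mB) (esym (mE' B mB))).
Qed.

End scaled_mixture.

(** * Functionals of super-Brownian motion *)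

Section pairing.
Context {R : realType}.
Implicit Types (f g : R -> R) (m : MF R).

Lemma bounded_continuous_measurable f : bounded_continuous f ->
  measurable_fun setT (f : measurableTypeR R -> R).
Proof. by move=> [fc _]; exact: continuous_measurable_fun. Qed.

Lemma pairing_integrable f m : bounded_continuous f ->
  (to_finite_measure m).-integrable setT (EFin \o f).
Proof.
move=> fb; have [fc [C hC]] := fb.
apply: measurable_bounded_integrable => //.
- exact: fin_num_fun_lty.
- exact: bounded_continuous_measurable.
- exists C; split; first exact: num_real.
  by move=> y Cy x _; rewrite /= (le_trans (hC x))// ltW.
Qed.

Lemma pairing_ge0 f m : (forall x, 0 <= f x) -> 0 <= pairing f m.
Proof. by move=> f0; apply: Rintegral_ge0. Qed.

Lemma le_pairing f g m : bounded_continuous f -> bounded_continuous g ->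
  (forall x, f x <= g x) -> pairing f m <= pairing g m.
Proof.
by move=> fb gb fg; apply: le_Rintegral => //; exact: pairing_integrable.
Qed.

Lemma pairingZ (r : R) f m : bounded_continuous f ->
  pairing (fun x => r * f x) m = r * pairing f m.
Proof. by move=> fb; rewrite /pairing RintegralZl//; exact: pairing_integrable. Qed.

Lemma pairingD f g m : bounded_continuous f -> bounded_continuous g ->
  pairing (fun x => f x + g x) m = pairing f m + pairing g m.
Proof.
by move=> fb gb; rewrite /pairing RintegralD//; exact: pairing_integrable.
Qed.

Lemma bounded_continuousZ (r : R) f : bounded_continuous f ->
  bounded_continuous (fun x => r * f x).
Proof.
move=> [fc [C hC]]; split; first by move=> x; apply: cvgM; [exact: cvg_cst|exact: fc].
by exists (`|r| * C) => x; rewrite normrM ler_wpM2l.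
Qed.

Lemma bounded_continuousD f g : bounded_continuous f -> bounded_continuous g ->
  bounded_continuous (fun x => f x + g x).
Proof.
move=> [fc [C hC]] [gc [C' hC']]; split; first by move=> x; apply: cvgD; [exact: fc|exact: gc].
by exists (C + C') => x; rewrite (le_trans (ler_normD _ _))// lerD.
Qed.

Lemma bounded_continuous_cst (r : R) : bounded_continuous (cst r : R -> R).
Proof. by split; [move=> x; exact: cvg_cst|exists `|r|]. Qed.

Lemma pairing_cst (r : R) m : pairing (cst r) m = r * pairing (cst 1) m.
Proof.
rewrite -pairingZ; last exact: bounded_continuous_cst.
by congr pairing; apply/funext => x; rewrite mulr1.
Qed.

(** The sigma-algebra of [MF R] is generated by evaluations, which says that the identity is a
    kernel; integrals against a kernel are measurable. *)
Lemma measurable_pairing f : bounded_continuous f -> (forall x, 0 <= f x) ->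
  measurable_fun setT (fun m : MF R => pairing f m).
Proof.
move=> fb f0.
have h : measurable_fun setT (fun m : MF R => (\int[to_finite_measure m]_x (f x)%:E)%E).
  apply: (@measurable_fun_integral_kernel _ _ (MF R) (measurableTypeR R) R
    (fun m => to_finite_measure m) _ (fun x => (f x)%:E)).
  - move=> U mU; move=> _ Y mY; rewrite setTI.
    by apply: sub_gen_smallest; exists U, Y; split.
  - by move=> x; rewrite lee_fin.
  - by apply/measurable_EFinP; exact: bounded_continuous_measurable.
exact: (measurableT_comp (fine_measurable measurableT) h).
Qed.

End pairing.

Lemma evolution_bounded_continuous (R : realType) (psi f : R -> R) v t :
  continuous f -> evolution_solution psi f v -> 0 <= t -> bounded_continuous (v ^~ t).
Proof.
move=> fc [v0 vb _ dv vf]; rewrite le_eqVlt => t0; split.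
  case/predU1P: t0 => [<-|t0].
    by have -> : v ^~ 0 = f by apply/funext.
  move=> x; have [_ h _ _] := dv x t t0.
  exact: is_derive1_continuous (derivableP h).
have [C hC] := vb t; exists C => x.
have t0' : 0 <= t by case/predU1P: t0 => [<-//|/ltW].
by rewrite ger0_norm ?v0// hC// t0' lexx.
Qed.

(** * Laplace functionals and the Markov property *)

Section super_brownian_motion.
Context {R : realType} {psi : R -> R} {d : measure_display}
  {W : measurableType d} {X : R -> W -> MF R} {P : MF R -> probability W R}.
Hypothesis hX : super_brownian_motion psi X P.
Implicit Types (f phi : R -> R) (v : R -> R -> R) (s t : R) (mu : MF R) (A : set W).

Lemma natural_filtration_measurable s A : natural_filtration X s A -> measurable A.
Proof.
apply: smallest_sub; first exact: sigma_algebra_measurable.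
move=> _ [r [G [/andP[r0 _] mG ->]]]; rewrite -[X in measurable X]setTI.
exact: (sbm_measurable hX).
Qed.

Lemma natural_filtration_preimage s t G : 0 <= s <= t -> measurable G ->
  natural_filtration X t (X s @^-1` G).
Proof. by move=> st mG; apply: sub_sigma_algebra; exists s, G. Qed.

Lemma natural_filtration_le s t A : s <= t ->
  natural_filtration X s A -> natural_filtration X t A.
Proof.
move=> st; apply: sub_sigma_algebra2 => _ [r [G [/andP[r0 rs] mG ->]]].
by exists r, G; split => //; rewrite r0 (le_trans rs).
Qed.

Lemma natural_filtrationD s A B : natural_filtration X s A ->
  natural_filtration X s B -> natural_filtration X s (A `\` B).
Proof.
pose G := [set C | exists (r : R) (D : set (MF R)),
  [/\ 0 <= r <= s, measurable D & C = X r @^-1` D]].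
exact: (@measurableD _ (g_sigma_algebraType G) A B).
Qed.

Lemma measurable_expR_pairing f t : bounded_continuous f -> (forall x, 0 <= f x) ->
  0 <= t -> measurable_fun setT (fun w => expR (- pairing f (X t w))).
Proof.
move=> fb f0 t0; apply: (measurableT_comp (@measurable_expR R)).
apply: measurableT_comp => //.
apply: (@measurableT_comp _ _ _ _ _ _ (pairing f) _ (X t)).
  exact: measurable_pairing.
exact: (sbm_measurable hX).
Qed.

Lemma expR_pairing_itv f m : (forall x, 0 <= f x) -> 0 <= expR (- pairing f m) <= 1.
Proof.
by move=> f0; rewrite expR_ge0 -expR0 ler_expR oppr_le0 pairing_ge0.
Qed.

(** [ln] inverts [expR] only on positive reals, so the expectation must first be seen to be finite
    and nonzero; it is the integral of a positive function bounded by 1. *)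
Lemma sbm_expectation f v mu t : bounded_continuous f -> (forall x, 0 <= f x) ->
  evolution_solution psi f v -> 0 <= t ->
  (\int[P mu]_w (expR (- pairing f (X t w)))%:E = (expR (- pairing (v ^~ t) mu))%:E)%E.
Proof.
move=> fb f0 hv t0.
have [u [hu uniq]] := sbm_laplace hX fb f0.
have -> : v ^~ t = u ^~ t by apply/funext => x; exact: uniq.
move=> /(_ mu t t0); rewrite unlock.
set E := (\int[P mu]_w _)%E => hE.
have mf := measurable_expR_pairing fb f0 t0.
have E0 : (0 <= E)%E by apply: integral_ge0 => w _; rewrite lee_fin expR_ge0.
have E1 : (E <= 1)%E.
  rewrite -(@probability_setT _ _ _ (P mu)) -[leRHS]mul1e -integral_cst//.
  apply: ge0_le_integral => //.
  - exact/measurable_EFinP.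
  - by move=> w _; rewrite lee_fin; case/andP: (expR_pairing_itv (X t w) f0).
have Efin : E \is a fin_num by rewrite ge0_fin_numE// (le_lt_trans E1) ?ltry.
rewrite -(fineK Efin) in E0 *; rewrite lee_fin in E0.
have En0 : fine E != 0.
  apply/eqP => e; have : (\int[P mu]_w `|(expR (- pairing f (X t w)))%:E| = 0)%E.
    rewrite -[RHS]/(0%:E) -e fineK//; apply: eq_integral => w _.
    by rewrite gee0_abs ?lee_fin ?expR_ge0.
  have mf' := (measurable_EFinP _ _).2 mf.
  move=> /(ae_eq_integral_abs _ measurableT mf').1.
  case=> N [mN N0 hN].
  have : (P mu setT <= P mu N)%E.
    apply: le_measure; rewrite ?inE// => w _; apply: hN => /= /(_ I) [] /eqP.
    by rewrite gt_eqF// expR_gt0.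
  by rewrite N0 probability_setT lee_fin ler10.
congr EFin; rewrite -hE opprK lnK// posrE lt_neqAle eq_sym En0; exact: E0.
Qed.

(** Weighted by the indicator of [A], the Dirac kernel at [X (s + t)] and the law of the state at
    time [t] started from [X s] have the same mixture on measurable sets: this is [sbm_markov]. *)
Lemma sbm_markov_laplace f v mu s t A : bounded_continuous f -> (forall x, 0 <= f x) ->
  evolution_solution psi f v -> 0 <= s -> 0 <= t -> natural_filtration X s A ->
  (\int[P mu]_(w in A) (expR (- pairing f (X (s + t)%R w)))%:E =
   \int[P mu]_(w in A) (expR (- pairing (v ^~ t) (X s w)))%:E)%E.
Proof.
move=> fb f0 hv s0 t0 As; have mA := natural_filtration_measurable As.
have st0 : 0 <= s + t by rewrite addr_ge0.
have mXt := sbm_measurable hX t0; have mXs := sbm_measurable hX s0.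
have mXst := sbm_measurable hX st0.
pose h (m : MF R) := (expR (- pairing f m))%:E.
have mh : measurable_fun setT h.
  apply/measurable_EFinP; apply: (measurableT_comp (@measurable_expR R)).
  by apply: measurableT_comp => //; exact: measurable_pairing.
have h0 m : (0 <= h m)%E by rewrite lee_fin expR_ge0.
have indic01 w : 0 <= (\1_A w : R) <= 1.
    by rewrite indicE ler0n (ler_nat _ _ 1) leq_b1.
pose k w : giry (MF R) R := giry_ret (X (s + t) w).
pose k' w : giry (MF R) R := giry_map mXt (P (X s w)).
have e := @eq_integral_scaled_mixture _ _ W (MF R) R (P mu) \1_A \1_A k k' h.
have {}e : (\int[P mu]_w ((\1_A w)%:E * \int[k w]_y h y) =
            \int[P mu]_w ((\1_A w)%:E * \int[k' w]_y h y))%E.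
  apply: e => //.
  - move=> B mB; have := measurable_fun_dirac mB; move=> /(_ R) hd.
    exact: (measurableT_comp (hd setT) mXst).
  - move=> B mB; exact: (measurableT_comp (sbm_kernel hX t0 mB) mXs).
  - move=> B mB.
    transitivity (P mu (A `&` X (s + t) @^-1` B)).
      have mAB : measurable (A `&` X (s + t) @^-1` B).
        by apply: measurableI => //; rewrite -[X in measurable X]setTI; exact: mXst.
      rewrite -[A `&` _ in RHS]setIT -[RHS]integral_indic//.
      by apply: eq_integral => w _; rewrite /k /= diracE -EFinM !indicE in_setI -natrM mulnb.
    rewrite (sbm_markov hX)// integral_mkcond; apply: eq_integral => w _.
    by rewrite epatch_indic /= muleC.
rewrite integral_mkcond [RHS]integral_mkcond.
transitivity (\int[P mu]_w ((\1_A w)%:E * \int[k w]_y h y))%E.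
  apply: eq_integral => w _; rewrite epatch_indic /= muleC; congr (_ * _)%E.
  by rewrite integral_dirac// diracT mul1e.
rewrite e; apply: eq_integral => w _; rewrite epatch_indic /= muleC; congr (_ * _)%E.
have := @giry_int_map _ _ _ _ R _ mXt (P (X s w)) h mh h0; rewrite /giry_int => ->.
exact: sbm_expectation.
Qed.

Lemma sbm_markov_product f v phi mu s t : bounded_continuous f -> (forall x, 0 <= f x) ->
  bounded_continuous phi -> (forall x, 0 <= phi x) ->
  evolution_solution psi f v -> 0 <= s -> 0 <= t ->
  (\int[P mu]_w (expR (- pairing f (X (s + t)%R w)) * expR (- pairing phi (X s w)))%:E =
   \int[P mu]_w (expR (- pairing (v ^~ t) (X s w)) * expR (- pairing phi (X s w)))%:E)%E.
Proof.
move=> fb f0 phib phi0 hv s0 t0.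
have st0 : 0 <= s + t by rewrite addr_ge0.
have vb := evolution_bounded_continuous fb.1 hv t0.
have v0 x : 0 <= v x t by case: hv => + _ _ _ _; exact.
have mXs := sbm_measurable hX s0.
pose h (m : MF R) := (expR (- pairing phi m))%:E.
have mh : measurable_fun setT h.
  apply/measurable_EFinP; apply: (measurableT_comp (@measurable_expR R)).
  by apply: measurableT_comp => //; exact: measurable_pairing.
have h0 m : (0 <= h m)%E by rewrite lee_fin expR_ge0.
pose k w : giry (MF R) R := giry_ret (X s w).
pose D w := expR (- pairing f (X (s + t) w)).
pose D' w := expR (- pairing (v ^~ t) (X s w)).
have mk B : measurable B -> measurable_fun setT (fun w => k w B).
  move=> mB; have := measurable_fun_dirac mB; move=> /(_ R) hd.
  exact: (measurableT_comp (hd setT) mXs).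
have intk w : (\int[k w]_y h y = h (X s w))%E by rewrite integral_dirac// diracT mul1e.
have kE (E : W -> R) B : measurable B ->
    (\int[P mu]_w ((E w)%:E * k w B) = \int[P mu]_(w in X s @^-1` B) (E w)%:E)%E.
  move=> mB; rewrite [RHS]integral_mkcond; apply: eq_integral => w _.
  by rewrite epatch_indic /= diracE indicE.
have e : (\int[P mu]_w ((D w)%:E * \int[k w]_y h y) =
          \int[P mu]_w ((D' w)%:E * \int[k w]_y h y))%E.
  apply: (@eq_integral_scaled_mixture _ _ W (MF R) R (P mu) D D' k k h _ _ _ _ mk mk _ mh h0).
  - by move=> w; exact: expR_pairing_itv.
  - by move=> w; exact: expR_pairing_itv.
  - exact: measurable_expR_pairing.
  - exact: measurable_expR_pairing.
  - move=> B mB; rewrite (kE D B mB) (kE D' B mB).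
    have ss : 0 <= s <= s by rewrite s0 lexx.
    exact: (sbm_markov_laplace mu fb f0 hv s0 t0 (natural_filtration_preimage ss mB)).
transitivity (\int[P mu]_w ((D w)%:E * \int[k w]_y h y))%E.
  by apply: eq_integral => w _; rewrite intk -EFinM.
by rewrite e; apply: eq_integral => w _; rewrite intk -EFinM.
Qed.

End super_brownian_motion.

(** * Equilibria and waves as solutions of the evolution equation *)

Section wave_evolution.
Context {R : realType} {psi : R -> R} {al ls : R}.
Hypothesis M : mechanism psi al ls.
Let ls0 := mech_ls M.

Lemma equilibrium_evolution : evolution_solution psi (cst ls) (fun _ _ => ls).
Proof.
split => //.
- by move=> x t _; exact: ltW.
- by move=> T; exists ls.
- exact: continuous_subspaceT (fun p => @cvg_cst _ _ _ _ _).
- move=> x t t0; rewrite (mech_psils M) subr0.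
  have e : (fun=> ls) = cst ls :> (R -> R) by [].
  rewrite e derive1_cst.
  have -> : derive1 (cst ls : R -> R) = cst 0 by apply/funext => y; rewrite derive1_cst.
  by split; rewrite ?derive1_cst ?mulr0//; exact: derivable_cst.
Qed.

Context {c : R} {Phi : R -> R}.
Hypothesis W : travelling_wave psi ls c Phi.

Lemma wave_bounded_continuous a : bounded_continuous (fun x => Phi (x + a)).
Proof.
split.
  move=> x; apply: (@continuous_comp _ _ _ (fun x => x + a) Phi); last exact: wave_continuous W _.
  by apply: cvgD; [exact: cvg_id|exact: cvg_cst].
by exists ls => x; rewrite gtr0_norm ?(wave_gt0 M W)// (wave_le_ls W).
Qed.

Lemma wave_evolution a :
  evolution_solution psi (fun x => Phi (x + a)) (fun x t => Phi (x + a - c * t)).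
Proof.
have Wx := wave_is_derive W; have Wxx := wave_is_derive2 W.
have dx (x t : R) : is_derive x 1 (fun x => Phi (x + a - c * t)) (derive1 Phi (x + a - c * t)).
  rewrite -[X in is_derive _ _ _ X]mulr1.
  have h : is_derive x 1 (fun x => x + a - c * t) 1 by apply: is_derive_eq; rewrite !addr0 subr0.
  exact: (is_derive1_comp (Wx _) h).
have dxx (x t : R) : is_derive x 1 (fun x => derive1 Phi (x + a - c * t))
    (2 * psi (Phi (x + a - c * t)) - 2 * c * derive1 Phi (x + a - c * t)).
  rewrite -[X in is_derive _ _ _ X]mulr1.
  have h : is_derive x 1 (fun x => x + a - c * t) 1 by apply: is_derive_eq; rewrite !addr0 subr0.
  exact: (is_derive1_comp (Wxx _) h).
have dt (x t : R) : is_derive t 1 (fun t => Phi (x + a - c * t)) (derive1 Phi (x + a - c * t) * - c).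
  have h : is_derive t 1 (fun t => x + a - c * t) (- c).
    by apply: is_derive_eq; rewrite /GRing.scale /=; ring.
  exact: (is_derive1_comp (Wx _) h).
split.
- by move=> x t _; exact: ltW (wave_gt0 M W _).
- by move=> T; exists ls => x t _; exact: (wave_le_ls W).
- apply: continuous_subspaceT => -[x t].
  apply: (@continuous_comp _ _ _ (fun p : R * R => p.1 + a - c * p.2) Phi); last exact: wave_continuous W _.
  apply: cvgB; first by apply: cvgD; [exact: cvg_fst|exact: cvg_cst].
  by apply: cvgM; [exact: cvg_cst|exact: cvg_snd].
- move=> x t t0.
  have e1 : derive1 (fun x => Phi (x + a - c * t)) = fun x => derive1 Phi (x + a - c * t).
    by apply/funext => y; rewrite derive1E; have [_ ->] := dx y t.
  have [h1 _] := dx x t; have [h2 e2] := dxx x t; have [h3 e3] := dt x t.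
  have e4 : derive1 (fun t => Phi (x + a - c * t)) t = derive1 Phi (x + a - c * t) * - c.
    by rewrite derive1E; exact: e3.
  have e5 : derive1 (derive1 (fun x => Phi (x + a - c * t))) x =
      2 * psi (Phi (x + a - c * t)) - 2 * c * derive1 Phi (x + a - c * t).
    by rewrite e1 derive1E; exact: e2.
  split; [exact: h3|exact: h1|by rewrite e1; exact: h2|].
  by rewrite e4 e5; field.
- by move=> x; rewrite mulr0 subr0.
Qed.

End wave_evolution.

Lemma pairing_dirac_zero (R : realType) (f : R -> R) : bounded_continuous f ->
  pairing f (@dirac_zero R) = f 0.
Proof.
move=> fb; rewrite /pairing /Rintegral.
have h := @integral_dirac _ (measurableTypeR R) 0 R setT measurableT (EFin \o f).
rewrite (_ : (\int[_]_(_ in _) _)%E = (f 0)%:E)//.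
rewrite h ?diracT ?mul1e//.
by apply/measurable_EFinP; exact: bounded_continuous_measurable.
Qed.

(** * Extinction *)

Section extinction.
Context {R : realType} {psi : R -> R} {al ls : R}.
Hypothesis M : mechanism psi al ls.
Let ls0 := mech_ls M.

(* Uniqueness and translation invariance make the solution spatially constant,
   so that it solves the ordinary equation [g' = - psi g]. *)
Lemma flat_evolution_decay (a : R) (u : R -> R -> R) :
  unique_evolution_solution psi (cst a) u ->
  forall e : R, 0 < e -> exists2 t, 0 <= t & forall x, u x t = u 0 t /\ u 0 t < ls + e.
Proof.
move=> [hu uniq] e e0; have [u0 ub uc du uf] := hu.
have flat (x t : R) : 0 <= t -> u x t = u 0 t.
  move=> t0.
  have shift b : evolution_solution psi (cst a) (fun y s => u (y + b) s).
    split.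
    - by move=> y s; exact: u0.
    - by move=> T; have [C hC] := ub T; exists C => y s; exact: hC.
    - apply/subspace_continuousP => -[y s] /= s0 U hU.
      have /subspace_continuousP/(_ (y + b, s) s0 U hU) := uc.
      rewrite /= !nbhs_simpl /within /= => hn.
      have Tc : (q.1 + b, q.2) @[q --> ((y, s) : R * R)] --> (y + b, s).
        apply: (@cvg_pair _ _ _ (nbhs ((y, s) : R * R)) (nbhs (y + b)) (nbhs s) _ _ _
          (fun q : R * R => q.1 + b) (fun q => q.2)).
          by apply: cvgD; [exact: cvg_fst|exact: cvg_cst].
        exact: cvg_snd.
      exact: (@filterS _ (nbhs ((y, s) : R * R)) _ _ _ (fun q hq Aq => hq Aq) (Tc _ hn)).
    - move=> y s s0; have [h1 h2 h3 h4] := du (y + b) s s0.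
      have e1 : derive1 (fun y => u (y + b) s) = fun y => derive1 (u ^~ s) (y + b).
        apply/funext => z; have [_ k2 _ _] := du (z + b) s s0.
        rewrite !derive1E; have [_ ->//] := is_derive_shift (derivableP k2).
      have [k2 _] := is_derive_shift (derivableP h2).
      have [k3 e3] := is_derive_shift (derivableP h3).
      split; [exact: h1|exact: k2|by rewrite e1; exact: k3|].
      have -> : derive1 (derive1 (fun y => u (y + b) s)) y = derive1 (derive1 (u ^~ s)) (y + b).
        by rewrite e1 derive1E [RHS]derive1E; exact: e3.
      exact: h4.
    - by move=> y; rewrite uf.
  by have := uniq _ (shift x) 0 t t0; rewrite add0r.
have dg (t : R) : 0 < t -> is_derive t 1 (u 0) (- psi (u 0 t)).
  move=> t0; have [h1 _ _ h4] := du 0 t t0.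
  apply: DeriveDef => //; rewrite -derive1E h4.
  have -> : u ^~ t = cst (u 0 t) by apply/funext => x; rewrite flat// ltW.
  have -> : derive1 (cst (u 0 t) : R -> R) = cst 0 by apply/funext => y; rewrite derive1_cst.
  by rewrite derive1_cst mulr0 sub0r.
pose k := psi (ls + e); have k0 : 0 < k by apply: (mech_gt0 M); rewrite ltrDl.
(* As long as [u >= ls + e] it decreases at rate at least [k]; from time 1 to [T + 1] it would
   become negative. The start is at 1 because the equation holds only for positive times. *)
pose T := 1 + u 0 1 / k.
have T1 : 1 <= T by rewrite lerDl divr_ge0 ?u0// ltW.
have [[t /andP[t1 tT] ht]|hT] := pselect (exists2 t, 1 <= t <= T + 1 & u 0 t < ls + e).
  have t0 : 0 <= t by lra.
  by exists t => // x; rewrite flat.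
have hge (t : R) : 1 <= t <= T + 1 -> ls + e <= u 0 t.
  by move=> tT; rewrite leNgt; apply/negP => ?; apply: hT; exists t.
have dG (t : R) : 0 < t -> is_derive t 1 (fun t => u 0 t + k * t) (- psi (u 0 t) + k).
  by move=> t0; have h := dg t t0; apply: is_derive_eq; rewrite /GRing.scale /= mulr1.
have T11 : 1 <= T + 1 by lra.
have := @derive_le0_le _ (fun t => u 0 t + k * t) (fun t => - psi (u 0 t) + k) 1 (T + 1) T11.
have h1 (t : R) : 1 < t < T + 1 -> is_derive t 1 (fun t => u 0 t + k * t) (- psi (u 0 t) + k).
  by move=> /andP[t1 _]; apply: dG; lra.
have h2 (t : R) : 1 < t < T + 1 -> - psi (u 0 t) + k <= 0.
  move=> /andP[t1 tT]; rewrite addrC subr_le0; apply: (mech_ndecr M); first by rewrite lerDl ltW.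
  by apply: hge; rewrite !ltW.
have h3 (t : R) : 1 <= t <= T + 1 -> {for t, continuous (fun t => u 0 t + k * t)}.
  by move=> /andP[t1 _]; apply: is_derive1_continuous (dG t _); lra.
move=> /(_ h1 h2 h3).
have -> : k * (T + 1) = 2 * k + u 0 1 by rewrite /T; field; rewrite gt_eqF.
have T0 : 0 <= T + 1 by lra.
by have := u0 0 (T + 1) T0; lra.
Qed.

Context {d : measure_display} {W : measurableType d} {X : R -> W -> MF R}
  {P : MF R -> probability W R}.
Hypothesis hX : super_brownian_motion psi X P.
Implicit Types (s t h e : R) (mu : MF R) (A : set W).

Let N t w := expR (- pairing (cst ls) (X t w)).

Let N_itv t w : 0 <= N t w <= 1.
Proof. by apply: expR_pairing_itv => x; exact: ltW. Qed.

Let N_ge0 t w : 0 <= N t w. Proof. exact: expR_ge0. Qed.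

Let cst_ge0 (r : R) : 0 <= r -> forall x : R, 0 <= (cst r : R -> R) x.
Proof. by []. Qed.

Let measurable_N t : 0 <= t -> measurable_fun setT (N t).
Proof.
move=> t0; apply: (measurable_expR_pairing hX) => //; first exact: bounded_continuous_cst.
by move=> x; exact: ltW.
Qed.

Let N_markov mu s t A : 0 <= s -> 0 <= t -> natural_filtration X s A ->
  (\int[P mu]_(w in A) (N (s + t) w)%:E = \int[P mu]_(w in A) (N s w)%:E)%E.
Proof.
move=> s0 t0 As; have b := bounded_continuous_cst ls.
exact: (sbm_markov_laplace hX mu b (cst_ge0 (ltW ls0)) (equilibrium_evolution M) s0 t0 As).
Qed.

Let N_expectation mu t : 0 <= t ->
  (\int[P mu]_w (N t w)%:E = (expR (- pairing (cst ls) mu))%:E)%E.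
Proof.
move=> t0; have b := bounded_continuous_cst ls.
exact: (sbm_expectation hX mu b (cst_ge0 (ltW ls0)) (equilibrium_evolution M) t0).
Qed.

Let low s e : set W := [set w | N s w <= 1 - e].

Let low_filtration s e : 0 <= s -> natural_filtration X s (low s e).
Proof.
move=> s0.
have -> : low s e = X s @^-1` [set m | expR (- pairing (cst ls) m) <= 1 - e] by [].
apply: natural_filtration_preimage; first by rewrite s0 lexx.
have mf : measurable_fun setT (fun m : MF R => expR (- pairing (cst ls) m)).
  apply: (measurableT_comp (@measurable_expR R)); apply: measurableT_comp => //.
  apply: measurable_pairing; first exact: bounded_continuous_cst.
  by move=> x; exact: ltW.
have := mf measurableT [set` `]-oo, (1 - e)]] (measurable_itv _).
by rewrite setTI; congr measurable; apply/seteqP; split => m /=; rewrite in_itv.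
Qed.

Let grid s h e (K : nat) : set W := [set w | exists2 k, (k <= K)%N & low (s + k%:R * h) e w].

Let measurable_grid s h e K : 0 <= s -> 0 <= h -> measurable (grid s h e K).
Proof.
move=> s0 h0.
have -> : grid s h e K = \bigcup_(k in [set k | (k <= K)%N]) low (s + k%:R * h) e.
  by apply/seteqP; split => w [k hk wk]; exists k.
apply: bigcup_measurable => k _.
by apply: (natural_filtration_measurable hX); apply: low_filtration; rewrite addr_ge0// mulr_ge0.
Qed.

Let N_le mu t A : 0 <= t -> measurable A ->
  (\int[P mu]_(w in A) (N t w)%:E <= P mu A)%E.
Proof.
move=> t0 mA; rewrite -[leRHS]mul1e -integral_cst//; apply: ge0_le_integral => //.
- by move=> w _; rewrite lee_fin.
- by apply/measurable_EFinP; exact: measurable_funS (measurable_N t0).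
- by move=> w _; rewrite lee_fin; case/andP: (N_itv t w).
Qed.

Let N_fin mu t A : 0 <= t -> measurable A ->
  (\int[P mu]_(w in A) (N t w)%:E \is a fin_num)%E.
Proof.
move=> t0 mA.
have h0 : (0 <= \int[P mu]_(w in A) (N t w)%:E)%E.
  by apply: integral_ge0 => w _; rewrite lee_fin.
rewrite ge0_fin_numE// (le_lt_trans (N_le mu t0 mA))//.
by rewrite (le_lt_trans (probability_le1 _ mA))// ltry.
Qed.

Let I mu t A := fine (\int[P mu]_(w in A) (N t w)%:E)%E.
Let p mu A := fine (P mu A).

Let IE mu t A : 0 <= t -> measurable A -> (\int[P mu]_(w in A) (N t w)%:E = (I mu t A)%:E)%E.
Proof. by move=> t0 mA; rewrite /I fineK// N_fin. Qed.

Let pE mu A : measurable A -> P mu A = (p mu A)%:E.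
Proof. by move=> mA; rewrite /p fineK// fin_num_measure. Qed.

Let I_split mu t A B : 0 <= t -> measurable A -> measurable B ->
  I mu t A = I mu t (A `\` B) + I mu t (A `&` B).
Proof.
move=> t0 mA mB; apply: EFin_inj.
have mD := measurableD mA mB; have mI := measurableI _ _ mA mB.
rewrite EFinD -!IE//.
have <- := ge0_integral_setU (P mu) mD mI (f := fun w => (N t w)%:E).
- by rewrite setUC setUIDK.
- by apply/measurable_EFinP; exact: measurable_funS (measurable_N t0).
- by move=> w _; rewrite lee_fin.
- by apply/disj_setPS => w /= [[_ ?] []].
Qed.

Let p_split mu A B : measurable A -> measurable B ->
  p mu A = p mu (A `\` B) + p mu (A `&` B).
Proof.
move=> mA mB; apply: EFin_inj.
have mD := measurableD mA mB; have mI := measurableI _ _ mA mB.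
by rewrite EFinD -!pE// -measureDI.
Qed.

Let p_le mu A B : measurable A -> measurable B -> A `<=` B -> p mu A <= p mu B.
Proof. by move=> mA mB AB; rewrite -lee_fin -!pE// le_measure ?inE. Qed.

Let I_le mu t A : 0 <= t -> measurable A -> I mu t A <= p mu A.
Proof. by move=> t0 mA; rewrite -lee_fin -IE// -pE// N_le. Qed.

Let I_low mu t e A : 0 <= t -> measurable A -> e <= 1 -> A `<=` low t e ->
  I mu t A <= (1 - e) * p mu A.
Proof.
move=> t0 mA e1 Ae; rewrite -lee_fin EFinM -IE// -pE// -integral_cst//.
apply: ge0_le_integral => //.
- by move=> w _; rewrite lee_fin.
- by apply/measurable_EFinP; exact: measurable_funS (measurable_N t0).
Qed.

(* Ville's inequality along a grid, in the form
   [E(N_s; A) + e P(A, N falls to 1 - e) <= P(A)]. *)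
Let ville_grid mu e h K : 0 <= e <= 1 -> 0 <= h -> forall s A, 0 <= s ->
  natural_filtration X s A ->
  I mu s A + e * p mu (A `&` grid s h e K) <= p mu A.
Proof.
move=> /andP[e0 e1] h0; elim: K => [|K IH] s A s0 As;
  have mA := natural_filtration_measurable hX As;
  have lF := low_filtration e s0;
  have mL := natural_filtration_measurable hX lF;
  have mD := measurableD mA mL; have mI := measurableI _ _ mA mL;
  have hI : I mu s (A `&` low s e) <= (1 - e) * p mu (A `&` low s e)
    by apply: I_low => // w [].
  rewrite (I_split mu s0 mA mL) (p_split mu mA mL).
  have -> : A `&` grid s h e 0 = A `&` low s e.
    apply/seteqP; split => w [Aw hw]; split => //.
      by case: hw => k; rewrite leqn0 => /eqP ->; rewrite mul0r addr0.
    by exists 0%N => //; rewrite mul0r addr0.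
  by have := I_le mu s0 mD; lra.
(* On the part of [A] where [N] is already low the bound is direct; on the rest the martingale
   property moves the integral to time [s + h], where the induction hypothesis applies. *)
rewrite (I_split mu s0 mA mL) (p_split mu mA mL).
have sh0 : 0 <= s + h by rewrite addr_ge0.
have Ds : natural_filtration X s (A `\` low s e) by exact: natural_filtrationD.
have Dsh : natural_filtration X (s + h) (A `\` low s e).
  by apply: natural_filtration_le Ds; rewrite lerDl.
have := IH _ _ sh0 Dsh.
have -> : I mu (s + h) (A `\` low s e) = I mu s (A `\` low s e).
  by rewrite /I N_markov.
have mG := measurable_grid e K.+1 s0 h0; have mG' := measurable_grid e K sh0 h0.
have mU : measurable ((A `\` low s e) `&` grid (s + h) h e K `|` A `&` low s e).
  by apply: measurableU => //; exact: measurableI.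
have : p mu (A `&` grid s h e K.+1) <=
    p mu ((A `\` low s e) `&` grid (s + h) h e K) + p mu (A `&` low s e).
  apply: (@le_trans _ _ (p mu ((A `\` low s e) `&` grid (s + h) h e K `|` A `&` low s e))).
    apply: p_le => //; first exact: measurableI.
    move=> w [Aw [[_|k kK wk]]].
      by rewrite mul0r addr0 => ?; right.
    have [wl|wl] := pselect (low s e w); first by right.
    left; split => //; exists k => //.
    have -> : s + h + k%:R * h = s + k.+1%:R * h by rewrite -natr1; ring.
    exact: wk.
  rewrite -lee_fin EFinD -!pE//; last exact: measurableI.
  by apply: measureU2 => //; exact: measurableI.
move=> h1 h2.
have : e * p mu (A `&` grid s h e K.+1) <=
    e * p mu ((A `\` low s e) `&` grid (s + h) h e K) + e * p mu (A `&` low s e).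
  by rewrite -mulrDr ler_wpM2l.
move: h2 hI; move: (I mu s (A `\` low s e)) (I mu s (A `&` low s e))
  (p mu (A `&` grid s h e K.+1)) (p mu ((A `\` low s e) `&` grid (s + h) h e K))
  (p mu (A `\` low s e)) (p mu (A `&` low s e)) => *; lra.
Qed.

(** Mesh [2^-j] with [4^j] steps covers a time span [2^j]: resolution and horizon grow together, and
    the grids are nested, so probabilities pass to the limit monotonically. *)
Let below s e : set W := \bigcup_j grid s (2 ^- j) e (4 ^ j).

Let measurable_below s e : 0 <= s -> measurable (below s e).
Proof. by move=> s0; apply: bigcup_measurable => j _; exact: measurable_grid. Qed.

Let ville mu s e A : 0 <= e <= 1 -> 0 <= s -> natural_filtration X s A ->
  I mu s A + e * p mu (A `&` below s e) <= p mu A.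
Proof.
move=> /andP[]; rewrite le_eqVlt => /predU1P[<- _|e0 e1] s0 As;
  have mA := natural_filtration_measurable hX As.
  by rewrite mul0r addr0 I_le.
have cv : (P mu (A `&` grid s (2 ^- j) e (4 ^ j)) @[j --> \oo] --> P mu (A `&` below s e))%E.
  rewrite /below setI_bigcupr; apply: nondecreasing_cvg_mu.
  - by move=> j; apply: measurableI => //; exact: measurable_grid.
  - by apply: bigcup_measurable => j _; apply: measurableI => //; exact: measurable_grid.
  - apply/nondecreasing_seqP => j; apply/subsetPset => w [Aw [k kK wk]]; split => //.
    exists (2 * k)%N; first by rewrite expnS leq_mul.
    have -> : (2 * k)%:R * 2 ^- j.+1 = k%:R * 2 ^- j :> R.
      by rewrite natrM exprS invfM mulrACA divff ?mul1r// pnatr_eq0.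
    exact: wk.
have e1' : 0 <= e <= 1 by rewrite ltW.
rewrite addrC -lerBrDr -ler_pdivlMl// -lee_fin -pE; last first.
  by apply: measurableI => //; exact: measurable_below.
apply: (cvge_to_le cv); apply: nearW => j.
have mg : measurable (A `&` grid s (2 ^- j) e (4 ^ j)).
  by apply: measurableI => //; exact: measurable_grid.
by rewrite pE// lee_fin ler_pdivlMl// lerBrDr addrC; exact: ville_grid.
Qed.

(** If [N t w < 1 - e], right continuity keeps [N] below this level just after [t], where a fine
    enough grid has a point. *)
Let below_stay s e w t : 0 <= s -> ~ below s e w -> s <= t -> 1 - e <= N t w.
Proof.
move=> s0 hw st; rewrite leNgt; apply/negP => Nt; apply: hw.
have t0 : 0 <= t by exact: le_trans st.
have : N r w @[r --> t^'+] --> N t w.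
  have c := sbm_right_continuous hX (w := w) (bounded_continuous_cst ls) t0.
  have {}c : - pairing (cst ls) (X r w) @[r --> t^'+] --> - pairing (cst ls) (X t w) by exact: cvgN.
  exact: (cvg_comp _ expR c (@continuous_expR R _)).
move=> /(cvgr_lt _)/(_ _ Nt) [r /= r0 hr].
(* Large enough for the mesh to be less than [r] and for the next grid point after [t], of index at
   most [(t - s + 1) 2^j], to be within the [4^j] steps. *)
pose j := (Num.truncn (Num.max r^-1 (t - s + 1))).+1.
have jr : r^-1 < j%:R by apply: le_lt_trans (truncnS_gt _); rewrite le_max lexx.
have jt : t - s + 1 < j%:R by apply: le_lt_trans (truncnS_gt _); rewrite le_max lexx orbT.
have j2 : (j%:R : R) <= 2 ^+ j by rewrite -natrX ler_nat ltnW// ltn_expl.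
pose k := Num.truncn ((t - s) * 2 ^+ j).
have ts0 : 0 <= (t - s) * 2 ^+ j by rewrite mulr_ge0 ?subr_ge0// exprn_ge0.
have /andP[k1 k2] := truncn_itv ts0.
have p0 : 0 < 2 ^+ j :> R by rewrite exprn_gt0.
exists j => //; exists k.+1.
  rewrite -(ler_nat R) (_ : 4 = 2 * 2)%N// expnMn natrM natrX.
  rewrite -natr1 (le_trans (_ : _ <= (t - s) * 2 ^+ j + 1))// ?lerD//.
  have h1 : 1 <= 2 ^+ j :> R by rewrite exprn_ege1// ler1n.
  apply: (@le_trans _ _ ((t - s + 1) * 2 ^+ j)); first by rewrite (mulrDl (t - s) 1) mul1r lerD.
  by rewrite ler_wpM2r ?(ltW p0)// (le_trans (ltW jt)).
have pn0 : 2 ^+ j != 0 :> R by rewrite gt_eqF.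
have h1 : t < s + k.+1%:R * 2 ^- j.
  by rewrite -ltrBlDl ltr_pdivlMr.
have h2 : 2 ^- j < r :> R.
  by rewrite -[ltRHS]invrK ltf_pV2 ?posrE ?invr_gt0// (lt_le_trans jr).
have h3 : s + k.+1%:R * 2 ^- j <= t + 2 ^- j.
  have : k%:R * 2 ^- j <= t - s by rewrite ler_pdivrMr.
  by rewrite -(natr1 k) mulrDl mul1r; move: (2 ^- j : R) (k%:R : R) => *; lra.
apply/ltW/hr => //=.
by rewrite ltr0_norm; lra.
Qed.

(** [N^2] is the Laplace functional of the constant [2 ls]. The flat solution from [2 ls] falls
    below [ls + e / (1 + m)] at some time, and the excess, multiplied by the initial mass [m], costs
    at most [e]. *)
Let N_sqr_expectation mu e : 0 < e -> exists2 s, 0 <= s &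
  ((expR (- (ls * pairing (cst 1) mu)) - e)%:E <= \int[P mu]_w (N s w ^+ 2)%:E)%E.
Proof.
move=> e0; set m := pairing (cst 1) mu.
have cb := @bounded_continuous_cst R.
have m0 : 0 <= m by exact: pairing_ge0.
have f0 (x : R) : 0 <= cst (2 * ls) x by rewrite mulr_ge0// ltW.
have [u [hu uniq] _] := sbm_laplace hX (cb (2 * ls)) f0.
have e1 : 0 < e / (1 + m) by rewrite divr_gt0// ltr_pwDl.
have [s s0 hs] := flat_evolution_decay (conj hu uniq) e1.
exists s => //.
have -> : (\int[P mu]_w (N s w ^+ 2)%:E = \int[P mu]_w (expR (- pairing (cst (2 * ls)) (X s w)))%:E)%E.
  apply: eq_integral => w _; rewrite -expRM_natr.
  by rewrite [in RHS]pairing_cst pairing_cst; congr (expR _)%:E; ring.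
rewrite (sbm_expectation hX mu (cb (2 * ls)) f0 hu s0) lee_fin.
have -> : u ^~ s = cst (u 0 s) by apply/funext => x; case: (hs x).
have [_ us] := hs 0.
rewrite pairing_cst -/m.
apply: (@le_trans _ _ (expR (- (ls * m)) * expR (- (e / (1 + m) * m)))); last first.
  by rewrite -expRD ler_expR -opprD lerN2 -mulrDl ler_wpM2r// ltW.
have h1 := expR_ge1Dx (- (e / (1 + m) * m)).
have h2 : e / (1 + m) * m <= e.
  by rewrite mulrAC ler_pdivrMr ?ltr_pwDl// ler_wpM2l ?lerDr// ltW.
have h3 : expR (- (ls * m)) <= 1 by rewrite -expR0 ler_expR oppr_le0 mulr_ge0// ltW.
have h4 := expR_ge0 (- (ls * m)).
apply: (@le_trans _ _ (expR (- (ls * m)) * (1 - e))).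
  by rewrite mulrBr mulr1 lerD2l lerN2 ler_piMl// ltW.
by rewrite ler_wpM2l// (le_trans _ h1)// lerD2l lerN2.
Qed.

Let stay e : set W := [set w | exists2 s, 0 <= s & forall t, s <= t -> 1 - e <= N t w].

(** With the second moment of [N s] within [D^2] of the first, the event [N s <= 1 - D] contributes
    at most [D] to the mean. On its complement [A], Ville's inequality bounds the probability of a
    later fall to [1 - e] by [D / e = n / 2], and [P(A)] is at least the mean minus [D <= n / 2]. *)
Let stay_probability mu e (n : R) : 0 < e <= 1 -> 0 < n <= 1 -> exists G,
  [/\ measurable G, G `<=` stay e & expR (- (ls * pairing (cst 1) mu)) - n <= p mu G].
Proof.
move=> /andP[e0 e1] /andP[n0 n1]; set q := expR _.
pose D := n * e / 2; have D0 : 0 < D by rewrite divr_gt0// mulr_gt0.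
have D1 : D <= 1.
  by rewrite /D ler_pdivrMr// mul1r (le_trans (ler_piMr (ltW n0) e1))// (le_trans n1)// ler1n.
have [s s0 hs] := N_sqr_expectation mu (mulr_gt0 D0 D0).
have lF := low_filtration D s0; have mL := natural_filtration_measurable hX lF.
pose A := setT `\` low s D.
have TF : natural_filtration X s setT.
  have := low_filtration 0 s0; congr natural_filtration.
  by apply/seteqP; split => // w _; rewrite /low /= subr0; case/andP: (N_itv s w).
have AF : natural_filtration X s A by exact: natural_filtrationD.
have mA := natural_filtration_measurable hX AF.
have mB := measurable_below e s0.
exists (A `\` below s e); split; first exact: measurableD.
  by move=> w [_ wB]; exists s => // t; exact: below_stay.
have e01 : 0 <= e <= 1 by rewrite ltW.
have V := ville mu e01 s0 AF.
have pS := p_split mu mA mB.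
have IT : I mu s setT = q.
  by rewrite /I N_expectation//= /q pairing_cst.
have IS := I_split mu s0 measurableT mL; rewrite setTI IT in IS.
have IA : (1 - D) * p mu A <= I mu s A.
  rewrite -lee_fin EFinM -IE// -pE// -integral_cst//.
  apply: ge0_le_integral => //.
  - by move=> w [_ wL]; rewrite lee_fin subr_ge0.
  - by apply/measurable_EFinP; exact: measurable_funS (measurable_N s0).
  - by move=> w [_ wL]; rewrite lee_fin ltW// ltNge; apply/negP.
have pA1 : p mu A <= 1 by rewrite -lee_fin -pE//; exact: probability_le1.
have IL : I mu s (low s D) <= D.
  have hI : measurable_fun setT (fun w => (N s w ^+ 2)%:E).
    by apply/measurable_EFinP; apply: measurable_funX; exact: measurable_N.
  have : (\int[P mu]_w (N s w ^+ 2)%:E <= ((1 - D) * I mu s (low s D) + I mu s A)%:E)%E.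
    rewrite -(setUIDK setT (low s D)) setTI.
    rewrite ge0_integral_setU//; last 3 first.
    - exact: measurable_funS hI.
    - by move=> w _; rewrite lee_fin exprn_ge0.
    - by apply/disj_setPS => w [? []].
    rewrite EFinD leeD//.
      rewrite EFinM -IE// -ge0_integralZl//.
      - apply: ge0_le_integral => //.
        + by move=> w _; rewrite lee_fin exprn_ge0.
        + exact: measurable_funS hI.
        + apply: emeasurable_funM => //.
          by apply/measurable_EFinP; exact: measurable_funS (measurable_N s0).
        + by move=> w wL; rewrite -EFinM lee_fin expr2 ler_wpM2r.
      - by apply/measurable_EFinP; exact: measurable_funS (measurable_N s0).
      - by move=> w _; rewrite lee_fin.
      - by rewrite lee_fin subr_ge0.
    rewrite -IE//; apply: ge0_le_integral => //.
    - by move=> w _; rewrite lee_fin exprn_ge0.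
    - exact: measurable_funS hI.
    - by apply/measurable_EFinP; exact: measurable_funS (measurable_N s0).
    - move=> w _; rewrite lee_fin expr2 ler_piMl//; by case/andP: (N_itv s w).
  move=> /(le_trans hs); rewrite lee_fin -/q IS.
  move: (I mu s (low s D)) (I mu s A) => a b h.
  have : D * a <= D * D by lra.
  by rewrite ler_pM2l.
have IAp := I_le mu s0 mA.
have pB : p mu (A `&` below s e) <= n / 2.
  rewrite -(ler_pM2l e0) (_ : e * (n / 2) = D); last by rewrite /D; ring.
  move: (p mu A) (I mu s A) (p mu (_ `&` _)) pA1 IA V => a b x a1 h1 h2.
  have : D * a <= D by rewrite ler_piMr// ltW.
  lra.
have D2 : D <= n / 2.
  by rewrite /D ler_pM2r// ler_piMr// ltW.
move: IS pS IL IAp pB D2.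
move: (I mu s (low s D)) (I mu s A) (p mu A) (p mu (A `\` _)) (p mu (_ `&` _)) => *; lra.
Qed.

Let stay_extinguishing w : (forall n, stay n.+1%:R^-1 w) -> extinguishing X w.
Proof.
move=> hw; rewrite /extinguishing /=; apply/cvgrPdist_lt => e e0.
have pe : 0 < 1 - expR (- (ls * e)) by rewrite subr_gt0 -expR0 ltr_expR oppr_lt0 mulr_gt0.
pose n := Num.truncn (1 - expR (- (ls * e)))^-1.
have hn : n.+1%:R^-1 < 1 - expR (- (ls * e)).
  by rewrite -[ltRHS]invrK ltf_pV2 ?posrE ?invr_gt0// truncnS_gt.
have [s s0 hs] := hw n.
exists s; split; first exact: num_real.
move=> t st /=; rewrite sub0r normrN ger0_norm ?pairing_ge0//.
have hN := hs t (ltW st).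
have : expR (- (ls * e)) < N t w by apply: lt_le_trans hN; rewrite ltrBrDl -ltrBrDr.
by rewrite /N ltr_expR ltrN2 pairing_cst ltr_pM2l.
Qed.

(* [exp(- ls |X_t|)] is a martingale whose second moment converges to its first
   moment, so that its limit is [0] or [1]. *)
Lemma sbm_extinction mu : exists E, [/\ measurable E, E `<=` extinguishing X &
  ((expR (- (ls * pairing (cst 1) mu)))%:E <= P mu E)%E].
Proof.
have /choice[G hG] : forall n, exists G, [/\ measurable G, G `<=` stay n.+1%:R^-1 &
    expR (- (ls * pairing (cst 1) mu)) - n.+1%:R^-1 <= p mu G].
  move=> n; have h : 0 < (n.+1%:R^-1 : R) <= 1 by rewrite invr_gt0 ltr0n invf_le1 ?ler1n ?ltr0n.
  exact: stay_probability.
have mG n : measurable (G n) by case: (hG n).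
have mU n : measurable (\bigcup_(k in [set k | (n <= k)%N]) G k) by apply: bigcup_measurable => k _.
(* The sets [G n] need not be nested, but a path in infinitely many of them stays above every level
   below 1. The upper limit keeps the bound on the probabilities. *)
have mE : measurable (lim_sup_set G) by apply: bigcap_measurable => // n _; exact: mU.
exists (lim_sup_set G); split => //.
  move=> w hw; apply: stay_extinguishing => n.
  have [k /= nk Gk] := hw n Logic.I.
  have [_ /(_ _ Gk)[s s0 hs] _] := hG k.
  exists s => // t st; rewrite (le_trans _ (hs t st))// lerD2l lerN2.
  by rewrite lef_pV2 ?posrE ?ltr0n// ler_nat.
have := lim_sup_set_cvg (P mu) G mG.
move=> /(_ (le_lt_trans (probability_le1 _ (mU 0%N)) (ltry _))) cv.
apply: (cvge_to_ge cv); apply: nearW => n.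
apply: (@le_trans _ _ (p mu (\bigcup_(k in [set k | (n <= k)%N]) G k))%:E); last first.
  by rewrite (esym (pE mu (mU n))); exact: lexx.
rewrite lee_fin; apply/ler_addgt0Pr => e e0.
pose k := maxn n (Num.truncn e^-1).
have ke : k.+1%:R^-1 <= e.
  rewrite -[leRHS]invrK lef_pV2 ?posrE ?invr_gt0 ?ltr0n//.
  by rewrite (le_trans (ltW (truncnS_gt _)))// ler_nat ltnS leq_maxr.
have [_ _ hk] := hG k.
rewrite -lerBlDr (le_trans _ (p_le mu (mG k) (mU n) _)) ?(le_trans _ hk) ?lerD2l ?lerN2//.
by move=> w Gw; exists k => //=; rewrite leq_maxl.
Qed.

End extinction.

(** * The limit of the additive functional *)

Section bounded_expectation.
Context {R : realType} {d : measure_display} {W : measurableType d} (Q : probability W R).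
Implicit Types (f g : W -> R).

Lemma bounded_integrable f (C : R) : measurable_fun setT f -> (forall w, `|f w| <= C) ->
  Q.-integrable setT (EFin \o f).
Proof.
move=> mf fC; apply: measurable_bounded_integrable => //.
  by rewrite (le_lt_trans (probability_le1 _ measurableT))// ltry.
exists C; split; first exact: num_real.
by move=> y Cy x _; rewrite /= (le_trans (fC x))// ltW.
Qed.

Lemma Rintegral_probability_cst (r : R) : \int[Q]_w r = r.
Proof.
have Q1 : fine (Q setT) = 1 by rewrite probability_setT.
by rewrite Rintegral_cst//; exact: etrans (congr1 _ Q1) (mulr1 r).
Qed.

Context (M : nat -> W -> R).
Hypotheses (mM : forall n, measurable_fun setT (M n))
  (M01 : forall n w, 0 <= M n w <= 1)
  (orth : forall n m, (n <= m)%N -> \int[Q]_w (M m w * M n w) = \int[Q]_w (M n w * M n w)).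

Let Mn n w : `|M n w| <= 1.
Proof. by case/andP: (M01 n w) => h0 h1; rewrite ger0_norm. Qed.

Let int_prod n m : Q.-integrable setT (EFin \o (fun w => M n w * M m w)).
Proof.
apply: (@bounded_integrable _ 1); first exact: measurable_funM.
by move=> w; rewrite normrM mulr_ile1.
Qed.

Let increment n m w := M m w - M n w.

Let measurable_increment n m : measurable_fun setT (increment n m).
Proof. exact: measurable_funB. Qed.

Let norm_increment n m w : `|increment n m w| <= 1.
Proof.
have /andP[] := M01 n w; have /andP[] := M01 m w; rewrite /increment => *.
by rewrite ler_norml; apply/andP; split; lra.
Qed.

Let a n := \int[Q]_w (M n w * M n w).

Let int_sqr n m : Q.-integrable setT (EFin \o (fun w => increment n m w * increment n m w)).
Proof.
apply: (@bounded_integrable _ 1); first by apply: measurable_funM; exact: measurable_increment.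
by move=> w; rewrite normrM mulr_ile1.
Qed.

Let increment_sqr n m : (n <= m)%N ->
  \int[Q]_w (increment n m w * increment n m w) = a m - a n.
Proof.
move=> nm.
have -> : \int[Q]_w (increment n m w * increment n m w) =
    \int[Q]_w ((M m w * M m w - M m w * M n w) - (M m w * M n w - M n w * M n w)).
  by apply: eq_Rintegral => w _; rewrite /increment; ring.
have i1 : Q.-integrable setT (EFin \o (fun w => M m w * M m w - M m w * M n w)).
  by apply: (integrableB measurableT (int_prod m m) (int_prod m n)).
have i2 : Q.-integrable setT (EFin \o (fun w => M m w * M n w - M n w * M n w)).
  by apply: (integrableB measurableT (int_prod m n) (int_prod n n)).
rewrite RintegralB// !RintegralB// orth// /a; ring.
Qed.

Let a_mono n m : (n <= m)%N -> a n <= a m.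
Proof.
move=> nm; rewrite -subr_ge0 -increment_sqr//.
by apply: Rintegral_ge0 => w _; rewrite -expr2 sqr_ge0.
Qed.

Let a_le1 n : a n <= 1.
Proof.
rewrite -[leRHS]Rintegral_probability_cst; apply: le_Rintegral => //.
  by apply: (@bounded_integrable _ 1) => // w; rewrite normr1.
by move=> w _; case/andP: (M01 n w) => *; rewrite mulr_ile1.
Qed.

(** By orthogonality the squared increments have mean [a m - a n], with [a] nondecreasing and
    bounded by 1. Along a subsequence on which [a] converges geometrically the increments are
    summable in mean, hence almost surely. *)
Lemma orthogonal_increments_subsequence : exists2 phi : nat -> nat,
  (forall k, (k <= phi k)%N) & \forall w \ae Q, cvgn (fun k => M (phi k) w).
Proof.
have ca : cvgn a.
  apply: nondecreasing_is_cvgn; first exact: a_mono.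
  by exists 1 => _ [n _ <-].
pose l := limn a.
have al n : a n <= l by apply: nondecreasing_cvgn_le => //; exact: a_mono.
have /choice[N hN] : forall k, exists N, forall n, (N <= n)%N -> l - 4 ^- k <= a n.
  move=> k; have : \forall n \near \oo, l - 4 ^- k < a n.
    by apply: (cvgr_gt l ca); rewrite ltrBlDr ltrDl invr_gt0 exprn_gt0.
  by move=> [n _ h]; exists n => m nm; apply/ltW/h.
(* Summing all thresholds makes [phi] nondecreasing as well as above [N k]; the term [k] sends it to
   infinity. *)
pose phi k := (k + \sum_(j < k.+1) N j)%N.
have phiN k : (N k <= phi k)%N.
  by rewrite /phi big_ord_recr /= addnA leq_addl.
have phiS k : (phi k <= phi k.+1)%N.
  by rewrite /phi (big_ord_recr k.+1) /= leq_add// leq_addr.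
exists phi; first by move=> k; rewrite leq_addr.
pose D k w := increment (phi k) (phi k.+1) w.
have mD k : measurable_fun setT (fun w => `|D k w|).
  by apply: measurableT_comp => //; exact: measurable_increment.
have iD k : Q.-integrable setT (EFin \o (fun w => `|D k w|)).
  by apply: (@bounded_integrable _ 1) => // w; rewrite normr_id norm_increment.
have iC (r : R) : Q.-integrable setT (EFin \o (fun=> r)).
  exact: (@bounded_integrable _ `|r|).
have iDD k (r : R) : Q.-integrable setT (EFin \o (fun w => r * (D k w * D k w))).
  exact: (integrableZl measurableT r (int_sqr (phi k) (phi k.+1))).
have ED k : \int[Q]_w `|D k w| <= 2 ^- k.
  have p0 : 0 < 2 ^+ k :> R by rewrite exprn_gt0.
  (* From [2 |x| <= 2^-k + 2^k x^2], with the weights balanced for a second moment of at most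
     [4^-k]. *)
  apply: (@le_trans _ _ (\int[Q]_w (2^-1 * 2 ^- k + 2^-1 * 2 ^+ k * (D k w * D k w)))).
    apply: le_Rintegral => //.
      exact: (integrableD measurableT (iC _) (iDD k _)).
    move=> w _; rewrite -subr_ge0.
    have -> : 2^-1 * 2 ^- k + 2^-1 * 2 ^+ k * (D k w * D k w) - `|D k w| =
        2^-1 * 2 ^- k * (1 - 2 ^+ k * `|D k w|) ^+ 2.
      have -> : D k w * D k w = `|D k w| ^+ 2 by rewrite -normrX ger0_norm ?sqr_ge0.
      by field; rewrite gt_eqF.
    by rewrite mulr_ge0 ?sqr_ge0// mulr_ge0// invr_ge0 ltW.
  rewrite RintegralD//.
  have -> : \int[Q]_w (2^-1 * 2 ^+ k * (D k w * D k w)) =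
      2^-1 * 2 ^+ k * (a (phi k.+1) - a (phi k)).
    rewrite -increment_sqr//.
    exact: (RintegralZl (2^-1 * 2 ^+ k) measurableT (int_sqr (phi k) (phi k.+1))).
  rewrite Rintegral_probability_cst.
  have h1 := hN _ _ (phiN k); have h2 := al (phi k.+1).
  have : 2^-1 * 2 ^+ k * (a (phi k.+1) - a (phi k)) <= 2^-1 * 2 ^+ k * 4 ^- k.
    by rewrite ler_pM2l ?mulr_gt0//; lra.
  have -> : 4 ^- k = 2 ^- k * 2 ^- k :> R.
    by rewrite -invfM -exprMn; congr (_ ^- _); ring.
  have -> : 2^-1 * 2 ^+ k * (2 ^- k * 2 ^- k) = 2^-1 * 2 ^- k :> R by field; rewrite gt_eqF.
  move: (2 ^- k : R) => *; lra.
have sumD : (\int[Q]_w (\sum_(k <oo) (`|D k w|)%:E) < +oo)%E.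
  rewrite integral_nneseries//; last first.
    by move=> k; apply/measurable_EFinP.
  apply: (@le_lt_trans _ _ (2 : R)%:E); last exact: ltry.
  apply: lime_le; first by apply: is_cvg_nneseries => k _ _; exact: integral_ge0.
  apply: nearW => n.
  apply: (@le_trans _ _ (2 - 2 * 2 ^- n : R)%:E); last first.
    by rewrite lee_fin gerBl mulr_ge0// invr_ge0 exprn_ge0.
  elim: n => [|n IH]; first by rewrite big_geq// expr0 invr1 mulr1 subrr.
  rewrite big_nat_recr//=; apply: (@le_trans _ _ ((2 - 2 * 2 ^- n)%:E + (2 ^- n)%:E)%E).
    have h : (\int[Q]_w (`|D n w|)%:E <= (2 ^- n)%:E)%E.
      by rewrite -(fineK (integrable_fin_num measurableT (iD n))) lee_fin; exact: ED.
    exact: leeD IH h.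
  rewrite -EFinD lee_fin exprS invfM; move: (2 ^- n : R) => *; lra.
have iS : Q.-integrable setT (fun w => (\sum_(k <oo) (`|D k w|)%:E)%E).
  apply/integrableP; split.
    by apply: ge0_emeasurable_sum => // k _; apply/measurable_EFinP.
  rewrite (eq_integral (fun w => (\sum_(k <oo) (`|D k w|)%:E)%E))// => w _.
  by rewrite gee0_abs// nneseries_ge0.
have := integrable_ae measurableT iS.
apply: filterS => w /(_ Logic.I) hw.
have cD : cvgn (series (fun k => D k w)).
  apply: normed_cvg; apply: nondecreasing_is_cvgn.
    by apply: (nondecreasing_series (P := xpredT)) => n _ _; exact: normr_ge0.
  exists (fine (\sum_(k <oo) (`|D k w|)%:E)%E) => _ [n _ <-].
  rewrite -lee_fin fineK// /series /= -sumEFin.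
  exact: nneseries_lim_ge.
have -> : (fun k => M (phi k) w) = (fun k => M (phi 0%N) w + series (fun k => D k w) k).
  by apply/funext => k; rewrite (eq_sum_telescope (fun k => M (phi k) w)).
by apply: is_cvgD => //; exact: is_cvg_cst.
Qed.

End bounded_expectation.

Lemma powR_expR (R : realType) (x r : R) : expR x `^ r = expR (r * x).
Proof. by rewrite /powR gt_eqF ?expR_gt0// expRK. Qed.

Lemma powR_cvg_seq (R : realType) (u : nat -> R) (l r : R) : 0 < r ->
  (forall n, 0 <= u n) -> u n @[n --> \oo] --> l -> u n `^ r @[n --> \oo] --> l `^ r.
Proof.
move=> r0 u0 ul.
have l0 : 0 <= l by apply: (cvgr_to_ge ul); apply: nearW.
have [l_gt0|l_le0] := ltP 0 l.
  have cl : {for l, continuous (fun x : R => x `^ r)}.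
    apply/differentiable_continuous/derivable1_diffP.
    by apply: derivable_powR; rewrite in_itv/= l_gt0.
  exact: (cvg_comp _ _ ul cl).
have {l_le0 l0}l0 : l = 0 by apply/eqP; rewrite eq_le l0 l_le0.
rewrite l0 powR0 ?gt_eqF//; apply/cvgrPdist_lt => e e0; rewrite l0 in ul.
have e1 : 0 < e `^ r^-1 by exact: powR_gt0.
have /cvgrPdist_lt/(_ _ e1) := ul; apply: filterS => n; rewrite sub0r normrN.
rewrite sub0r normrN ger0_norm// ger0_norm ?powR_ge0// => h.
have := gt0_ltr_powR r0 (u0 n) (powR_ge0 e r^-1) h.
by rewrite -powRrM mulVf ?gt_eqF// powRr1// ltW.
Qed.

(** The bound [1 - e^(- r)], rather than [r], is itself a Laplace functional when [r] is a pairing,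
    so its expectation is available without any moment. *)
Lemma expR_diff_le (R : realType) (a b r : R) : 0 <= a -> 0 <= b -> `|a - b| <= r ->
  `|expR (- a) - expR (- b)| <= 1 - expR (- r).
Proof.
have aux x y : 0 <= x -> x <= y -> y - x <= r -> `|expR (- x) - expR (- y)| <= 1 - expR (- r).
  move=> x0 xy yr.
  have h : expR (- y) = expR (- x) * expR (- (y - x)) by rewrite -expRD; congr expR; ring.
  have h1 : expR (- x) <= 1 by rewrite -expR0 ler_expR oppr_le0.
  have h2 : expR (- r) <= expR (- (y - x)) by rewrite ler_expR lerN2.
  have h3 : expR (- (y - x)) <= 1 by rewrite -expR0 ler_expR oppr_le0 subr_ge0.
  rewrite h -[X in X - _]mulr1 -mulrBr ger0_norm; last first.
    by rewrite mulr_ge0 ?expR_ge0// subr_ge0.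
  by apply: le_trans (_ : _ <= 1 - expR (- (y - x))) _; rewrite ?ler_piMl ?subr_ge0// lerB.
move=> a0 b0 abr; have [ab|/ltW ba] := leP a b.
  by apply: aux => //; rewrite (le_trans _ abr)// distrC ler_norm.
by rewrite distrC; apply: aux => //; rewrite (le_trans _ abr)// ler_norm.
Qed.

(** * Limit of the wave martingale and of its powers *)

Section wave_limit.
Context {R : realType} {psi : R -> R} {al ls : R}.
Hypothesis M : mechanism psi al ls.
Let al0 := mech_al M.
Let ls0 := mech_ls M.
Context {c lam : R} {Phi : R -> R}.
Hypothesis (lam0 : 0 < lam) (lamc : lam <= c) (clam : c = al / lam + lam / 2).
Hypothesis wave : travelling_wave psi ls c Phi.
Context {d : measure_display} {W : measurableType d} {X : R -> W -> MF R}
  {P : MF R -> probability W R}.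
Hypothesis hX : super_brownian_motion psi X P.

Let Q : probability W R := P (@dirac_zero R).

Let Phi0 x : 0 <= Phi x. Proof. exact: ltW (wave_gt0 M wave x). Qed.

Let Y (n : nat) (x : R) (w : W) := pairing (fun z => Phi (z + (x + c * n%:R))) (X n%:R w).

Let Y_ge0 n x w : 0 <= Y n x w.
Proof. by apply: pairing_ge0 => z. Qed.

Let expY_itv n x w : 0 <= expR (- Y n x w) <= 1.
Proof. by apply: expR_pairing_itv => z. Qed.

Let measurable_expY n x : measurable_fun setT (fun w => expR (- Y n x w)).
Proof.
by apply: (measurable_expR_pairing hX) => //; exact: (wave_bounded_continuous M wave).
Qed.

Let expY_expectation n x : \int[Q]_w expR (- Y n x w) = expR (- Phi x).
Proof.
have b := wave_bounded_continuous M wave (x + c * n%:R).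
have h := wave_evolution M wave (x + c * n%:R).
rewrite /Rintegral (sbm_expectation hX (@dirac_zero R) b (fun z => Phi0 _) h (ler0n _ n)) /=.
rewrite pairing_dirac_zero; first by congr (expR (- Phi _)); ring.
by apply: evolution_bounded_continuous h (ler0n _ n); exact: b.1.
Qed.

Let N n w := expR (- Y n 0 w).

Let N_orthogonal n m : (n <= m)%N ->
  \int[Q]_w (N m w * N n w) = \int[Q]_w (N n w * N n w).
Proof.
move=> nm.
have b a := wave_bounded_continuous M wave a.
have h := wave_evolution M wave (0 + c * m%:R).
have := sbm_markov_product hX (@dirac_zero R) (b _) (fun z => Phi0 _) (b (0 + c * n%:R))
  (fun z => Phi0 _) h (ler0n _ n) (ler0n _ (m - n)).
have -> : n%:R + (m - n)%:R = m%:R :> R by rewrite -natrD subnKC.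
move=> e.
transitivity (\int[Q]_w (expR (- pairing (fun z => Phi (z + (0 + c * m%:R) - c * (m - n)%:R))
    (X n%:R w)) * N n w)); first exact: (congr1 fine e).
apply: eq_Rintegral => w _.
have -> // : (fun z => Phi (z + (0 + c * m%:R) - c * (m - n)%:R)) =
    (fun z => Phi (z + (0 + c * n%:R))).
have mn : (m - n)%:R = m%:R - n%:R :> R := natrB R nm.
have zE z : z + (0 + c * m%:R) - c * (m - n)%:R = z + (0 + c * n%:R).
  by rewrite mn; move: (m%:R : R) (n%:R : R) => *; ring.
by apply/funext => z; rewrite zE.
Qed.

Let v0 : R -> R := critical_profile al.

(** To the right of [A] the ratio limit bounds the difference by [e Phi]. To the left the difference
    is at most [B], and there [f] equals [B], as [C v0] is nonincreasing and takes the value [B] at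
    [A]. *)
Let wave_difference (x e : R) : 0 < e -> exists (C : R) (f : R -> R),
  [/\ 0 <= C, bounded_continuous f, (forall z, 0 <= f z), (forall z, f z <= C * v0 z)
    & forall z, `|Phi (z + x) - expR (- (lam * x)) * Phi z| <= e * Phi z + f z].
Proof.
move=> e0; set r := expR _.
have v_gt0 z : 0 < v0 z by exact: (critical_profile_gt0 M).
have v_dec y z : y <= z -> v0 z <= v0 y by exact: (critical_profile_nincr M).
have v_cont : continuous v0 by exact: (critical_profile_continuous M).
have r0 : 0 < r by exact: expR_gt0.
have [A hA] := cvgy_dist (@wave_ratio_cvg _ _ _ _ M _ _ wave _ lam0 lamc clam x) e0.
pose B := (1 + r) * ls; have B0 : 0 < B by rewrite mulr_gt0// addr_gt0.
pose C := B / v0 A; have C0 : 0 < C by rewrite divr_gt0.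
pose f z := Num.min B (C * v0 z).
have f0 z : 0 <= f z by rewrite le_min (ltW B0) mulr_ge0// ltW.
exists C, f; split => //; first exact: ltW.
- split.
    have -> : f = fun z => (B + C * v0 z - `|B - C * v0 z|) / 2.
      by apply/funext => z; rewrite /f minr_absE.
    move=> z; have Cz : C * v0 y @[y --> z] --> C * v0 z.
      by apply: cvgM; [exact: cvg_cst|exact: v_cont].
    apply: cvgM; last exact: cvg_cst.
    apply: cvgB; first by apply: cvgD; [exact: cvg_cst|exact: Cz].
    by apply: cvg_norm; apply: cvgB; [exact: cvg_cst|exact: Cz].
  by exists B => z; rewrite ger0_norm// ge_min lexx.
- by move=> z; rewrite ge_min lexx orbT.
move=> z; have Pz := wave_gt0 M wave z.
have [Az|zA] := leP A z.
  apply: (@le_trans _ _ (e * Phi z)); last by rewrite lerDl.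
  have -> : Phi (z + x) - r * Phi z = (Phi (z + x) / Phi z - r) * Phi z.
    by field; rewrite gt_eqF.
  by rewrite normrM (gtr0_norm Pz) ler_wpM2r ?ltW// hA.
have -> : f z = B.
  apply/min_idPl; rewrite /C -mulrA ler_peMr ?(ltW B0)//.
  by rewrite mulrC ler_pdivlMr// mul1r v_dec// ltW.
apply: (@le_trans _ _ B); last by rewrite lerDr mulr_ge0 ?(ltW e0)// ltW.
rewrite (le_trans (ler_normB _ _))// normrM !ger0_norm ?(ltW r0)//.
by rewrite /B mulrDl mul1r lerD ?(wave_le_ls wave)// ler_wpM2l ?(ltW r0)// (wave_le_ls wave).
Qed.

(** The expectation is [1 - e^(- u 0 n) <= u 0 n], which [critical_decay] controls. That estimate
    concerns the minimal speed, but [c] is no smaller and the profile is nonincreasing, so it covers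
    every [c]. *)
Let decay (f : R -> R) (C : R) : 0 <= C -> bounded_continuous f -> (forall z, 0 <= f z) ->
  (forall z, f z <= C * v0 z) ->
  \int[Q]_w (1 - expR (- pairing (fun z => f (z + (0 + c * n%:R))) (X n%:R w))) @[n --> \oo]
    --> (0 : R).
Proof.
move=> C0 fb f0 fC.
have [D D0 hD] := critical_decay M.
have fbn n : bounded_continuous (fun z => f (z + (0 + c * n%:R))).
  have [fc [B hB]] := fb; split; last by exists B.
  move=> z; apply: (@continuous_comp _ _ _ (fun z => z + (0 + c * n%:R)) f); last exact: fc.
  by apply: cvgD; [exact: cvg_id|exact: cvg_cst].
have lc : Num.sqrt (2 * al) <= c.
  have c0 : 0 <= c by rewrite (le_trans (ltW lam0)).
  by rewrite -(ger0_norm c0) -sqrtr_sqr ler_sqrt ?sqr_ge0// (wave_speed_ge M wave c0).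
have key n : 0 <= \int[Q]_w (1 - expR (- pairing (fun z => f (z + (0 + c * n%:R))) (X n%:R w)))
    <= C * D n.
  have [u [hu _] _] := sbm_laplace hX (fbn n) (fun z => f0 _).
  have ub := evolution_bounded_continuous (fbn n).1 hu (ler0n _ n).
  have u0 : 0 <= u 0 n%:R by case: hu => + _ _ _ _; apply.
  have uC : u 0 n%:R <= C * D n.
    apply: (hD _ _ _ _ C0 hu) => y; rewrite (le_trans (fC _))// ler_wpM2l//.
    by apply: (critical_profile_nincr M); rewrite add0r lerD2l ler_wpM2r.
  rewrite RintegralB//; last 2 first.
  - by apply: (@bounded_integrable _ _ _ _ _ 1) => // w; rewrite normr1.
  - apply: (@bounded_integrable _ _ _ _ _ 1); first exact: (measurable_expR_pairing hX).
    move=> w; have /andP[h1 h2] := expR_pairing_itv (X n%:R w) (fun z => f0 (z + (0 + c * n%:R))).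
    by rewrite ger0_norm.
  rewrite Rintegral_probability_cst.
  have -> : \int[Q]_w expR (- pairing (fun z => f (z + (0 + c * n%:R))) (X n%:R w)) =
      expR (- u 0 n%:R).
    rewrite /Rintegral (sbm_expectation hX (@dirac_zero R) (fbn n) (fun z => f0 _) hu (ler0n _ n)) /=.
    by rewrite pairing_dirac_zero.
  have h1 := expR_ge1Dx (- u 0 n%:R).
  have h2 : expR (- u 0 n%:R) <= 1 by rewrite -[leRHS]expR0 ler_expR oppr_le0.
  by apply/andP; split; lra.
have CD0 : C * D n @[n --> \oo] --> (0 : R).
  by rewrite -(mulr0 C); apply: cvgM; [exact: cvg_cst|exact: D0].
apply: (@squeeze_cvgr _ _ _ _ (cst 0) (fun n => C * D n)) => //; last exact: cvg_cst.
by apply: nearW => n; exact: key.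
Qed.

Let N_power x n w : N n w `^ expR (- (lam * x)) = expR (- (expR (- (lam * x)) * Y n 0 w)).
Proof. by rewrite /N powR_expR mulrN. Qed.

(** [Y n x] and [r * Y n 0] differ by at most [h * Y n 0] plus a term killed by [decay]. No bound on
    the size of [Y n 0] enters: with [h = e^(- lam b)] the error [h * Y n 0] is at most [Y n b],
    whose Laplace functional has mean [e^(- Phi b)], close to 1 uniformly in [n]. *)
Let expY_power_expectation x :
  \int[Q]_w (N n w `^ expR (- (lam * x))) @[n --> \oo] --> expR (- Phi x).
Proof.
set r := expR _; have r0 : 0 < r by exact: expR_gt0.
apply/cvgrPdist_le => e e0.
have e2 : 0 < e / 2 by rewrite divr_gt0.
have [b b0 hb] : exists2 b, 0 <= b & Phi b <= e / 2.
  have [A hA] := cvgy_dist (wave_cvgy wave) e2.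
  exists (Num.max 0 A); first by rewrite le_max lexx.
  by have := hA (Num.max 0 A); rewrite le_max lexx orbT subr0 ger0_norm// => /(_ isT)/ltW.
pose h := expR (- (lam * b)); have h0 : 0 < h by exact: expR_gt0.
have [C [f [C0 fb f0 fC fdiff]]] := wave_difference x h0.
have Fcvg := decay C0 fb f0 fC.
pose F n w := pairing (fun z => f (z + (0 + c * n%:R))) (X n%:R w).
have F0 n w : 0 <= F n w by apply: pairing_ge0 => z.
have fbn n : bounded_continuous (fun z => f (z + (0 + c * n%:R))).
  have [fc [B hB]] := fb; split; last by exists B.
  move=> z; apply: (@continuous_comp _ _ _ (fun z => z + (0 + c * n%:R)) f); last exact: fc.
  by apply: cvgD; [exact: cvg_id|exact: cvg_cst].
have wb a := wave_bounded_continuous M wave a.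
have diffY n w : `|Y n x w - r * Y n 0 w| <= Y n b w + F n w.
  have hY : h * Y n 0 w <= Y n b w.
    rewrite -pairingZ//; apply: le_pairing => //; first exact: bounded_continuousZ.
    move=> z; have := wave_shift_ge M wave lam0 lamc clam (z + (0 + c * n%:R)) b0.
    by rewrite (_ : z + (0 + c * n%:R) + b = z + (b + c * n%:R))//; ring.
  apply: (@le_trans _ _ (h * Y n 0 w + F n w)); last by rewrite lerD2r.
  have zE z : z + (x + c * n%:R) = z + (0 + c * n%:R) + x by ring.
  pose a : R := 0 + c * n%:R.
  have eR : r * Y n 0 w = pairing (fun z => r * Phi (z + a)) (X n%:R w) by rewrite pairingZ.
  have bh : bounded_continuous (fun z => h * Phi (z + a)) by exact: bounded_continuousZ.
  have br : bounded_continuous (fun z => r * Phi (z + a)) by exact: bounded_continuousZ.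
  have eS : h * Y n 0 w + F n w = pairing (fun z => h * Phi (z + a) + f (z + a)) (X n%:R w).
    by rewrite (pairingD (X n%:R w) bh (fbn n)) (pairingZ h (X n%:R w) (wb a)).
  have bS : bounded_continuous (fun z => h * Phi (z + a) + f (z + a)).
    exact: bounded_continuousD bh (fbn n).
  have hz z : `|Phi (z + (x + c * n%:R)) - r * Phi (z + a)| <= h * Phi (z + a) + f (z + a).
    by rewrite zE; exact: fdiff.
  rewrite eS eR ler_distl; apply/andP; split.
    rewrite lerBlDr -pairingD//; apply: le_pairing => //.
      exact: (bounded_continuousD (wb (x + c * n%:R)) bS).
    by move=> z; rewrite -lerBlDr; have := hz z; rewrite ler_distl => /andP[].
  rewrite -pairingD//; apply: le_pairing => //; first exact: bounded_continuousD br bS.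
  by move=> z; have := hz z; rewrite ler_distl => /andP[].
have iY n y : Q.-integrable setT (EFin \o (fun w => expR (- Y n y w))).
  apply: (@bounded_integrable _ _ _ _ _ 1) => // w.
  by have /andP[h1 h2] := expY_itv n y w; rewrite ger0_norm.
have iF n : Q.-integrable setT (EFin \o (fun w => 1 - expR (- F n w))).
  apply: (@bounded_integrable _ _ _ _ _ 1).
    by apply: measurable_funB => //; exact: (measurable_expR_pairing hX).
  move=> w; have h1 := expR_ge0 (- F n w).
  have h2 : expR (- F n w) <= 1 by rewrite -[leRHS]expR0 ler_expR oppr_le0.
  by rewrite ger0_norm ?subr_ge0// gerBl.
have mN n : measurable_fun setT (fun w => N n w `^ r).
  exact: (measurableT_comp (measurable_powR r) (measurable_expY n 0)).
have iN n : Q.-integrable setT (EFin \o (fun w => N n w `^ r)).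
  apply: (@bounded_integrable _ _ _ _ _ 1) => // w.
  rewrite N_power ger0_norm ?expR_ge0// -[leRHS]expR0 ler_expR oppr_le0.
  by rewrite mulr_ge0 ?(ltW r0)// Y_ge0.
have i1 : Q.-integrable setT (EFin \o (fun=> 1 : R)).
  by apply: (@bounded_integrable _ _ _ _ _ 1) => // w; rewrite normr1.
have i1Y n y : Q.-integrable setT (EFin \o (fun w => 1 - expR (- Y n y w))).
  exact: (integrableB measurableT i1 (iY n y)).
have bound n w : `|expR (- Y n x w) - N n w `^ r| <=
    (1 - expR (- Y n b w)) + (1 - expR (- F n w)).
  rewrite N_power -/r; apply: (@le_trans _ _ (1 - expR (- (Y n b w + F n w)))).
    by apply: expR_diff_le => //; exact: mulr_ge0 (ltW r0) (Y_ge0 _ _ _).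
  rewrite opprD expRD.
  have h1 : expR (- Y n b w) <= 1 by rewrite -[leRHS]expR0 ler_expR oppr_le0.
  have h2 : expR (- F n w) <= 1 by rewrite -[leRHS]expR0 ler_expR oppr_le0.
  have : 0 <= (1 - expR (- Y n b w)) * (1 - expR (- F n w)) by rewrite mulr_ge0// subr_ge0.
  move: (expR (- Y n b w)) (expR (- F n w)) => p q; lra.
have main n : `|expR (- Phi x) - \int[Q]_w (N n w `^ r)| <=
    (1 - expR (- Phi b)) + \int[Q]_w (1 - expR (- F n w)).
  rewrite -(expY_expectation n x) -RintegralB//.
  apply: (le_trans (le_normr_Rintegral _ _)) => //.
    exact: (integrableB measurableT (iY n x) (iN n)).
  have <- : \int[Q]_w (1 - expR (- Y n b w)) = 1 - expR (- Phi b).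
    by rewrite RintegralB// Rintegral_probability_cst expY_expectation.
  rewrite -RintegralD//; apply: le_Rintegral => //.
    exact: (integrable_abse (integrableB measurableT (iY n x) (iN n))).
  exact: (integrableD measurableT (i1Y n b) (iF n)).
have nearF : \forall n \near \oo, \int[Q]_w (1 - expR (- F n w)) < e / 2.
  exact: (cvgr_lt _ Fcvg _ e2).
apply: filterS nearF => n hn.
apply: (le_trans (main n)).
have := expR_ge1Dx (- Phi b).
move: hn hb; move: (\int[Q]_w _) (expR (- Phi b)) => *; lra.
Qed.

(** The moments of [L] are limits of those of the bounded [N]. The value 1 holds on every
    extinguishing path, without exceptional set, since there [Y n 0 <= ls |X_n|] tends to 0. *)
Lemma wave_martingale_limit : exists2 L : W -> R, [/\ measurable_fun setT L, (forall w, 0 <= L w <= 1)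
    & (forall w, extinguishing X w -> L w = 1)] &
  forall x, \int[Q]_w (L w `^ expR (- (lam * x))) = expR (- Phi x).
Proof.
have [phi phik cN] := orthogonal_increments_subsequence (fun n => measurable_expY n 0)
  (fun n => expY_itv n 0) N_orthogonal.
have phioo : phi k @[k --> \oo] --> \oo.
  move=> A [n _ hn]; exists n => // k /= nk; apply: hn => /=; exact: leq_trans nk (phik k).
pose u w k := N (phi k) w.
(* The clipped upper limit is measurable and in [[0, 1]] everywhere, and equals the limit wherever
   it exists. *)
pose L w : R := Num.max 0 (Num.min 1 (limn_sup (u w))).
have LE w (l : R) : 0 <= l <= 1 -> u w k @[k --> \oo] --> l -> L w = l.
  move=> /andP[l0 l1] ul; rewrite /L cvg_limn_supE; last by apply/cvg_ex; exists l.
  by rewrite (cvg_lim _ ul)// (min_idPr l1) (max_idPr l0).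
have mL : measurable_fun setT L.
  apply: measurable_maxr => //; apply: measurable_minr => //.
  apply: (measurable_fun_limn_sup (h := fun k w => u w k)).
  - by move=> w _; exists 1 => _ [k _ <-]; case/andP: (expY_itv (phi k) 0 w).
  - by move=> w _; exists 0 => _ [k _ <-]; case/andP: (expY_itv (phi k) 0 w).
  - by move=> k; exact: measurable_expY.
exists L.
  split => //.
    by move=> w; rewrite le_max lexx/= ge_max ler01/= ge_min lexx.
  move=> w; rewrite /extinguishing /= => hw; apply: LE; first by rewrite ler01 lexx.
  have c1 : pairing (cst 1) (X n%:R w) @[n --> \oo] --> (0 : R).
    exact: (cvg_comp _ _ (@cvgr_idn R) hw).
  have c2 : Y n 0 w @[n --> \oo] --> (0 : R).
    apply: (@squeeze_cvgr _ _ _ _ (cst 0) (fun n => ls * pairing (cst 1) (X n%:R w))).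
    - apply: nearW => n; rewrite Y_ge0 /= -pairing_cst; apply: le_pairing.
      + exact: (wave_bounded_continuous M wave).
      + exact: bounded_continuous_cst.
      + by move=> z; exact: (wave_le_ls wave).
    - exact: cvg_cst.
    - by rewrite -(mulr0 ls); apply: cvgM; [exact: cvg_cst|exact: c1].
  have c3 : N n w @[n --> \oo] --> (1 : R).
    have {}c2 : - Y n 0 w @[n --> \oo] --> (0 : R) by rewrite -[X in _ --> X]oppr0; exact: cvgN.
    rewrite -[X in _ --> X]expR0; exact: (cvg_comp _ expR c2 (@continuous_expR R 0)).
  exact: (cvg_comp _ _ phioo c3).
move=> x; set r := expR (- (lam * x)); have r0 : 0 < r by exact: expR_gt0.
have mf k : measurable_fun setT (fun w => (u w k `^ r)%:E).
  apply/measurable_EFinP.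
  exact: (measurableT_comp (measurable_powR r) (measurable_expY (phi k) 0)).
have mLr : measurable_fun setT (fun w => (L w `^ r)%:E).
  by apply/measurable_EFinP; exact: (measurableT_comp (measurable_powR r) mL).
have i1 : Q.-integrable setT (EFin \o (fun=> 1 : R)).
  by apply: (@bounded_integrable _ _ _ _ _ 1) => // w; rewrite normr1.
have cf : {ae Q, forall w, setT w -> ((u w k `^ r)%:E @[k --> \oo] --> (L w `^ r)%:E)%E}.
  apply: filterS cN => w cw _; apply/cvg_EFin; first exact: nearW.
  apply: powR_cvg_seq => //; first by move=> k; case/andP: (expY_itv (phi k) 0 w).
  rewrite (LE w (limn (u w)))//.
  apply/andP; split.
    by apply: limr_ge => //; apply: nearW => k; case/andP: (expY_itv (phi k) 0 w).
  by apply: limr_le => //; apply: nearW => k; case/andP: (expY_itv (phi k) 0 w).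
have fg : {ae Q, forall w k, setT w -> (`|(u w k `^ r)%:E| <= (1%R : R)%:E)%E}.
  apply: aeW => w k _; rewrite /= lee_fin ger0_norm ?powR_ge0// N_power.
  by rewrite -[leRHS]expR0 ler_expR oppr_le0 mulr_ge0 ?(ltW r0)// Y_ge0.
have [iL _ cI] := dominated_convergence measurableT mf mLr cf i1 fg.
have c4 : \int[Q]_w (u w k `^ r) @[k --> \oo] --> \int[Q]_w (L w `^ r).
  by apply: fine_cvg; rewrite fineK; [exact: cI|exact: integrable_fin_num].
have c5 : \int[Q]_w (u w k `^ r) @[k --> \oo] --> expR (- Phi x).
  have cE := @expY_power_expectation x.
  exact: (@cvg_comp _ _ _ phi (fun n => \int[Q]_w (N n w `^ r)) _ _ _ phioo cE).
exact: (cvg_unique _ c4 c5).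
Qed.

End wave_limit.

(** * The wave as a Laplace transform, and the event [Delta = 0] *)

Section wave_representation.
Context {R : realType} {psi : R -> R} {al ls : R}.
Hypothesis M : mechanism psi al ls.
Context {c lam : R} {Phi : R -> R}.
Hypothesis (lam0 : 0 < lam) (lamc : lam <= c) (clam : c = al / lam + lam / 2).
Hypothesis wave : travelling_wave psi ls c Phi.
Context {d : measure_display} {W : measurableType d} {X : R -> W -> MF R}
  {P : MF R -> probability W R}.
Hypothesis hX : super_brownian_motion psi X P.

Let Q : probability W R := P (@dirac_zero R).

Let indic_expectation (A : set W) (f : W -> R) : measurable A ->
  measurable_fun setT f -> (forall w, 0 <= f w <= 1) -> (forall w, A w -> f w = 1) ->
  fine (Q A) <= \int[Q]_w f w.
Proof.
move=> mA mf f01 fA.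
have <- : \int[Q]_w (\1_A w) = fine (Q A).
  by rewrite /Rintegral integral_indic// setIT.
apply: le_Rintegral => //.
- apply: (@bounded_integrable _ _ _ _ _ 1) => // w.
  by rewrite indicE ger0_norm ?ler0n// (ler_nat _ _ 1) leq_b1.
- apply: (@bounded_integrable _ _ _ _ _ 1) => // w.
  by have /andP[h1 h2] := f01 w; rewrite ger0_norm.
- move=> w _; rewrite indicE; have [/set_mem/fA ->//|_] := boolP (w \in A).
  by case/andP: (f01 w).
Qed.

Lemma wave_representation : exists Delta : {RV Q >-> R},
  [/\ (forall w, 0 <= Delta w),
      (\forall w \ae Q, Delta w = 0 <-> extinguishing X w)
    & forall x, - ln (fine ('E_Q [fun w => expR (- (expR (- (lam * x)) * Delta w))])%E) = Phi x].
Proof.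
have [L [mL L01 L1] EL] := wave_martingale_limit M lam0 lamc clam wave hX.
have L0 w : 0 <= L w by case/andP: (L01 w).
have Lr1 w (r : R) : 0 < r -> 0 <= L w `^ r <= 1.
  move=> r0; rewrite powR_ge0 /=.
  have : L w `^ r <= 1 `^ r.
    by apply: ge0_ler_powR; rewrite ?nnegrE ?(ltW r0)//; case/andP: (L01 w).
  by rewrite powR1.
have mLr (r : R) : measurable_fun setT (fun w => L w `^ r).
  exact: (measurableT_comp (measurable_powR r) mL).
(* [L = 0] stands for an infinite [Delta], which a real [- ln L] cannot express. On this event
   [1 - L^r = 1] for every [r > 0], so its probability is at most [1 - e^(- Phi x) <= Phi x], which
   tends to 0 as [x] tends to [+oo]. *)
pose Z := L @^-1` [set 0].
have mZ : measurable Z by rewrite -[Z]setTI; exact: mL.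
have QZ : Q Z = 0%E.
  have h x : fine (Q Z) <= Phi x.
    have r0 : 0 < expR (- (lam * x)) by exact: expR_gt0.
    have := indic_expectation mZ (f := fun w => 1 - L w `^ expR (- (lam * x))).
    move=> /(_ _ _ _); rewrite RintegralB//; last 2 first.
    - by apply: (@bounded_integrable _ _ _ _ _ 1) => // w; rewrite normr1.
    - apply: (@bounded_integrable _ _ _ _ _ 1) => // w.
      by have /andP[h1 h2] := Lr1 w _ r0; rewrite ger0_norm.
    rewrite Rintegral_probability_cst EL => h.
    have : fine (Q Z) <= 1 - expR (- Phi x).
      apply: h; first exact: measurable_funB.
        by move=> w; have /andP[h1 h2] := Lr1 w _ r0; rewrite subr_ge0 h2 gerBl.
      by move=> w /= ->; rewrite powR0 ?gt_eqF// subr0.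
    by have := expR_ge1Dx (- Phi x); lra.
  have : fine (Q Z) <= 0.
    by apply: (cvgr_to_ge (wave_cvgy wave)); apply: nearW.
  have Zfin : Q Z \is a fin_num by exact: fin_num_measure.
  move=> Z0; apply/eqP; rewrite eq_le measure_ge0 andbT.
  by rewrite -(fineK Zfin) lee_fin.
have mD : measurable_fun setT (fun w => - ln (L w)).
  by apply: measurable_funN; exact: (measurableT_comp (@measurable_ln R) mL).
exists (mfun_Sub (mem_set mD)).
have D0 w : 0 <= - ln (L w) by rewrite oppr_ge0 ln_le0//; case/andP: (L01 w).
have mE r : measurable_fun setT (fun w => expR (- (r * - ln (L w)))).
  apply: (measurableT_comp (@measurable_expR R)); apply: measurable_funN.
  by apply: measurable_funM.
have ED x : \int[Q]_w expR (- (expR (- (lam * x)) * - ln (L w))) = expR (- Phi x).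
  rewrite -EL; congr fine; apply: ae_eq_integral => //; try exact/measurable_EFinP.
  exists Z; split => // w /= h; apply: contrapT => Lw; apply: h => _.
  by rewrite mulrN opprK /powR ifF//; apply/eqP.
split => //=; last first.
  by move=> x; rewrite unlock -/(Rintegral _ _ _) ED expRK opprK.
have [E [mE' Eext]] := sbm_extinction M hX (@dirac_zero R).
rewrite pairing_dirac_zero ?mulr1; last exact: bounded_continuous_cst.
move=> QE.
pose D := (fun w => - ln (L w)) @^-1` [set 0].
have mDD : measurable D by rewrite -[D]setTI; exact: mD.
have extD w : extinguishing X w -> D w by move=> /L1 h; rewrite /D /= h ln1 oppr0.
(* On [D] the variable [e^(- r Delta)] is 1, so [Q D] is at most [e^(- Phi x)] for every [x]; now
   [x] tends to [-oo]. *)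
have QD : fine (Q D) <= expR (- ls).
  have h x : fine (Q D) <= expR (- Phi x).
    rewrite -ED; apply: indic_expectation => //.
      by move=> w; rewrite expR_ge0 -[leRHS]expR0 ler_expR oppr_le0 mulr_ge0// expR_ge0.
    by move=> w /= ->; rewrite mulr0 oppr0 expR0.
  have cv : expR (- Phi x) @[x --> -oo] --> expR (- ls).
    have cN : - Phi x @[x --> -oo] --> - ls by apply: cvgN; exact: (wave_cvgNy wave).
    exact: (cvg_comp _ expR cN (@continuous_expR R _)).
  by apply: (cvgr_to_ge cv); apply: nearW.
(* As [E] is included in the extinguishing paths and these in [D], any disagreement lies in this
   measurable set, which is null because [Q E >= e^(- ls) >= Q D]. *)
exists (D `\` E); split.
- exact: measurableD.
- have fq A : measurable A -> (fine (Q A))%:E = Q A.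
    by move=> mA; apply: fineK; exact: fin_num_measure.
  have mDE := measurableD mDD mE'.
  have DE : D `&` E = E by apply/setIidPr => w /Eext; exact: extD.
  have QDE : fine (Q D) = fine (Q (D `\` E)) + fine (Q E).
    by apply: EFin_inj; rewrite EFinD !fq//; have := measureDI Q mDD mE'; rewrite DE.
  have {}QE : expR (- ls) <= fine (Q E) by rewrite -lee_fin fq.
  have : fine (Q (D `\` E)) <= 0 by lra.
  rewrite -lee_fin fq// => DE0.
  by apply/eqP; rewrite eq_le measure_ge0 andbT; exact: DE0.
- move=> w /= hw; split.
    by apply: contrapT => Dw; apply: hw; split => // /extD.
  move=> Ew; apply: hw; split => [_|/extD//].
  exact: Eext.
Qed.

End wave_representation.

(** [L] is read off from the wave itself through [z = e^(- l x)], so the quotient is identically 1.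
    Slow variation is then the limit of [Phi (x + b) / Phi x] for the shift [b = - ln a / l]. *)
Lemma wave_slowly_varying (R : realType) (psi : R -> R) (al ls c l : R) (Phi : R -> R) :
  mechanism psi al ls -> travelling_wave psi ls c Phi ->
  0 < l -> l <= c -> c = al / l + l / 2 ->
  exists L : R -> R, slowly_varying0 L /\
    Phi x / (expR (- (l * x)) * L (expR (- (l * x)))) @[x --> +oo] --> (1 : R).
Proof.
move=> M W l0 lc cl.
have Phi0 x : 0 < Phi x by exact: (wave_gt0 M W).
pose L z := Phi (- ln z / l) / z.
exists L; split; [split|].
- by move=> z z0; rewrite divr_gt0.
- move=> a a0.
  pose b := - ln a / l.
  have h : expR (l * b) * (Phi (x + b) / Phi x) @[x --> +oo] --> (1 : R).
    rewrite -(expRxMexpNx_1 (l * b)); apply: cvgM; first exact: cvg_cst.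
    exact: (@wave_ratio_cvg _ _ _ _ M _ _ W _ l0 lc cl b).
  apply/cvgrPdist_lt => e e0.
  have [A hA] := cvgy_dist h e0.
  near=> z; have z0 : 0 < z by near: z; exact: nbhs_right_gt.
  have zA : A <= - ln z / l.
    rewrite ler_pdivlMr// lerNr -ler_expR lnK ?posrE//.
    by near: z; apply: nbhs_right_le; exact: expR_gt0.
  have -> : L (a * z) / L z = expR (l * b) * (Phi (- ln z / l + b) / Phi (- ln z / l)).
    rewrite /L lnM ?posrE// opprD mulrDl -/b [b + _]addrC.
    have -> : expR (l * b) = a^-1.
      by rewrite /b mulrCA divff ?gt_eqF// mulr1 expRN lnK.
    by field; rewrite !gt_eqF.
  by rewrite distrC hA.
- apply: cvg_near_cst; apply: nearW => x.
  rewrite /L expRK opprK [l * x]mulrC mulfK ?gt_eqF//.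
  have p0 := expR_gt0 (- (x * l)); have := Phi0 x.
  by move: (expR _) (Phi x) p0 => p q p0 q0; field; rewrite !gt_eqF.
Unshelve. all: by end_near. Qed.

Theorem theorem2p1 (R : realType) (psi : R -> R)
  (hpsi : branching_mechanism psi)
  (ls : R) (hls : largest_root psi ls)
  (d : measure_display) (W : measurableType d)
  (X : R -> W -> MF R) (P : MF R -> probability W R)
  (hX : super_brownian_motion psi X P) :
  [/\ (* (i) *)
      (integral_condition psi ls ->
       forall c : R, 0 <= c < wave_speed psi (lambda_min psi) ->
         ~ exists Phi : R -> R, travelling_wave psi ls c Phi),
      (* (ii) *)
      (forall c : R, wave_speed psi (lambda_min psi) <= c ->
         exists Phi : R -> R, travelling_wave psi ls c Phi) /\
      (forall l : R, 0 < l <= lambda_min psi ->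
         exists Delta : {RV (P (@dirac_zero R)) >-> R},
           [/\ (forall w, 0 <= Delta w),
               (\forall w \ae P (@dirac_zero R),
                  Delta w = 0 <-> extinguishing X w)
             & travelling_wave psi ls (wave_speed psi l)
                 (fun x => - ln (fine ('E_(P (@dirac_zero R))
                    [ fun w => expR (- (expR (- (l * x)) * Delta w)) ])%E))]),
      (* (iii) *)
      (forall l : R, 0 < l <= lambda_min psi ->
         (exists Phi : R -> R, travelling_wave psi ls (wave_speed psi l) Phi) /\
         forall Phi1 Phi2 : R -> R,
           travelling_wave psi ls (wave_speed psi l) Phi1 ->
           travelling_wave psi ls (wave_speed psi l) Phi2 ->
           exists a : R, forall x, Phi2 x = Phi1 (x + a))
    & (* (iv) *)
      (forall l : R, 0 < l <= lambda_min psi ->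
         forall Phi : R -> R, travelling_wave psi ls (wave_speed psi l) Phi ->
         exists (k : R) (L : R -> R),
           [/\ 0 < k, slowly_varying0 L
             & Phi x / (expR (- (l * x)) * L (expR (- (l * x))))
                 @[x --> +oo] --> k])].
Proof.
have [al M Hal] := branching_mechanismW hpsi hls.
have al0 := mech_al M.
have lmE : lambda_min psi = Num.sqrt (2 * al) by rewrite /lambda_min Hal mulrNN.
have lm0 : 0 < lambda_min psi by rewrite lmE sqrtr_gt0 mulr_gt0.
have lm2 : lambda_min psi ^+ 2 = 2 * al by rewrite lmE sqr_sqrtr// mulr_ge0// ltW.
have wsE (l : R) : wave_speed psi l = al / l + l / 2 by rewrite /wave_speed Hal opprK.
have wsm : wave_speed psi (lambda_min psi) = lambda_min psi.
  have -> : wave_speed psi (lambda_min psi) = lambda_min psi ^+ 2 / 2 / lambda_min psi + lambda_min psi / 2.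
    by rewrite wsE lm2; congr (_ / _ + _); field.
  by field; rewrite gt_eqF.
have lews (l : R) : 0 < l <= lambda_min psi -> l <= wave_speed psi l.
  move=> /andP[l0 ll]; rewrite wsE -subr_ge0.
  have -> : al / l + l / 2 - l = (lambda_min psi ^+ 2 - l ^+ 2) / (2 * l).
    by rewrite lm2; field; rewrite gt_eqF.
  by rewrite divr_ge0 ?mulr_ge0 ?(ltW l0)// subr_ge0 ler_pXn2r// nnegrE ltW.
have ws0 (l : R) : 0 < l <= lambda_min psi -> 0 <= wave_speed psi l.
  by move=> hl; case/andP: (hl) => l0 _; rewrite (le_trans (ltW l0))// lews.
have wsex (l : R) : 0 < l <= lambda_min psi ->
    exists Phi, travelling_wave psi ls (wave_speed psi l) Phi.
  by move=> /andP[l0 _]; rewrite wsE; exact: (wave_exists M l0 erefl).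
split.
- move=> _ c /andP[c0 cc] [Phi W0].
  have := wave_speed_ge M W0 c0; rewrite -lm2 leNgt ltr_pXn2r ?nnegrE ?(ltW lm0)//.
  by rewrite -wsm cc.
- split.
    move=> c; rewrite wsm => cc.
    have c0 : 0 < c by exact: lt_le_trans cc.
    have d0 : 0 <= c ^+ 2 - 2 * al.
      by rewrite subr_ge0 -lm2 ler_pXn2r ?nnegrE ?(ltW lm0)// ltW.
    (* [c - s] is the smaller root of [r^2 - 2 c r + 2 al], that is, a rate [l] with
       [c = al / l + l / 2]. *)
    pose s := Num.sqrt (c ^+ 2 - 2 * al).
    have s2 : s ^+ 2 = c ^+ 2 - 2 * al by rewrite sqr_sqrtr.
    have sc : s < c.
      rewrite -(ltr_pXn2r (ltn0Sn 1)) ?nnegrE ?sqrtr_ge0 ?(ltW c0)// s2.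
      by rewrite gtrBl mulr_gt0.
    have l0 : 0 < c - s by rewrite subr_gt0.
    have -> : c = al / (c - s) + (c - s) / 2.
      have -> : al = (c ^+ 2 - s ^+ 2) / 2 by rewrite s2; field.
      by field; rewrite gt_eqF.
    exact: (wave_exists M l0 erefl).
  move=> l hl; have /andP[l0 ll] := hl; have [Phi W0] := wsex l hl.
  have [Delta [D0 Dae DE]] := wave_representation M l0 (lews l hl) (wsE l) W0 hX.
  exists Delta; split => //.
  by have -> : (fun x => - ln (fine ('E_(P (@dirac_zero R))
    [fun w => expR (- (expR (- (l * x)) * Delta w))])%E)) = Phi by exact/funext.
- move=> l hl; split; first exact: wsex.
  by move=> Phi1 Phi2 W1 W2; exact: (wave_unique M W2 W1 (ws0 l hl)).
- move=> l hl Phi W0; have /andP[l0 _] := hl.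
  have [L [sL cL]] := wave_slowly_varying M W0 l0 (lews l hl) (wsE l).
  by exists 1, L.
Qed.
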